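(* Let $k\ge a\ge 1$, $n\ge 0$ and $N_1\ge N_2\ge\cdots\ge N_{k-1}\ge 0$ be integers. Let $\mathcal{B}_{N_1,\ldots,N_{k-1};a}(n)$ be the set of partitions enumerated by $B_{k,a}(n)$ whose Gordon marking has exactly $N_i$ $i$-marked parts for each $i=1,\dots,k-1$. Let $\mathcal{E}_{N_1,\ldots,N_{k-1};a}(n)$ be the set of lattice paths of major index $n$ that satisfy the special $(k,a)$-conditions and have exactly $N_i$ peaks with relative height greater than or equal to $i$ for each $i=1,\dots,k-1$. Let $\phi\times\psi$ be the explicit map described in the context: first $\phi$ sends a partition $\lambda_0$ to $(\mu,\pi^{(1)},\ldots,\pi^{(k-1)})$ by backward moves on clusters, then $\psi$ sends $(\mu,\pi^{(1)},\ldots,\pi^{(k-1)})$ to a lattice path $L$ by insertion and moving of peaks, insertion of South-East steps and volcanic uplifts. Then $\phi\times\psi$ is a bijection between $\mathcal{B}_{N_1,\ldots,N_{k-1};a}(n)$ and $\mathcal{E}_{N_1,\ldots,N_{k-1};a}(n)$.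
   Context: Partitions: a partition of $n$ is a non-increasing finite sequence $\lambda_1\ge\lambda_2\ge\cdots\ge\lambda_s>0$ of positive integers with sum $n$ (the empty partition is the only partition of $0$). For $k\ge a\ge 1$, $B_{k,a}(n)$ denotes the number of partitions $\lambda_1+\cdots+\lambda_s$ of $n$ such that $\lambda_j-\lambda_{j+k-1}\ge 2$ for all $j$ with $1\le j\le s-k+1$, and at most $a-1$ of the $\lambda_j$ are equal to $1$. Gordon marking: the Gordon marking of a partition $\lambda$ is an assignment of positive integers (marks) to the parts of $\lambda$ such that any two equal parts, as well as any two nearly equal parts $j$ and $j+1$, are assigned different marks, and the marks are as small as possible assuming that the marks are assigned to the parts in increasing order. A part is $i$-marked if its mark is $i$. An $r$-cluster is a sub-partition $\lambda_{i_1}\le\cdots\le\lambda_{i_r}$ such that $\lambda_{i_j}$ is $j$-marked for $j=1,\ldots,r$, $\lambda_{i_{j+1}}-\lambda_{i_j}\le 1$ for $j=1,\ldots,r-1$, and there are no $(r+1)$-marked parts equal to $\lambda_{i_r}$ or $\lambda_{i_r}+1$. Every partition with its Gordon marking decomposes uniquely into non-overlapping clusters. Put $n_r=N_r-N_{r+1}$ for $1\le r\le k-2$ and $n_{k-1}=N_{k-1}$; this is the number of $r$-clusters of a partition in $\mathcal{B}_{N_1,\ldots,N_{k-1};a}(n)$. Lattice paths: a lattice path is a path in the first quadrant ($x,y\ge 0$, integer vertices) that starts on the $y$-axis, ends on the $x$-axis, and uses unit steps of three kinds: North-East (NE) $(x,y)\to(x+1,y+1)$; South-East (SE) $(x,y)\to(x+1,y-1)$;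 East (E) $(x,0)\to(x+1,0)$, allowed only at height $0$. A path is either empty or ends with an SE step. The height of a vertex $(x,y)$ is $y$ and its weight is $x$. A peak is a vertex preceded by an NE step and followed by an SE step. The major index of a path is the sum of the weights of its peaks. A path satisfies the special $(k,a)$-conditions if it starts at height $k-a$ and its height is less than $k$. The relative height of a peak $(x,y)$ is the largest integer $h$ for which there are two vertices on the path, $(x',y-h)$ and $(x'',y-h)$, with $x'<x<x''$, such that between these two vertices there are no peaks of height $>y$ and every peak of height $y$ has abscissa $\ge x$. The map $\phi$: start with $\lambda=\lambda_0$ and with $\mu,\pi^{(1)},\ldots,\pi^{(k-1)}$ empty. For $r$ from $k-1$ down to $1$, as long as $\lambda$ has $r$-marked parts (then $r$ is the largest mark in $\lambda$), do the following. Let $m$ be the number of clusters already in $\mu$, and choose the $r$-cluster of $\lambda$ with the smallest $r$-marked part. Apply to this $r$-marked part the backward move of the $r$-th kind (a move which, in this situation, replaces the smallest $r$-marked part $x$ of $\lambda$ by $x-1$, after which the Gordon marking of $\lambda$ is recomputed; the followed part is then the smallest $r$-marked part of the new $\lambda$) repeatedly, until the cluster containing it has $a-1$ parts equal to $2m+1$ and $r-a+1$ parts equal to $2m+2$ if $r\ge a$, or has $r$ parts equal to $2m+1$ if $r\le a-1$. Record the number of moves made (possibly $0$) as a part of $\pi^{(r)}$, and transfer the cluster from $\lambda$ to $\mu$. When $\lambda$ is empty, $\mu$ has $n_r$ $r$-clusters and $\pi^{(r)}$ is a partition with $n_r$ nonnegative parts $\pi^{(r)}_1\ge\pi^{(r)}_2\ge\cdots$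 for each $r$, and $|\lambda_0|=|\mu|+|\pi^{(1)}|+\cdots+|\pi^{(k-1)}|$, where $|\cdot|$ denotes the sum of the parts. The map $\psi$: start with the empty path at $(0,0)$. For $i$ from $k-1$ down to $1$: (1) Insert $n_i$ peaks of relative height one at the start of the path, shifting the rest to the right: if $i\ge a$ the start point is $(0,k-i-1)$ and the peaks are at $(1,k-i),(3,k-i),\ldots,(2n_i-1,k-i)$; if $i\le a-1$ the start point is $(0,k-a)$ and the peaks are at $(1,k-a+1),(3,k-a+1),\ldots,(2n_i-1,k-a+1)$. (2) If $i\ge a$, add an SE step at the beginning, starting at $(0,k-i)$, so the weight of every peak increases by one. (3) For $j=1,\ldots,n_i$, move the $j$-th peak of relative height one, counted from right to left, to the right $\pi^{(i)}_j$ times by Bressoud's rule: one move interchanges the two steps NE, SE forming the peak with the step following them (i.e. NE,SE,$s$ becomes $s$,NE,SE; at the end of the path an E step is inserted before the peak), which increases the weight of that peak by one; if the moved peak $(x,y)$ then has another peak at $(x+2,y)$ and thereby loses relative height one, the next move is applied instead to that following peak, which now has relative height one. (4) If $i\ge 2$, perform the volcanic uplift: at each peak break the path, spread it apart by two units, and insert a new peak whose height is one more than the old (i.e. replace the NE, SE at each peak by NE, NE, SE, SE); then replace $i$ by $i-1$. If $i=1$, the resulting path is $L$. *)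

(* Defs.v *)
From mathcomp Require Import all_boot.
From mathcomp Require Import classical_sets functions.

Set Implicit Arguments.
Unset Strict Implicit.
Unset Printing Implicit Defensive.

Local Open Scope nat_scope.

(** * Partitions and Gordon markings *)

Definition is_partition (n : nat) (la : seq nat) : bool :=
  [&& sorted geq la, 0 \notin la & sumn la == n].

(* The partitions enumerated by B_{k,a}(n); lambda_(j+1) is [nth 0 la j]. *)
Definition gordon_partition (k a n : nat) (la : seq nat) : Prop :=
  [/\ is_partition n la,
      forall j, j + k.-1 < size la ->
        2 <= nth 0 la j - nth 0 la (j + k.-1)
    & count_mem 1 la <= a.-1].

(* Least positive integer not in [s]; it is at most [(size s).+1]. *)
Definition least_mark (s : seq nat) : nat :=
  (find (fun i => i.+1 \notin s) (iota 0 (size s).+1)).+1.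

(* [M] lists (part, mark) pairs, all of parts at most [v]. *)
Definition mark_next (M : seq (nat * nat)) (v : nat) : seq (nat * nat) :=
  rcons M
    (v, least_mark [seq p.2 | p <- M & (p.1 == v) || (p.1.+1 == v)]).

(* The list of (part, mark) pairs, by increasing part; only the multiset of
   parts of [la] matters. *)
Definition gordon_marking (la : seq nat) : seq (nat * nat) :=
  foldl mark_next [::] (sort leq la).

(* The r-marked parts of [la], in increasing order. *)
Definition marked (r : nat) (la : seq nat) : seq nat :=
  [seq p.1 | p <- gordon_marking la & p.2 == r].

Definition B_set (k a : nat) (N : nat -> nat) (n : nat) : set (seq nat) :=
  [set la | gordon_partition k a n la /\
            forall i, 1 <= i <= k.-1 -> size (marked i la) = N i]%classic.

(** * Clusters *)

(* All sequences x_1 <= ... <= x_r with x_j a j-marked part of [la] and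
   x_(j+1) - x_j <= 1. *)
Fixpoint marked_chains (r : nat) (la : seq nat) : seq (seq nat) :=
  match r with
  | 0 => [:: [::]]
  | j.+1 =>
      [seq rcons c v | c <- marked_chains j la,
         v <- [seq v <- marked j.+1 la |
                 (c == [::]) || (last 0 c <= v <= (last 0 c).+1)]]
  end.

Definition clusters (r : nat) (la : seq nat) : seq (seq nat) :=
  [seq c <- marked_chains r la |
     (last 0 c \notin marked r.+1 la) &&
     ((last 0 c).+1 \notin marked r.+1 la)].

(* The r-cluster of [la] whose r-marked part is the smallest one. *)
Definition first_cluster (r : nat) (la : seq nat) : option (seq nat) :=
  ohead [seq c <- clusters r la | last 0 c == head 0 (marked r la)].

(** * The map phi *)

(* When r is the largest mark of [la]: the backward move of the r-th kind,
   applied to the smallest r-marked part. *)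
Definition backward_move (r : nat) (la : seq nat) : seq nat :=
  let x := head 0 (marked r la) in x.-1 :: rem x la.

(* The final position of an r-cluster when [m] clusters are already in mu. *)
Definition in_place (a r m : nat) (c : seq nat) : bool :=
  if a <= r
  then (count_mem (2 * m + 1) c == a - 1) &&
       (count_mem (2 * m + 2) c == r - a + 1)
  else count_mem (2 * m + 1) c == r.

(* Move the first r-cluster of [la] into place: the number of moves made, the
   cluster in its final position, and what is left of [la] once the cluster is
   removed; [None] if the position is never reached. A move lowers the sum of
   the parts by one, so at most [sumn la] moves are possible. *)
Definition settle_cluster (a r m : nat) (la : seq nat) :
    option (nat * seq nat * seq nat) :=
  let settled la' := oapp (in_place a r m) false (first_cluster r la') in
  let t := find settled (traject (backward_move r) la (sumn la).+1) in
  let la' := iter t (backward_move r) la in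
  if t <= sumn la
  then omap (fun c => (t, c, foldl (fun l x => rem x l) la' c))
            (first_cluster r la')
  else None.

(* Stage r of phi on (lambda, mu, pi^(r)), as long as lambda has r-marked
   parts; [mu] is kept as the list of its clusters. Each round removes r parts
   from lambda, so the fuel [size la] is enough for r > 0. *)
Fixpoint phi_stage (fuel a r : nat) (la : seq nat) (mu : seq (seq nat))
    (pi : seq nat) : option (seq nat * seq (seq nat) * seq nat) :=
  if marked r la is [::] then Some (la, mu, pi) else
  if fuel is f.+1 then
    if settle_cluster a r (size mu) la is Some (t, c, la')
    then phi_stage f a r la' (rcons mu c) (t :: pi)
    else None
  else None.

(* Stages r, r-1, ..., 1. In the result (mu, pis), the partition pi^(i) is
   [nth [::] pis i.-1]. *)
Fixpoint phi_from (a r : nat) (la : seq nat) (mu : seq (seq nat)) :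
    option (seq (seq nat) * seq (seq nat)) :=
  match r with
  | 0 => if la is [::] then Some (mu, [::]) else None
  | r'.+1 =>
      if phi_stage (size la) a r la mu [::] is Some (la', mu', pi)
      then omap (fun res => (res.1, rcons res.2 (sort geq pi)))
                (phi_from a r' la' mu')
      else None
  end.

Definition phi (k a : nat) (la : seq nat) :
    option (seq (seq nat) * seq (seq nat)) :=
  phi_from a k.-1 la [::].

(** * Lattice paths *)

Inductive step := NE | SE | EE.

Definition is_NE (s : step) : bool := if s is NE then true else false.
Definition is_SE (s : step) : bool := if s is SE then true else false.

(* The path starting at (0, start) with the given steps; its vertices have
   abscissas 0, ..., size steps. *)
Record lpath := LPath { start : nat; steps : seq step }.

(* The subtraction is exact on the paths satisfying [is_lattice_path]. *)
Definition height (L : lpath) (x : nat) : nat :=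
  start L + count is_NE (take x (steps L)) - count is_SE (take x (steps L)).

Definition is_lattice_path (L : lpath) : Prop :=
  [/\ forall x, x < size (steps L) ->
        match nth EE (steps L) x with
        | NE => True
        | SE => 0 < height L x
        | EE => height L x = 0
        end,
      height L (size (steps L)) = 0
    & steps L = [::] \/ last EE (steps L) = SE].

(* The vertex of abscissa [x] is a peak. *)
Definition is_peak (L : lpath) (x : nat) : bool :=
  (0 < x) && (if drop x.-1 (steps L) is NE :: SE :: _ then true else false).

(* The abscissas of the peaks, from left to right. *)
Definition peaks (L : lpath) : seq nat :=
  [seq x <- iota 0 (size (steps L)).+1 | is_peak L x].

Definition major_index (L : lpath) : nat := sumn (peaks L).

(* The peak of abscissa [x] is at least [h] above two vertices as in the
   definition of relative height. *)
Definition rises_by (L : lpath) (x h : nat) : bool :=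
  let y := height L x in
  has (fun x1 =>
    has (fun x2 =>
      [&& height L x1 == y - h, height L x2 == y - h &
          all (fun z => (x1 < z < x2) ==>
                 ((height L z < y) || (height L z == y) && (x <= z)))
              (peaks L)])
      (iota x.+1 (size (steps L) - x)))
    (iota 0 x).

Definition rel_height (L : lpath) (x : nat) : nat :=
  \max_(h <- iota 0 (height L x).+1 | rises_by L x h) h.

Definition special_path (k a : nat) (L : lpath) : Prop :=
  [/\ is_lattice_path L,
      start L = k - a
    & forall x, x <= size (steps L) -> height L x < k].

Definition E_set (k a : nat) (N : nat -> nat) (n : nat) : set lpath :=
  [set L | [/\ special_path k a L, major_index L = n &
               forall i, 1 <= i <= k.-1 ->
                 count (fun x => i <= rel_height L x) (peaks L) = N i]]%classic.

(** * The map psi *)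

Definition insert_peaks (k a i n : nat) (L : lpath) : lpath :=
  LPath (if a <= i then k - i - 1 else k - a)
        (flatten (nseq n [:: NE; SE]) ++ steps L).

Definition prepend_SE (k i : nat) (L : lpath) : lpath :=
  LPath (k - i) (SE :: steps L).

(* One move to the right, on a pair (abscissa of the peak being moved, path);
   the result carries the abscissa of the peak to be moved next. A peak two
   units to the right of the moved one automatically has the same height, so
   heights are not compared. *)
Definition move_right (xL : nat * lpath) : nat * lpath :=
  let: (x, L) := xL in
  let after := if drop x.+1 (steps L) is s :: rest
               then [:: s, NE, SE & rest] else [:: EE; NE; SE] in
  let L' := LPath (start L) (take x.-1 (steps L) ++ after) in
  (if is_peak L' x.+3 then x.+3 else x.+1, L').

(* The abscissas of the peaks of relative height one, from right to left. *)
Definition unit_peaks (L : lpath) : seq nat :=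
  rev [seq x <- peaks L | rel_height L x == 1].

(* Moves the (j+1)-st peak of relative height one [t] times. *)
Definition move_unit_peak (j t : nat) (L : lpath) : option lpath :=
  if j < size (unit_peaks L)
  then Some (iter t move_right (nth 0 (unit_peaks L) j, L)).2 else None.

Definition move_peaks (n : nat) (pi : seq nat) (L : lpath) : option lpath :=
  foldl (fun oL j => obind (move_unit_peak j (nth 0 pi j)) oL) (Some L)
        (iota 0 n).

Fixpoint uplift_steps (s : seq step) : seq step :=
  match s with
  | NE :: (SE :: s') => [:: NE, NE, SE, SE & uplift_steps s']
  | x :: s' => x :: uplift_steps s'
  | [::] => [::]
  end.

Definition volcanic_uplift (L : lpath) : lpath :=
  LPath (start L) (uplift_steps (steps L)).

Definition nb_clusters (i : nat) (mu : seq (seq nat)) : nat :=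
  count (fun c => size c == i) mu.

(* Rounds i, i-1, ..., 1 of psi. *)
Fixpoint psi_from (k a : nat) (mu pis : seq (seq nat)) (i : nat) (L : lpath) :
    option lpath :=
  match i with
  | 0 => Some L
  | i'.+1 =>
      let n := nb_clusters i mu in
      let L1 := insert_peaks k a i n L in
      let L2 := if a <= i then prepend_SE k i L1 else L1 in
      if move_peaks n (nth [::] pis i.-1) L2 is Some L3
      then psi_from k a mu pis i'
             (if 2 <= i then volcanic_uplift L3 else L3)
      else None
  end.

Definition psi (k a : nat) (mu pis : seq (seq nat)) : option lpath :=
  psi_from k a mu pis k.-1 (LPath 0 [::]).

(* [None] when some instruction of phi or psi cannot be carried out. *)
Definition phi_psi (k a : nat) (la : seq nat) : option lpath :=
  obind (fun res => psi k a res.1 res.2) (phi k a la).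

(* Main.v *)
Require Import Defs.
From mathcomp Require Import all_boot.
From mathcomp Require Import classical_sets functions.
From mathcomp Require Import zify.

Set Implicit Arguments.
Unset Strict Implicit.
Unset Printing Implicit Defensive.

(** Both maps are bijections onto the tuples (pi^(1), ..., pi^(k-1)) of
    partitions, where pi^(i) has n_i parts.

    For phi, let F j be the number of parts of lambda equal to 2m+j, and put
    F 0 = r-(a-1); then F j + F (j+1) <= r for all j. The r-cluster that phi
    moves at stage r sits at the first i >= 1 with F i + F (i+1) = r. A backward
    move keeps the sequence obtained by deleting the entries i and i+1, and
    lowers the sum of r - F j - F (j+1) over j < i by one; the cluster is in
    place exactly when this sum vanishes. So extracting a cluster amounts to
    recording this sum and deleting two entries, which is explicitly invertible,
    and the recorded numbers increase from one cluster to the next. The numbers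
    of i-marked parts are unchanged by backward moves.

    For psi, a path of stage i is determined by the path v left after deleting
    all its peaks (all factors NE SE) and by the number of peaks deleted at each
    vertex of v; at a peak of v this number is at least one, because of the
    uplift, and the other peaks, those of relative height one, sit at the
    abscissas listed by pi^(i). A peak of relative height at least h+1 of the
    path corresponds to a peak of relative height at least h of v. *)

(** * Sequences of multiplicities *)

(** The link with Gordon marks is this: when neighbouring multiplicities sum to at most r, all marks
    are at most r, and mark r occurs exactly when some such sum equals r; the smallest r-marked part
    is then the larger value of the leftmost full pair. So the difference condition, the end of a
    stage and the place of the next cluster all become statements about sums of neighbours. The
    virtual entry r-(a-1) brings the parts 1 into the same frame: F 0 + F 1 <= r then bounds F 1 by
    a-1 if r >= a, while for r < a it truncates to 0 and leaves the bound r. These are the two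
    stopping positions of [phi]. Since [phi] and [psi] are partial searches here, it must also be
    shown that no instruction fails and that each search stops at the predicted move, not earlier.
    Backward moves unsort the list, hence the use of [perm_eq] until the very end. Both sides carry
    the same statistics: N_i is the number of parts of pi^(i), ..., pi^(k-1) together, and n is the
    sum over i of N_i^2 + [a <= i] N_i + |pi^(i)|. *)

Definition pairs_le (r : nat) (F : nat -> nat) := forall j, F j + F j.+1 <= r.

(** Index 0 is excluded because entry 0 is virtual: no cluster sits on the pair (0, 1), even though
    that pair may be full. *)
Definition first_full (r : nat) (F : nat -> nat) (i : nat) :=
  [/\ 0 < i, F i + F i.+1 = r & forall j, 0 < j < i -> F j + F j.+1 < r].

(* The number of backward moves that bring the first full pair into place. *)
Definition moves_left (r : nat) (F : nat -> nat) (i : nat) :=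
  \sum_(j < i) (r - (F j + F j.+1)).

Definition drop_pair (F : nat -> nat) (i j : nat) := if j < i then F j else F j.+2.

Lemma moves_left_eq r F G i : (forall j, j <= i -> F j = G j) -> moves_left r F i = moves_left r G i.
Proof.
move=> eqFG; apply: eq_bigr => -[j /= lt_ji] _; rewrite !eqFG //; lia.
Qed.

Lemma moves_leftS r F i : moves_left r F i.+1 = moves_left r F i + (r - (F i + F i.+1)).
Proof. by rewrite /moves_left big_ord_recr. Qed.

Lemma moves_left_le r F i j : i <= j -> moves_left r F i <= moves_left r F j.
Proof.
elim: j => [|j IH]; first by case: i.
by rewrite leq_eqVlt => /orP[/eqP-> //|/IH le]; rewrite moves_leftS; lia.
Qed.

Lemma first_full_uniq r F i i' : first_full r F i -> first_full r F i' -> i = i'.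
Proof.
move=> [i0 Fi Hi] [i0' Fi' Hi'].
case: (ltngtP i i') => // lt.
- by have := Hi' i; rewrite i0 lt Fi ltnn => /(_ isT).
- by have := Hi i'; rewrite i0' lt Fi' ltnn => /(_ isT).
Qed.

Lemma first_full_eq r F G i : F =1 G -> first_full r F i -> first_full r G i.
Proof. by move=> E [i0 Fi H]; split=> // [|j /H]; rewrite -!E. Qed.

Lemma first_full_ex r F : pairs_le r F -> (exists2 j, 0 < j & F j + F j.+1 = r) ->
  exists i, first_full r F i.
Proof.
move=> okF [j j0 Fj].
have ex : exists j, (0 < j) && (F j + F j.+1 == r) by exists j; rewrite j0 Fj eqxx.
case: (ex_minnP ex) => i /andP[i0 /eqP Fi] Hmin; exists i; split=> // l /andP[l0 li].
rewrite ltn_neqAle okF andbT; apply/negP => /eqP Fl.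
by have := Hmin l; rewrite l0 Fl eqxx leqNgt li => /(_ isT).
Qed.

(** Only the new neighbours F (i-1) and F (i+2) need care: fullness at i gives F (i-1) <= F (i+1),
    so their sum is at most F (i+1) + F (i+2). *)
Lemma pairs_le_drop_pair r F i : 0 < r -> pairs_le r F -> first_full r F i -> pairs_le r (drop_pair F i).
Proof.
move=> r0 okF [i0 Fi Hi] j; rewrite /drop_pair.
case: (ltnP j i); case: (ltnP j.+1 i) => *; try apply: okF; last lia.
have Ei : i = j.+1 by lia.
by move: Fi (okF j) (okF i.+1); rewrite Ei; lia.
Qed.

(** This makes the recorded numbers monotone. The deletion creates no full pair before i, since F
    (i-1) < F (i+1) when i > 1; and F (i+2) <= F i, so the term of index i-1 can only grow. *)
Lemma moves_left_drop_pair r F i i' : pairs_le r F -> first_full r F i -> first_full r (drop_pair F i) i' ->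
  moves_left r F i <= moves_left r (drop_pair F i) i'.
Proof.
move=> okF [i0 Fi Hi] [i0' Fi' Hi'].
have le : i <= i'.
  rewrite leqNgt; apply/negP => lt; move: Fi'; rewrite /drop_pair lt.
  case: ltnP => [lt2|le2] Fi'; first by have := Hi i'; lia.
  have E : i = i'.+1 by lia.
  by have := Hi i'; move: Fi (okF i.+1); rewrite E; lia.
apply: leq_trans (moves_left_le _ _ le); case: i i0 Fi Hi {le Fi' Hi'} => // i _ Fi Hi.
rewrite !moves_leftS (@moves_left_eq r (drop_pair F i.+1) F).
  by rewrite /drop_pair ltnSn ltnn; move: (okF i.+2); lia.
by move=> j le; rewrite /drop_pair ltnS le.
Qed.

(** If i1 < i2, the sequences agree below i1 and F2 i1 = F1 (i1+2) <= F1 i1, and F2 has a further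
    positive term at i1, so its sum would be larger. Once i1 = i2, the sum determines the entry at
    i1 and fullness the next one. *)
Lemma drop_pair_inj r F1 F2 i1 i2 : pairs_le r F1 -> pairs_le r F2 ->
  first_full r F1 i1 -> first_full r F2 i2 -> moves_left r F1 i1 = moves_left r F2 i2 ->
  drop_pair F1 i1 =1 drop_pair F2 i2 -> F1 =1 F2.
Proof.
wlog le : F1 F2 i1 i2 / i1 <= i2.
  move=> W; case: (leqP i1 i2) => [|/ltnW] le *; first exact: (W F1 F2 i1 i2).
  by move=> j; apply/esym; apply: (W F2 F1 i2 i1).
move=> ok1 ok2 [i10 E1 H1] [i20 E2 H2] eqp eqd.
have lo j : j < i1 -> F1 j = F2 j.
  by move=> lt; have := eqd j; rewrite /drop_pair lt (leq_trans lt le).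
have E : i1 = i2.
  apply/eqP; rewrite eqn_leq le leqNgt; apply/negP => lt.
  have H : moves_left r F1 i1 < moves_left r F2 i2; last by rewrite eqp ltnn in H.
  apply: leq_trans (moves_left_le r F2 lt); rewrite moves_leftS.
  have H21 := H2 i1; rewrite i10 lt in H21; move/(_ isT): H21 => H21.
  suff : moves_left r F1 i1 <= moves_left r F2 i1 by lia.
  case: i1 i10 lo le lt E1 H1 eqd {eqp H21} => // i _ lo le lt E1 H1 eqd.
  rewrite !moves_leftS (@moves_left_eq r F1 F2) //.
  have := eqd i.+1; rewrite /drop_pair ltnn lt => <-.
  by rewrite (lo i) //; move: (ok1 i.+2); lia.
subst i2.
have eqi : F1 i1 = F2 i1.
  case: i1 i10 lo {le E1 H1 i20 E2 H2 eqd} eqp => // i _ lo.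
  rewrite !moves_leftS (@moves_left_eq r F1 F2) //.
  by rewrite (lo i) //; have := ok1 i; have := ok2 i; rewrite (lo i) //; lia.
move=> j; case: (ltngtP j i1) => [/lo //|lt|->//].
case: j lt => // j; rewrite ltnS leq_eqVlt => /orP[/eqP<-|]; first by lia.
case: j => // j lej; have := eqd j; rewrite /drop_pair !ltnNge.
by rewrite -ltnS lej.
Qed.

(** The pair (al, r - al) is inserted right after [G i], where i+1 is the least positive index whose
    [moves_left] reaches t, and al makes the new term r - (G i + al) supply what is missing to t. A
    full pair of G before that place would, by the last hypothesis, make t too small for the choice
    of i. *)
Lemma drop_pair_surj r G t : 0 < r -> pairs_le r G ->
  (exists B, forall j, B <= j -> G j = 0) ->
  (forall i, first_full r G i -> t <= moves_left r G i) ->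
  exists F i, [/\ pairs_le r F, first_full r F i, moves_left r F i = t & drop_pair F i =1 G].
Proof.
move=> r0 okG [B HB] Ht.
have ex : exists i, (0 < i) && (t <= moves_left r G i).
  (* Beyond [B] every term of [moves_left] equals r >= 1, so [t] further terms suffice. *)
  exists (B.+1 + t); rewrite addSn /=.
  elim: t {Ht} => [//|t IH]; rewrite addnS moves_leftS.
  by rewrite !HB; lia.
case: (ex_minnP ex) => i /andP[i0 le_t] Hmin; case: i i0 le_t Hmin => // i _ le_t Hmin.
pose al := r - G i - (t - moves_left r G i).
have al_le : al + G i <= r by rewrite /al; have := okG i; lia.
have al_ge : G i.+1 <= al.
  by rewrite /al; move: le_t; rewrite moves_leftS; have := okG i; lia.
have tge : 0 < i -> moves_left r G i < t.
  by move=> i0; rewrite ltnNge; apply/negP => H; have := Hmin i; rewrite i0 H ltnn => /(_ isT).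
have tge' : moves_left r G i <= t by case: (posnP i) tge => [->|_ /(_ isT)/ltnW //]; rewrite /moves_left big_ord0.
pose F j := if j <= i then G j else if j == i.+1 then al else
            if j == i.+2 then r - al else G j.-2.
have Flo j : j <= i -> F j = G j by rewrite /F => ->.
have F1 : F i.+1 = al by rewrite /F ltnn eqxx.
have F2 : F i.+2 = r - al by rewrite /F eqxx ifF ?ifF; lia.
have Fhi j : i < j -> F j.+2 = G j.
  by move=> lt; rewrite /F /= !ifF //; lia.
have okF : pairs_le r F.
  move=> j; case: (ltngtP j i) => [lt|lt|->].
  - by rewrite !Flo // ltnW.
  - case: (ltngtP j i.+1) => [|lt2|->]; first lia.
      case: j lt lt2 => // -[//|j] _; rewrite ltnS => lt.
      case: (ltngtP j i) => [|lt2|->]; [lia| |].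
        by rewrite !Fhi //; lia.
      by rewrite F2 Fhi //; lia.
    by rewrite F1 F2; lia.
  - by rewrite Flo // F1; lia.
exists F, i.+1; split=> //.
- split=> //; first by rewrite F1 F2; lia.
  move=> j /andP[j0]; rewrite ltnS leq_eqVlt => /orP[/eqP E|lt].
    subst j; rewrite Flo // F1 /al; have := tge j0; have := okG i; move: le_t; rewrite moves_leftS; lia.
  rewrite !Flo //; last exact: ltnW.
  rewrite ltn_neqAle okG andbT; apply/negP => /eqP E.
  have [i' fi'] : exists i', first_full r G i' by apply: first_full_ex => //; exists j.
  have := Ht _ fi'.
  have lei' : i' <= j.
    by case: fi' => _ _ H; rewrite leqNgt; apply/negP => ?; have := H j; rewrite j0 E ltnn; lia.
  have := moves_left_le r G lei'; have := moves_left_le r G lt; have := tge; rewrite moves_leftS; lia.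
- rewrite moves_leftS F1 Flo // (@moves_left_eq r F G) //; move: le_t; rewrite moves_leftS /al; have := okG i; lia.
- move=> j; rewrite /drop_pair ltnS; case: leqP => [/Flo //|]; exact: Fhi.
Qed.

(* One backward move: a part at [i.+1] becomes a part at [i]. *)
Definition move_back (F : nat -> nat) (i j : nat) :=
  if j == i then (F i).+1 else if j == i.+1 then (F i.+1).-1 else F j.

(** Otherwise F i = r and the pair (i-1, i) is already full. This is possible only for i = 1, and
    then F 0 = 0 and no move is left. *)
Lemma first_full_gt0 r F i : 0 < r -> pairs_le r F -> first_full r F i -> 0 < moves_left r F i -> 0 < F i.+1.
Proof.
move=> r0 okF [i0 E H] p0; rewrite lt0n; apply/negP => /eqP E0.
case: i i0 E H p0 E0 => // i _ E H; rewrite moves_leftS => p0 E0.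
case: (posnP i) => [i0|i0]; last by have := H i; rewrite i0 ltnSn; have := okF i; lia.
by move: p0; rewrite i0 /moves_left big_ord0; move: E; rewrite E0 i0; have := okF 0; lia.
Qed.

(** The move raises the sum at i-1 by one and lowers the one at i+1. If the sum at i-1 stays below
    r, or if i = 1, the first full pair stays at i. Otherwise it slides to i-1, whose term was
    exactly 1, and F (i+1) - 1 = F (i-1), so deleting either pair leaves the same sequence. *)
Lemma move_backP r F i : 0 < r -> pairs_le r F -> first_full r F i -> 0 < moves_left r F i ->
  pairs_le r (move_back F i) /\ exists i', [/\ first_full r (move_back F i) i',
     (moves_left r (move_back F i) i').+1 = moves_left r F i & drop_pair (move_back F i) i' =1 drop_pair F i].
Proof.
move=> r0 okF fi p0; have Fi1 := first_full_gt0 r0 okF fi p0.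
case: fi => i0 E H; case: i i0 E H p0 Fi1 => // i _ E H p0 Fi1.
have lt : F i + F i.+1 < r.
  case: (posnP i) => [i0|i0]; last by apply: H; rewrite i0 /=.
  by move: p0; rewrite i0 moves_leftS /moves_left big_ord0; lia.
have Mlo j : j <= i -> move_back F i.+1 j = F j.
  by move=> le; rewrite /move_back !ifF //; lia.
have M1 : move_back F i.+1 i.+1 = (F i.+1).+1 by rewrite /move_back eqxx.
have M2 : move_back F i.+1 i.+2 = (F i.+2).-1 by rewrite /move_back eqxx ifF //; lia.
have Mhi j : i.+2 < j -> move_back F i.+1 j = F j.
  by move=> le; rewrite /move_back !ifF //; lia.
have okM : pairs_le r (move_back F i.+1).
  move=> j; case: (ltngtP j i) => [l|l|->].
  - by rewrite !Mlo // ltnW.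
  - case: (ltngtP j i.+1) => [|l2|->]; first lia.
      case: (ltngtP j i.+2) => [|l3|->]; first lia.
        by rewrite !Mhi // ltnW.
      by rewrite M2 Mhi //; have := okF i.+2; lia.
    by rewrite M1 M2; lia.
  - by rewrite Mlo // M1; lia.
split=> //.
case: (ltnP (F i + (F i.+1).+1) r) => [lt'|ge'].
- exists i.+1; split.
  + split=> //; first by rewrite M1 M2; lia.
    move=> j /andP[j0]; rewrite ltnS leq_eqVlt => /orP[/eqP ->|l].
      by rewrite Mlo // M1.
    by rewrite !Mlo //; [apply: H; lia | lia].
  + rewrite !moves_leftS M1 Mlo // (@moves_left_eq r _ F) //; lia.
  + move=> j; rewrite /drop_pair ltnS; case: leqP => [/Mlo //|le]; exact: Mhi.
case: i E H p0 Fi1 lt Mlo M1 M2 Mhi okM ge' => [|i] E H p0 Fi1 lt Mlo M1 M2 Mhi okM ge'.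
- exists 1; split.
  + split=> //; first by rewrite M1 M2; lia.
    by case=> // -[].
  + rewrite !moves_leftS /moves_left !big_ord0 M1 Mlo //; lia.
  + by move=> j; rewrite /drop_pair ltnS; case: leqP => [/Mlo //|le]; exact: Mhi.
exists i.+1; split.
- split=> //; first by rewrite Mlo // M1; have := okF i.+1; lia.
  by move=> j /andP[j0 l]; rewrite !Mlo; [apply: H; lia|lia|lia].
- rewrite !moves_leftS Mlo // Mlo; last lia.
  rewrite (@moves_left_eq r _ F) //; last by move=> j ?; apply: Mlo; lia.
  by lia.
- move=> j; rewrite /drop_pair !ltnS.
  case: (ltngtP j i.+1) => [l|l|->].
  + by rewrite -ltnS l Mlo // ltnW.
  + by rewrite leqNgt (ltn_trans (ltnSn _) l) /= Mhi.
  + by rewrite ltnn M2; lia.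
Qed.

Lemma moves_left0 r F i : pairs_le r F -> first_full r F i -> moves_left r F i = 0 -> i = 1 /\ F 0 + F 1 = r.
Proof.
move=> okF [i0 E H]; case: i i0 E H => // -[|i] _ E H; rewrite !moves_leftS.
  by rewrite /moves_left big_ord0 => ?; split=> //; have := okF 0; lia.
by have := H i.+1; lia.
Qed.

(** * Gordon marks *)

Lemma least_markP s :
  [/\ 0 < least_mark s, least_mark s \notin s &
      forall i, 0 < i < least_mark s -> i \in s].
Proof.
rewrite /least_mark; set a := (fun i => _); set l := iota _ _.
have hasa : has a l.
  rewrite has_predC; apply/negP => /allP H.
  have : size (map succn l) <= size s.
    apply: uniq_leq_size; first by rewrite map_inj_uniq ?iota_uniq //; apply: succn_inj.
    by move=> x /mapP[y /H] + ->.
  by rewrite size_map size_iota ltnn.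
have lt : find a l < (size s).+1 by move: hasa; rewrite has_find size_iota.
split=> //; first by have := nth_find 0 hasa; rewrite nth_iota.
case=> // i /andP[_ lti']; have lti : i < find a l := lti'; have := before_find 0 lti.
by rewrite nth_iota ?(ltn_trans lti lt) // => /negbFE.
Qed.

Lemma least_mark_eqi s s' : s =i s' -> least_mark s = least_mark s'.
Proof.
move=> E; have [p n b] := least_markP s; have [p' n' b'] := least_markP s'.
case: (ltngtP (least_mark s) (least_mark s')) => // lt.
- by have := b' (least_mark s); rewrite p lt -E (negbTE n) => /(_ isT).
- by have := b (least_mark s'); rewrite p' lt E (negbTE n') => /(_ isT).
Qed.

Fixpoint next_marks (S : seq nat) (c : nat) : seq nat :=
  if c is c'.+1 then
    let T := next_marks S c' in rcons T (least_mark (S ++ T))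
  else [::].

(* The marks of the copies of [v] in a partition with [f v] parts [v]. *)
Fixpoint marks (f : nat -> nat) (v : nat) : seq nat :=
  if v is v'.+1 then next_marks (marks f v') (f v) else [::].

(** [T] is, in any order, the set of the [c] smallest positive integers outside [S]. This
    description replaces the greedy procedure whenever marks are compared. *)
Definition is_next (S : seq nat) (c : nat) (T : seq nat) :=
  [/\ size T = c, uniq T, 0 \notin T,
      forall e, e \in T -> e \notin S &
      forall e i, e \in T -> 0 < i < e -> (i \in S) || (i \in T)].

Lemma next_marksP S c : is_next S c (next_marks S c).
Proof.
elim: c => [|c [sT uT zT dT bT]] //=.
have [p n b] := least_markP (S ++ next_marks S c).
move: n; rewrite mem_cat negb_or => /andP[n1 n2].
split.
- by rewrite size_rcons sT.
- by rewrite rcons_uniq n2.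
- by rewrite mem_rcons inE negb_or zT andbT eq_sym -lt0n.
- by move=> e; rewrite mem_rcons inE => /orP[/eqP->|/dT].
- move=> e i; rewrite !mem_rcons !inE => /orP[/eqP->|eT] H.
    by have := b i H; rewrite mem_cat => /orP[->|->] //; rewrite !orbT.
  by case/orP: (bT e i eT H) => ->; rewrite ?orbT.
Qed.

(** By equal sizes, an e in T but not T' comes with an e' in T' but not T. The smaller of the two
    lies below an element of the other set, hence must belong to that set or to S, which is
    impossible. *)
Lemma is_next_uniq S c T T' : is_next S c T -> is_next S c T' -> T =i T'.
Proof.
wlog suff W : T T' / is_next S c T -> is_next S c T' -> {subset T <= T'}.
  by move=> H H' e; apply/idP/idP; apply: W.
move=> [sT uT zT dT bT] [sT' uT' zT' dT' bT'] e eT; apply/negPn/negP => eT'.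
have [e' e'T' e'T] : exists2 e', e' \in T' & e' \notin T.
  apply/hasP; rewrite has_predC; apply/negP => /allP sub.
  have := uniq_leq_size (s1 := e :: T') (s2 := T).
  rewrite /= eT' uT' sT sT' ltnn => /(_ isT) F; apply: notF; apply: F => x.
  by rewrite inE => /orP[/eqP->|/sub].
case: (ltngtP e e') => [lt|lt|E].
- have := bT' e' e e'T'; rewrite lt lt0n (memPn zT) // (negbTE (dT _ eT)) (negbTE eT').
  by move/(_ isT).
- have := bT e e' eT; rewrite lt lt0n (memPn zT') // (negbTE (dT' _ e'T')) (negbTE e'T).
  by move/(_ isT).
- by rewrite -E eT in e'T.
Qed.

Lemma is_next_marks S c T : is_next S c T -> T =i next_marks S c.
Proof. by move=> H; apply: is_next_uniq H (next_marksP S c). Qed.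

Lemma next_marks_eqi S S' c : S =i S' -> next_marks S c = next_marks S' c.
Proof.
move=> E; elim: c => //= c ->; congr rcons; apply: least_mark_eqi => i.
by rewrite !mem_cat E.
Qed.

Lemma marksP f v : is_next (marks f v) (f v.+1) (marks f v.+1).
Proof. exact: next_marksP. Qed.

Lemma marks_uniq f v : uniq (marks f v).
Proof. by case: v => // v; case: (marksP f v). Qed.

Lemma marks_gt0 f v : 0 \notin marks f v.
Proof. by case: v => // v; case: (marksP f v). Qed.

Lemma marks_size f v : f 0 = 0 -> size (marks f v) = f v.
Proof. by case: v => [->|v _] //; case: (marksP f v). Qed.

Lemma marks_disj f v e : e \in marks f v -> e \notin marks f v.+1.
Proof. by move=> H; case: (marksP f v) => _ _ _ d _; apply/negP => /d; rewrite H. Qed.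

Lemma marks_cat_uniq f v : uniq (marks f v ++ marks f v.+1).
Proof.
rewrite cat_uniq !marks_uniq /= andbT; apply/hasP => -[x x1 /= x2].
by have := marks_disj x2; rewrite x1.
Qed.

Lemma eq_marks f f' v : (forall j, j <= v -> f j = f' j) -> marks f v = marks f' v.
Proof.
elim: v => //= v IH H; rewrite H // IH // => j le; exact: H (leqW le).
Qed.

Lemma eqi_marks f f' u v : u <= v -> marks f u =i marks f' u ->
  (forall j, u < j <= v -> f j = f' j) -> marks f v =i marks f' v.
Proof.
elim: v => [|v IH]; first by rewrite leqn0 => /eqP->.
rewrite leq_eqVlt => /orP[/eqP<- //|lt] E H /=.
have -> : f v.+1 = f' v.+1 by apply: H; rewrite lt /=.
rewrite (@next_marks_eqi _ (marks f' v)) //; apply: IH => // j /andP[a b].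
by apply: H; rewrite a leqW.
Qed.

Definition expand (f : nat -> nat) (B : nat) : seq nat :=
  flatten [seq nseq (f v) v | v <- iota 0 B].

Lemma expandS f B : expand f B.+1 = expand f B ++ nseq (f B) B.
Proof. by rewrite /expand -addn1 iotaD map_cat flatten_cat /= cats0. Qed.

Lemma count_expand f B u : count_mem u (expand f B) = if u < B then f u else 0.
Proof.
elim: B => // B IH; rewrite expandS count_cat IH count_nseq ltnS /=.
by case: (ltngtP u B) => [lt|lt|->] /=; rewrite ?mul0n ?mul1n ?addn0.
Qed.

Lemma expand_sorted f B : sorted leq (expand f B).
Proof.
rewrite sorted_pairwise; last exact: leq_trans.
elim: B => // B IH; rewrite expandS pairwise_cat IH /=; apply/andP; split.
  apply/allrelP => x y /flattenP[s /mapP[v + ->]].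
  by rewrite !mem_nseq mem_iota => /andP[_ lt] /andP[_ /eqP->] /andP[_ /eqP->]; exact: ltnW.
rewrite -sorted_pairwise; last exact: leq_trans.
by case: (f B) => //= c; elim: c => //= c ->; rewrite leqnn.
Qed.

Lemma sort_expand la B : (forall v, v \in la -> v < B) ->
  sort leq la = expand (fun v => count_mem v la) B.
Proof.
move=> H; apply: (sorted_eq leq_trans anti_leq).
- exact: sort_sorted leq_total _.
- exact: expand_sorted.
- rewrite perm_sort; apply/allP => v _ /=; rewrite count_expand.
  by case: ltnP => // le; apply/eqP/count_memPn/negP => /H; rewrite ltnNge le.
Qed.

Definition marking (f : nat -> nat) (B : nat) : seq (nat * nat) :=
  flatten [seq [seq (v, i) | i <- marks f v] | v <- iota 0 B].

Lemma markingS f B : marking f B.+1 = marking f B ++ [seq (B, i) | i <- marks f B].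
Proof. by rewrite /marking -addn1 iotaD map_cat flatten_cat /= cats0. Qed.

Lemma marking_lt f B p : p \in marking f B -> p.1 < B.
Proof. by case/flattenP=> s /mapP[v + ->] /mapP[i _ ->]; rewrite mem_iota. Qed.

Lemma foldl_marking f B : f 0 = 0 ->
  foldl mark_next [::] (expand f B) = marking f B.
Proof.
move=> f0; elim: B => // B IH; rewrite expandS markingS foldl_cat IH.
case: B {IH} => [|B]; first by rewrite f0.
rewrite [marks f B.+1]/=; elim: (f B.+1) => [|c IHc]; first by rewrite cats0.
have -> : nseq c.+1 B.+1 = nseq c B.+1 ++ [:: B.+1] by rewrite -addn1 nseqD.
rewrite foldl_cat IHc /= map_rcons -cats1 catA cats1.
rewrite /mark_next; congr (rcons _ (_, least_mark _)).
rewrite markingS -catA !filter_cat !map_cat.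
have -> : [seq p <- marking f B | (p.1 == B.+1) || (p.1.+1 == B.+1)] = [::].
  apply/eqP; rewrite -(negbK (_ == _)) -has_filter; apply/hasP => -[p /marking_lt lt]; rewrite eqSS.
  by rewrite (ltn_eqF lt) (ltn_eqF (ltn_trans lt (ltnSn B))).
rewrite !filter_map /= -!map_comp /=; congr (_ ++ _).
- by rewrite (eq_filter (a2 := predT)) ?filter_predT ?map_id // => i /=; rewrite eqxx orbT.
- by rewrite (eq_filter (a2 := predT)) ?filter_predT ?map_id // => i /=; rewrite eqxx.
Qed.

Lemma gordon_markingE la B : 0 \notin la -> (forall v, v \in la -> v < B) ->
  gordon_marking la = marking (fun v => count_mem v la) B.
Proof.
move=> z H; rewrite /gordon_marking (sort_expand H) foldl_marking //.
exact/count_memPn.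
Qed.

Lemma markedE r la B : 0 \notin la -> (forall v, v \in la -> v < B) ->
  marked r la = [seq v <- iota 0 B | r \in marks (fun v => count_mem v la) v].
Proof.
move=> z H; rewrite /marked (gordon_markingE z H).
move: (fun v => count_mem v la) => f {z H}; elim: B => // B IH.
rewrite markingS -addn1 iotaD !filter_cat map_cat IH /=; congr (_ ++ _).
rewrite filter_map -map_comp /=.
rewrite (eq_filter (a2 := pred1 r)) //.
case: (boolP (r \in _)) => rB; first by rewrite filter_pred1_uniq ?marks_uniq.
rewrite (_ : filter _ _ = [::]) //; apply/eqP; rewrite -(negbK (_ == _)) -has_filter.
by apply: contra rB => /hasP[i iB /= /eqP<-].
Qed.

Lemma bounded_parts (la : seq nat) : exists B, forall v, v \in la -> v < B.
Proof.
exists (sumn la).+1 => v; rewrite ltnS; elim: la => // x la IH; rewrite inE.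
by case/orP => [/eqP->|/IH le] /=; [exact: leq_addr | rewrite (leq_trans le) // leq_addl].
Qed.

Lemma is_next_le S c T e : uniq S -> is_next S c T -> e \in T -> e <= size S + c.
Proof.
move=> uS [<- uT zT dT bT] eT; rewrite -size_cat -(size_iota 1 e).
apply: uniq_leq_size; first exact: iota_uniq.
move=> i; rewrite mem_iota mem_cat add1n ltnS => /andP[i0].
rewrite leq_eqVlt => /orP[/eqP->|lt]; first by rewrite eT orbT.
by apply: (bT e i eT); rewrite i0.
Qed.

Lemma is_next_iota c : is_next [::] c (iota 1 c).
Proof.
split; rewrite ?size_iota ?iota_uniq ?mem_iota // => e i.
by rewrite !mem_iota => /andP[_ lt] /andP[-> lt'] /=; exact: ltn_trans lt.
Qed.

Section Marks.
Variables (r : nat) (f : nat -> nat).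
Hypotheses (f0 : f 0 = 0) (okf : pairs_le r f).

Lemma marks_le v e : e \in marks f v -> e <= r.
Proof.
case: v => // v ev; apply: leq_trans (okf v).
by have := is_next_le (marks_uniq f v) (marksP f v) ev; rewrite marks_size.
Qed.

(** The marks of [v] and [v.+1] are pairwise distinct and at most r; when there are r of them they
    exhaust 1, ..., r. *)
Lemma marks_full v e : f v + f v.+1 = r -> 0 < e <= r ->
  (e \in marks f v) || (e \in marks f v.+1).
Proof.
move=> E er; rewrite -mem_cat.
have [] := uniq_min_size (marks_cat_uniq f v) (s2 := iota 1 r).
- move=> i; rewrite mem_cat mem_iota add1n ltnS => H.
  case/orP: H => H; rewrite (marks_le H) andbT lt0n.
    exact: (memPn (marks_gt0 f v)).
  exact: (memPn (marks_gt0 f v.+1)).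
- by rewrite size_cat !marks_size // E size_iota.
by move=> _ ->; rewrite mem_iota add1n ltnS.
Qed.

Lemma top_mark_sum v : r \in marks f v.+1 -> f v + f v.+1 = r.
Proof.
move=> H; apply/eqP; rewrite eqn_leq okf /=.
by have := is_next_le (marks_uniq f v) (marksP f v) H; rewrite marks_size.
Qed.

(** A part marked r at a value u forces the pair (u-1, u) to be full, so [y] itself cannot carry r
    and its full pair must carry it on [y.+1]. *)
Lemma first_top_mark y : 0 < r -> f y + f y.+1 = r -> (forall j, j < y -> f j + f j.+1 < r) ->
  r \in marks f y.+1 /\ forall j, j <= y -> r \notin marks f j.
Proof.
move=> r0 E H; have N j : j <= y -> r \notin marks f j.
  case: j => // j lt; apply/negP => /top_mark_sum E'.
  by have := H j lt; rewrite E' ltnn.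
split=> //; have := @marks_full y r E; rewrite r0 leqnn => /(_ isT).
by rewrite (negbTE (N y _)).
Qed.

End Marks.

Definition mark_count (f : nat -> nat) (B j : nat) :=
  count (fun v => j \in marks f v) (iota 0 B).

Lemma mark_count_split f f' B y j : y.+2 <= B ->
  (forall v, v < y -> marks f v =i marks f' v) ->
  (forall v, y.+2 <= v -> marks f v =i marks f' v) ->
  mark_count f B j + (j \in marks f' y) + (j \in marks f' y.+1) =
  mark_count f' B j + (j \in marks f y) + (j \in marks f y.+1).
Proof.
move=> le lo hi; rewrite /mark_count -(subnKC le) -(addn2 y) !iotaD !count_cat /= !add0n.
rewrite !addn0.
rewrite (@eq_in_count _ _ (fun v => j \in marks f' v) (iota 0 y)); last first.
  by move=> v; rewrite mem_iota => /lo.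
rewrite (@eq_in_count _ _ (fun v => j \in marks f' v) (iota (y + 2) _)); last first.
  by move=> v; rewrite mem_iota addn2 => /andP[/hi].
move: (count _ (iota 0 y)) (count _ (iota (y + 2) _)) => c d.
by rewrite -/(marks f y.+1) -/(marks f' y.+1); lia.
Qed.

(** The part arriving at y+1 takes the least mark e free there, and e <= r because the pair (y, y+1)
    was not full. By fullness of the next pair, e was a mark of y+2, and it is the one that
    disappears there. The marks of y+3 and above do not change, so e has merely moved. *)
Lemma mark_count_move_back r f B y j : 0 < r -> f 0 = 0 -> pairs_le r f -> f y.+1 + f y.+2 = r ->
  f y + f y.+1 < r -> 0 < f y.+2 -> y.+3 <= B ->
  mark_count (move_back f y.+1) B j = mark_count f B j.
Proof.
move=> r0 f0 okf E lt pf leB; set f' := move_back f y.+1.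
have lo v : v <= y -> marks f' v = marks f v.
  by move=> le; apply: eq_marks => i lei; rewrite /f' /move_back !ifF //; lia.
have f'1 : f' y.+1 = (f y.+1).+1 by rewrite /f' /move_back eqxx.
have f'2 : f' y.+2 = (f y.+2).-1 by rewrite /f' /move_back eqxx ifF //; lia.
have hi v : y.+2 < v -> f' v = f v by move=> l; rewrite /f' /move_back !ifF //; lia.
set e := least_mark (marks f y ++ marks f y.+1).
have M1 : marks f' y.+1 = rcons (marks f y.+1) e.
  by rewrite [marks f' _]/= f'1 lo.
have [e0 + eb] := least_markP (marks f y ++ marks f y.+1); rewrite -/e mem_cat negb_or in e0 eb *.
case/andP=> e1 e2.
have er : e <= r.
  have := @is_next_le _ _ _ e (marks_uniq f y) (next_marksP (marks f y) (f y.+1).+1).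
  by rewrite /= mem_rcons inE eqxx => /(_ isT) H; apply: leq_trans H _; rewrite marks_size; lia.
have e3 : e \in marks f y.+2.
  by have := marks_full f0 okf E (e := e); rewrite e0 er (negbTE e2) => /(_ isT).
have [sz2 uq2 z2 d2 b2] := marksP f y.+1.
have M2 : marks f' y.+2 =i rem e (marks f y.+2).
  move=> i; apply/esym; apply: is_next_marks; rewrite -/(marks f' y.+1) M1; split.
  - by rewrite size_rem // sz2 f'2.
  - exact: rem_uniq.
  - by apply: contra z2; exact: mem_rem.
  - move=> d; rewrite mem_rem_uniq // inE mem_rcons inE negb_or => /andP[-> /d2 ->] //.
  - move=> d k /mem_rem dM; rewrite mem_rcons inE mem_rem_uniq // inE => kd.
    move: (b2 d k dM kd); case: (k == e) => //=.
have M3 : marks f' y.+3 =i marks f y.+3.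
  have [sz3 uq3 z3 d3 b3] := marksP f y.+2.
  move=> i; apply/esym; apply: is_next_marks; rewrite -/(marks f' y.+2); split=> //.
  - by rewrite sz3 hi.
  - move=> d /d3; rewrite M2; apply: contra; exact: mem_rem.
  - move=> d k dM kd; rewrite M2 mem_rem_uniq // inE.
    case/orP: (b3 d k dM kd) => ->; rewrite ?orbT // andbT.
    (* A mark d > e of y+3 cannot exist: absent from y+2, it would by fullness mark y+1, although
       the smaller e was free there. *)
    case: eqP => // ke; subst k.
    have d1 : d \in marks f y.+1.
      have := marks_full f0 okf E (e := d); rewrite (marks_le f0 okf dM) (negbTE (d3 _ dM)).
      rewrite orbF andbT; apply; by case/andP: kd => _; exact: leq_trans.
    have [_ _ _ _ b1] := marksP f y; have := b1 _ _ d1 kd.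
    by rewrite (negbTE e1) (negbTE e2).
have lo' v : v < y.+1 -> marks f' v =i marks f v by move=> l; rewrite lo.
have hi' v : y.+3 <= v -> marks f' v =i marks f v.
  move=> l; apply: (eqi_marks l M3) => k /andP[l1 _]; apply: hi; lia.
have := mark_count_split j leB lo' hi'.
rewrite M2 M1 mem_rcons inE mem_rem_uniq // inE.
case: eqP => [->|_]; first by rewrite e3 (negbTE e2) /=; lia.
by rewrite /=; lia.
Qed.

(** The parts y+1 carry 1, ..., f (y+1) and the parts y+2 the remaining marks up to r. Since f (y+3)
    <= f (y+1), the parts y+3 carry 1, ..., f (y+3), exactly as when nothing precedes them; hence
    only the two removed values lose marks, one of each kind. *)
Lemma mark_count_drop r f f' B y j : f 0 = 0 -> pairs_le r f -> (forall v, v <= y -> f v = 0) ->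
  f y.+1 + f y.+2 = r -> (forall v, f' v = if y < v <= y.+2 then 0 else f v) ->
  y.+3 <= B -> 0 < j <= r ->
  mark_count f B j = (mark_count f' B j).+1.
Proof.
move=> f0 okf z E Ef' leB jr.
have nil g v : (forall u, u <= v -> g u = 0) -> marks g v = [::].
  case: v => // v H; apply/nilP; rewrite /nilp marks_size ?H //.
have M0 : marks f y = [::] by exact: nil.
have M1 : marks f y.+1 =i iota 1 (f y.+1).
  by move=> i; apply/esym/is_next_marks; rewrite -/(marks f y) M0; exact: is_next_iota.
have M'1 : marks f' y.+1 = [::].
  by apply: nil => u le; rewrite Ef'; case: ifP => // H; apply: z; lia.
have M'2 : marks f' y.+2 = [::].
  by apply: nil => u le; rewrite Ef'; case: ifP => // H; apply: z; lia.
have M3 : marks f y.+3 =i marks f' y.+3.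
  move=> i; transitivity (i \in iota 1 (f y.+3)); last first.
    apply: is_next_marks; rewrite -/(marks f' y.+2) M'2.
    by have -> : f' y.+3 = f y.+3; [rewrite Ef' ifF //; lia | exact: is_next_iota].
  apply/esym/is_next_marks; rewrite -/(marks f y.+2).
  have [s u zz d b] := is_next_iota (f y.+3); split=> //.
  - move=> e; rewrite mem_iota => /andP[e0 e1].
    have : e \in marks f y.+1 by rewrite M1 mem_iota e0; have := okf y.+2; lia.
    exact: marks_disj.
  - by move=> e k eI kI; move: (b e k eI kI) => /= ->; rewrite orbT.
have := @mark_count_split f f' B y.+1 j leB.
rewrite M'1 M'2 !addn0 => -> //.
- have := marks_full f0 okf E jr.
  case: (boolP (j \in marks f y.+1)) => [/marks_disj/negbTE ->|_ /= ->] *; lia.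
- move=> v lt; have h u : u <= v -> f u = 0 by move=> le; apply: z; lia.
  by rewrite !nil // => u le; rewrite Ef' h //; case: ifP.
- move=> v l; apply: (eqi_marks l M3) => k /andP[l1 _].
  by rewrite Ef' ifF //; lia.
Qed.

(** * Extraction of one cluster *)

Definition freq (la : seq nat) (v : nat) := count_mem v la.

(* The value at 0 is a virtual multiplicity: it turns the bound a-1 on the
   number of smallest parts into an instance of [pairs_le]. *)
Definition rel_freq (a r m : nat) (la : seq nat) (j : nat) :=
  if j is 0 then r - a.-1 else freq la (2 * m + j).

(** The invariant of [phi] at stage [r]: the [m] clusters already extracted occupy the values up to
    2m. *)
Definition admissible (a r m : nat) (la : seq nat) :=
  (forall v, v \in la -> 2 * m < v) /\ pairs_le r (rel_freq a r m la).

Lemma freq_gt0 la v : (0 < freq la v) = (v \in la).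
Proof. by rewrite /freq -has_count has_pred1. Qed.

Lemma mem_marked j la v : 0 \notin la -> (v \in marked j la) = (j \in marks (freq la) v).
Proof.
move=> z; have [B HB] := bounded_parts la; rewrite (markedE j z HB) mem_filter mem_iota /=.
rewrite add0n andbC; case: ltnP => //= le; apply/esym/negP.
have : marks (freq la) v = [::]; last by move=> ->.
apply/nilP; rewrite /nilp marks_size; last exact/count_memPn.
by apply/eqP/count_memPn/negP => /HB; rewrite ltnNge le.
Qed.

Lemma size_marked j la B : 0 \notin la -> (forall v, v \in la -> v < B) ->
  size (marked j la) = mark_count (freq la) B j.
Proof. by move=> z HB; rewrite (markedE j z HB) size_filter. Qed.

Lemma head_filter_iota (P : pred nat) B y : P y -> y < B -> (forall j, j < y -> ~~ P j) ->
  head 0 [seq v <- iota 0 B | P v] = y.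
Proof.
move=> Py lt H; have -> : B = y + (B - y.+1).+1 by lia.
rewrite iotaD filter_cat (_ : filter _ (iota 0 y) = [::]) /= ?Py //.
apply/eqP; rewrite -(negbK (_ == _)) -has_filter; apply/hasP => -[j].
by rewrite mem_iota => /H /negbTE ->.
Qed.

Lemma head_marked r la y : 0 < r -> 0 \notin la -> pairs_le r (freq la) ->
  freq la y + freq la y.+1 = r -> (forall j, j < y -> freq la j + freq la j.+1 < r) ->
  head 0 (marked r la) = y.+1.
Proof.
move=> r0 z okf E H; have f0 : freq la 0 = 0 by exact/count_memPn.
have [B HB] := bounded_parts la; rewrite (markedE r z HB).
have [ry lo] := first_top_mark f0 okf r0 E H.
apply: head_filter_iota => //; apply: HB; rewrite -freq_gt0 lt0n; apply/eqP => E0.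
by have := marks_size y.+1 f0; rewrite E0 => /size0nil N; rewrite N in ry.
Qed.

Section Admissible.
Variables (a r m : nat) (la : seq nat).
Hypothesis (adm : admissible a r m la).

Lemma adm0 : 0 \notin la.
Proof. by apply/negP => /(proj1 adm). Qed.

Lemma adm_lo v : v <= 2 * m -> freq la v = 0.
Proof. by move=> le; apply/eqP; rewrite -leqn0 leqNgt freq_gt0; apply/negP => /(proj1 adm); lia. Qed.

Lemma adm_ok : pairs_le r (freq la).
Proof.
move=> v; case: (ltngtP v (2 * m)) => [lt|lt|->].
- by rewrite !adm_lo // ltnW.
- have := proj2 adm (v - 2 * m); rewrite /rel_freq.
  case E: (v - 2 * m) => [|j]; first lia.
  have -> : v = 2 * m + j.+1 by lia.
  by rewrite -addnS.
- by rewrite adm_lo // -addn1; have := proj2 adm 0; rewrite /rel_freq; lia.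
Qed.

(** The second hypothesis rules out r copies of 2m+1, the only case where the leftmost full pair of
    actual multiplicities is (2m, 2m+1), which [first_full] does not see. *)
Lemma adm_first_full i : first_full r (rel_freq a r m la) i -> freq la (2 * m).+1 < r ->
  freq la (2 * m + i) + freq la (2 * m + i).+1 = r /\
  forall j, j < 2 * m + i -> freq la j + freq la j.+1 < r.
Proof.
move=> [i0 E H] lt; case: i i0 E H => // i _; rewrite /rel_freq -addnS => E H; split=> //.
move=> j lt2; case: (ltngtP j (2 * m)) => [l|l|->].
- by rewrite !adm_lo //; lia.
- have := H (j - 2 * m).
  case E2: (j - 2 * m) => [|j']; first lia.
  have -> : j = 2 * m + j'.+1 by lia.
  by rewrite -[(2 * m + _).+1]addnS; apply; lia.
- by rewrite adm_lo.
Qed.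

End Admissible.

Lemma mem_marked_chains r la c : c \in marked_chains r la <->
  size c = r /\ forall j, j < r -> nth 0 c j \in marked j.+1 la /\
    (0 < j -> nth 0 c j.-1 <= nth 0 c j <= (nth 0 c j.-1).+1).
Proof.
elim: r c => [|r IH] c.
  by rewrite inE; split=> [/eqP->|[/size0nil -> _]].
split.
- case/allpairsPdep => c' [v [/IH[sc' Hc']]]; rewrite mem_filter => /andP[lv vm] ->.
  rewrite size_rcons sc'; split=> // j; rewrite ltnS leq_eqVlt => /orP[/eqP->|lt].
    rewrite !nth_rcons sc' ltnn eqxx; split=> // r0.
    rewrite prednK // leqnn; case/orP: lv => [/eqP E|].
      by move: sc' r0; rewrite E => <-.
    by rewrite -nth_last sc'.
  rewrite !nth_rcons sc' lt (leq_ltn_trans (leq_pred j) lt); exact: Hc'.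
- case=> sc; case/lastP: c sc => // c v; rewrite size_rcons => -[sc] H.
  apply/allpairsPdep; exists c, v; split=> //.
  + apply/IH; split=> // j lt; have [] := H j (ltnW lt : j < r.+1).
    by rewrite !nth_rcons sc lt (leq_ltn_trans (leq_pred j) lt).
  + have [] := H r (ltnSn r); rewrite !nth_rcons sc ltnn eqxx mem_filter => -> h.
    rewrite andbT; case: (posnP r) => [r0|r0]; first by rewrite -size_eq0 sc r0.
    by move: (h r0); rewrite prednK // leqnn -nth_last sc => ->; rewrite orbT.
Qed.

(** The entries of a chain have distinct marks, so its copies of [v] inject into the marks of
    [v]. *)
Lemma count_chain r la c v : 0 \notin la -> c \in marked_chains r la ->
  count_mem v c <= freq la v.
Proof.
move=> z /mem_marked_chains[sc H].
rewrite -(marks_size v (f := freq la)); last exact/count_memPn.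
have -> : count_mem v c = size [seq j <- iota 0 r | nth 0 c j == v].
  rewrite size_filter -[c in LHS](mkseq_nth 0) count_map sc.
  by apply: eq_count => j.
rewrite -(size_map succn); apply: uniq_leq_size.
  by rewrite map_inj_uniq ?filter_uniq ?iota_uniq //; exact: succn_inj.
move=> x /mapP[j]; rewrite mem_filter mem_iota => /andP[/eqP<- /H[h _] ->].
by rewrite -mem_marked.
Qed.

Lemma count_rem_seq (l c : seq nat) v :
  count_mem v (foldl (fun l x => rem x l) l c) = count_mem v l - count_mem v c.
Proof.
elim: c l => [|x c IH] l; first by rewrite subn0.
by rewrite /= IH count_mem_rem subnDA.
Qed.

Lemma freq_eq_perm la la' : freq la =1 freq la' -> perm_eq la la'.
Proof. by move=> H; apply/allP => v _ /=; apply/eqP; exact: H. Qed.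

Lemma freq_backward r la x : head 0 (marked r la) = x.+2 -> x.+2 \in la ->
  freq (backward_move r la) =1 move_back (freq la) x.+1 /\
  sumn la = (sumn (backward_move r la)).+1.
Proof.
move=> E xla; rewrite /backward_move E; split; last first.
  by rewrite (perm_sumn (perm_to_rem xla)) /=; lia.
move=> v; rewrite /freq /= count_mem_rem /move_back.
case: (ltngtP v x.+1) => [lt|lt|->].
- have [-> ->] : (x.+2 == v) = false /\ (v == x.+2) = false by lia.
  by rewrite add0n subn0.
- case: (v =P x.+2) => [->|ne].
    by rewrite eqxx add0n subn1.
  by rewrite (_ : (x.+2 == v) = false) ?add0n ?subn0 //; apply/eqP => /esym.
- by rewrite (_ : (x.+2 == x.+1) = false) ?subn0 //; lia.
Qed.

Lemma backward_step a r m la i (F := rel_freq a r m la) (la1 := backward_move r la) :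
  0 < r -> admissible a r m la -> first_full r F i -> 0 < moves_left r F i ->
  [/\ admissible a r m la1, rel_freq a r m la1 =1 move_back F i,
      forall j, size (marked j la1) = size (marked j la),
      sumn la = (sumn la1).+1 & size la1 = size la].
Proof.
move=> r0 adm fi p0.
have okF : pairs_le r F by case: adm.
have z := adm0 adm; have f0 : freq la 0 = 0 by exact/count_memPn.
(* With F 1 = r the pair (1, 2) is full and the only term of [moves_left] vanishes, against [p0]. *)
have F1 : F 1 < r.
  rewrite ltnNge; apply/negP => ge.
  have f1 : first_full r F 1 by split=> //; [have := okF 1; lia | case=> // -[]].
  by move: p0; rewrite (first_full_uniq fi f1) moves_leftS /moves_left big_ord0; lia.
have Fi1 := first_full_gt0 r0 okF fi p0.
have [] := adm_first_full adm fi; first by move: F1; rewrite /F /= addn1.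
case: (fi) => i0 _ _; case: i i0 fi p0 Fi1 => // i _ fi p0 Fi1.
rewrite addnS => E H.
have Fx : 0 < freq la (2 * m + i).+2 by move: Fi1; rewrite /F /= !addnS.
have hd := head_marked r0 z (adm_ok adm) E H.
have xla : (2 * m + i).+2 \in la by rewrite -freq_gt0.
have [fE sE] := freq_backward hd xla.
have relE : rel_freq a r m la1 =1 move_back F i.+1.
  case=> [|j] //; rewrite /rel_freq fE /move_back !addnS !eqSS eqn_add2l.
  case: (j =P i) => [_|_]; first by rewrite /F /= addnS.
  have -> : (2 * m + j == (2 * m + i).+1) = (j == i.+1) by rewrite -addnS eqn_add2l.
  by case: (j =P i.+1) => [_|_]; rewrite /F /= !addnS.
have [okM _] := move_backP r0 okF fi p0.
have lo v : v \in la1 -> 2 * m < v.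
  rewrite ltnNge -freq_gt0 fE => pv; apply/negP => le.
  by move: pv; rewrite /move_back !ifF ?(adm_lo adm le) //; lia.
split=> //.
- by split=> // j; rewrite !relE; exact: okM.
- move=> j; have [B HB] := bounded_parts la.
  have z1 : 0 \notin la1 by apply/negP => /lo.
  have HB1 v : v \in la1 -> v < B.+2 by rewrite inE hd => /orP[/eqP->|/mem_rem /HB]; have := HB _ xla; lia.
  have HB' v : v \in la -> v < B.+2 by move=> /HB; lia.
  rewrite (size_marked j z1 HB1) (size_marked j z HB').
  rewrite -(mark_count_move_back (B := B.+2) j r0 f0 (adm_ok adm) E) //.
  + by apply: eq_count => v; rewrite (@eq_marks _ (move_back (freq la) (2 * m + i).+1)).
  + by apply: H; rewrite ltnSn.
  + by have := HB _ xla; lia.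
- by rewrite /la1 /backward_move hd /= size_rem //; case: (la) xla.
Qed.

(** This prevents [find] from stopping too early: the counts required by [in_place] are lower bounds
    for F 1 and F 2, and together with the upper bounds on the pair sums they force both pairs (0,
    1) and (1, 2) to be full. *)
Lemma in_place_moves_left0 a r m la c i : 0 < a -> 0 < r -> admissible a r m la ->
  first_full r (rel_freq a r m la) i ->
  c \in marked_chains r la -> in_place a r m c -> moves_left r (rel_freq a r m la) i = 0.
Proof.
move=> a0 r0 adm fi cm; rewrite /in_place.
have ch v := count_chain v (adm0 adm) cm.
have := proj2 adm 0; have := proj2 adm 1.
have := ch (2 * m + 1); have := ch (2 * m + 2).
set F := rel_freq a r m la in fi *.
rewrite -[freq la (2 * m + 1)]/(F 1) -[freq la (2 * m + 2)]/(F 2).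
have F0 : F 0 = r - a.-1 by [].
move=> c2 c1 ok1 ok0 ip.
have [f01 f12] : F 0 + F 1 = r /\ F 1 + F 2 = r.
  move: ip; case: leqP => [le /andP[/eqP e1 /eqP e2]|lt /eqP e1]; lia.
have f1 : first_full r F 1 by split=> //; case=> // -[].
by rewrite (first_full_uniq fi f1) moves_leftS /moves_left big_ord0; lia.
Qed.

Section Settled.
Variables (a r m : nat) (la : seq nat).
Let F := rel_freq a r m la.
Hypotheses (a0 : 0 < a) (r0 : 0 < r) (adm : admissible a r m la).
Hypotheses (F01 : F 0 + F 1 = r) (F12 : F 1 + F 2 = r).
Let c0 := nseq (F 1) (2 * m + 1) ++ nseq (F 2) (2 * m + 2).

Let f0 : freq la 0 = 0.
Proof. exact/count_memPn/adm0/adm. Qed.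

Let marks1 : marks (freq la) (2 * m + 1) =i iota 1 (F 1).
Proof.
move=> j; rewrite addn1; apply/esym/is_next_marks; rewrite -/(marks (freq la) (2 * m)).
have -> : marks (freq la) (2 * m) = [::].
  by apply/nilP; rewrite /nilp marks_size // (adm_lo adm).
by rewrite -addn1; exact: is_next_iota.
Qed.

Let marks2 j : 0 < j <= r -> (j \in marks (freq la) (2 * m + 2)) = (F 1 < j).
Proof.
move=> jr; have E : freq la (2 * m + 1) + freq la (2 * m + 1).+1 = r by rewrite -addnS.
have := marks_full f0 (adm_ok adm) E jr; rewrite -addnS marks1 mem_iota add1n ltnS.
case/andP: (jr) => -> _ /=; case: leqP => //= le _.
apply/negbTE; rewrite addnS; apply: marks_disj.
by rewrite marks1 mem_iota add1n ltnS le; case/andP: jr => ->.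
Qed.

Let c0_nth j : j < r -> nth 0 c0 j = if j < F 1 then 2 * m + 1 else 2 * m + 2.
Proof.
move=> lt; rewrite nth_cat size_nseq; case: ltnP => H; rewrite nth_nseq ?H //.
by rewrite ifT //; lia.
Qed.

Let c0_size : size c0 = r.
Proof. by rewrite size_cat !size_nseq. Qed.

Let F1E : F 1 = freq la (2 * m).+1. Proof. by rewrite /F /= addn1. Qed.
Let F2E : F 2 = freq la (2 * m).+2. Proof. by rewrite /F /= addn2. Qed.

Let last_c0 : last 0 c0 = head 0 (marked r la).
Proof.
rewrite -nth_last c0_size c0_nth ?prednK //.
case: (leqP r (F 1)) => H; rewrite ?addn1 ?addn2; apply/esym/head_marked => //.
- exact: adm0 adm.
- exact: adm_ok adm.
- by rewrite (adm_lo adm) // -F1E; lia.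
- by move=> j lt; rewrite !(adm_lo adm) // ltnW.
- exact: adm0 adm.
- exact: adm_ok adm.
- by rewrite -F1E -F2E.
- move=> j; rewrite ltnS leq_eqVlt => /orP[/eqP->|lt].
    by rewrite (adm_lo adm) // -F1E; lia.
  by rewrite !(adm_lo adm) // ltnW.
Qed.

Let chain_c0 : c0 \in marked_chains r la.
Proof.
apply/mem_marked_chains; split=> // j lt; have z := adm0 adm.
rewrite c0_nth // mem_marked //; split.
  case: ltnP => H; first by rewrite marks1 mem_iota.
  by rewrite marks2.
move=> j0; rewrite c0_nth; last by lia.
by do 2! case: ifP; lia.
Qed.

(** Descending from its last entry, a chain stays at most 2m+2, and all parts exceed 2m. So each
    entry is 2m+1 or 2m+2, and its mark decides which. *)
Let chain_uniq c : c \in marked_chains r la -> last 0 c = head 0 (marked r la) -> c = c0.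
Proof.
move=> /mem_marked_chains[sc H] lc; have z := adm0 adm.
apply: (@eq_from_nth _ 0) => [|j]; first by rewrite c0_size.
rewrite sc => lt; rewrite c0_nth //.
have mon k : k < r -> nth 0 c (r.-1 - k) <= 2 * m + 2.
  elim: k => [_|k IH kr].
    rewrite subn0 -sc nth_last lc -last_c0 -nth_last c0_size c0_nth ?prednK //.
    by case: ifP; lia.
  apply: leq_trans (IH (ltnW kr)); have [|_ h] := H (r.-1 - k); first lia.
  have k0 : 0 < r.-1 - k by lia.
  have /andP[+ _] := h k0.
  by have -> : (r.-1 - k).-1 = r.-1 - k.+1 by lia.
have hi : nth 0 c j <= 2 * m + 2.
  by rewrite (_ : j = r.-1 - (r.-1 - j)); [apply: mon; lia | lia].
have [+ _] := H j lt; have lo : 2 * m < nth 0 c j.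
  have [+ _] := H j lt; rewrite mem_marked //; case: (ltnP (2 * m)) => // le.
  suff -> : marks (freq la) (nth 0 c j) = [::] by [].
  by apply/nilP; rewrite /nilp marks_size // (adm_lo adm).
rewrite mem_marked //.
have [->|->] : nth 0 c j = 2 * m + 1 \/ nth 0 c j = 2 * m + 2 by lia.
- by rewrite marks1 mem_iota => /andP[_]; rewrite add1n ltnS => ->.
- by rewrite marks2 // ltnS leqNgt => /negbTE ->.
Qed.

Lemma first_cluster_settled : first_cluster r la = Some c0.
Proof.
rewrite /first_cluster; set s := filter _ _.
have all_c0 c : c \in s -> c = c0.
  by rewrite mem_filter /clusters mem_filter => /andP[/eqP lc /andP[_ cm]]; exact: chain_uniq.
have c0s : c0 \in s.
  have N v : v \notin marked r.+1 la.
    rewrite mem_marked ?(adm0 adm) //; apply/negP => /(marks_le f0 (adm_ok adm)).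
    by rewrite ltnn.
  by rewrite mem_filter mem_filter last_c0 eqxx !N chain_c0.
by case: s all_c0 c0s => // c s H _; rewrite /= (H c) // inE eqxx.
Qed.

Lemma in_place_settled : in_place a r m c0.
Proof.
have F0 : F 0 = r - a.-1 by [].
move: F01 F12 F0; rewrite /in_place /c0; move: (F 0) (F 1) (F 2) => x y w e1 e2 e0.
rewrite !count_cat !count_nseq /= !eqxx.
have -> : (2 * m + 2 == 2 * m + 1) = false by rewrite eqn_add2l.
have -> : (2 * m + 1 == 2 * m + 2) = false by rewrite eqn_add2l.
rewrite !mul0n !mul1n addn0 add0n; case: leqP => H; last lia.
by apply/andP; split; lia.
Qed.

(** Removing the values 2m+1 and 2m+2 rebases the multiplicities at 2(m+1), which is the shift made
    by [drop_pair]. As F 2 = F 0, the cluster has r - (a-1) parts 2m+2, whence its sum. *)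
Lemma settled_rest (la' := foldl (fun l x => rem x l) la c0) :
  [/\ admissible a r m.+1 la', rel_freq a r m.+1 la' =1 drop_pair F 1,
      forall j, 0 < j <= r -> size (marked j la) = (size (marked j la')).+1,
      sumn la = r * (2 * m + 1) + (r - a.-1) + sumn la' &
      size la = r + size la'].
Proof.
have z := adm0 adm.
have c0E v : count_mem v c0 = if 2 * m < v <= (2 * m).+2 then freq la v else 0.
  rewrite /c0 F1E F2E count_cat !count_nseq /= addn1 addn2.
  case: (v =P (2 * m).+1) => [->|n1].
    by rewrite eqxx ifT ?mul1n; [have : ((2 * m).+2 == (2 * m).+1) = false by lia|]; lia.
  have -> : ((2 * m).+1 == v) = false by lia.
  case: (v =P (2 * m).+2) => [->|n2].
    by rewrite eqxx ifT ?mul1n; lia.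
  have -> : ((2 * m).+2 == v) = false by lia.
  by rewrite ifF //; lia.
have fE v : freq la' v = if 2 * m < v <= (2 * m).+2 then 0 else freq la v.
  by rewrite /freq count_rem_seq c0E /freq; case: ifP; rewrite ?subnn ?subn0.
have lo v : v \in la' -> 2 * m.+1 < v.
  rewrite -freq_gt0 fE ltnNge => pv; apply/negP => le; move: pv.
  by case: ifP => // h; rewrite (adm_lo adm) //; lia.
have relE : rel_freq a r m.+1 la' =1 drop_pair F 1.
  by case=> // j; rewrite /rel_freq fE /drop_pair ifF; [rewrite /F /=; congr (freq _ _)|]; lia.
have f1 : first_full r F 1 by split=> //; case=> // -[].
have perm : perm_eq la (c0 ++ la').
  apply: freq_eq_perm => v; rewrite {2}/freq count_cat -/(freq la' v) fE c0E.
  by case: ifP; rewrite ?addn0.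
split=> //.
- by split=> // j; rewrite !relE; apply: pairs_le_drop_pair => //; case: adm.
- move=> j jr; have z' : 0 \notin la' by apply/negP => /lo.
  have [B HB] := bounded_parts la.
  have HB1 v : v \in la -> v < B + (2 * m).+3 by move/HB; lia.
  have HB2 v : v \in la' -> v < B + (2 * m).+3.
    by move=> h; apply: HB1; rewrite (perm_mem perm) mem_cat h orbT.
  rewrite (size_marked j z HB1) (size_marked j z' HB2).
  apply: (@mark_count_drop r _ _ _ (2 * m)) => //; last lia.
  + exact: adm_ok adm.
  + by move=> v; exact: adm_lo adm _.
  + by rewrite -addn1 -[(_ + _).+1]addnS.
- rewrite (perm_sumn perm) sumn_cat sumn_cat !sumn_nseq.
  have F0 : F 0 = r - a.-1 by [].
  have -> : r - a.-1 = F 2 by lia.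
  by rewrite -[in r * _]F12; nia.
- by rewrite (perm_size perm) size_cat c0_size.
Qed.

End Settled.

Lemma find_traject (T : Type) (P : pred T) (f : T -> T) x n t : t < n ->
  P (iter t f x) -> (forall j, j < t -> ~~ P (iter j f x)) ->
  find P (traject f x n) = t.
Proof.
elim: n x t => // n IH x [|t] lt Pt H /=; first by rewrite Pt.
rewrite (negbTE (H 0 isT)) (IH _ t) // -?iterSr // => j ltj.
by rewrite -iterSr; exact: (H j.+1).
Qed.

Lemma settle_iter a r m la i t (F := rel_freq a r m la)
    (settled := fun la' => oapp (in_place a r m) false (first_cluster r la'))
    (la_t := iter t (backward_move r) la) :
  0 < a -> 0 < r -> admissible a r m la -> first_full r F i -> moves_left r F i = t ->
  [/\ settled la_t, forall j, j < t -> ~~ settled (iter j (backward_move r) la) &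
  exists c, let la' := foldl (fun l x => rem x l) la_t c in
    [/\ first_cluster r la_t = Some c, size c = r &
    [/\ admissible a r m.+1 la', rel_freq a r m.+1 la' =1 drop_pair F i,
      forall j, 0 < j <= r -> size (marked j la) = (size (marked j la')).+1,
      sumn la = t + r * (2 * m + 1) + (r - a.-1) + sumn la' &
      size la = r + size la']]].
Proof.
rewrite {}/la_t {}/settled {}/F => a0 r0.
elim: t la i => [|t IH] la i adm fi pt.
  have okF : pairs_le r (rel_freq a r m la) by case: adm.
  have [i1 F01] := moves_left0 okF fi pt; subst i; have [_ F12 _] := fi.
  have fc := first_cluster_settled a0 r0 adm F01 F12.
  have ip := in_place_settled a0 r0 adm F01 F12.
  split=> //; first by rewrite /= fc.
  eexists; split; first exact: fc.
    by rewrite size_cat !size_nseq F12.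
  exact: settled_rest a0 r0 adm F01 F12.
have p0 : 0 < moves_left r (rel_freq a r m la) i by rewrite pt.
have [adm1 relE mE sE szE] := backward_step r0 adm fi p0.
have okF : pairs_le r (rel_freq a r m la) by case: adm.
have [_ [i1 [fi1 pi1 dE]]] := move_backP r0 okF fi p0.
have relE' : move_back (rel_freq a r m la) i =1 rel_freq a r m (backward_move r la) by move=> j; rewrite relE.
have [|S1 S2 [c [fc sc [H1 H2 H3 H4 H5]]]] := IH _ _ adm1 (first_full_eq relE' fi1).
  by apply/succn_inj; rewrite -pt -pi1; congr _.+1; apply: moves_left_eq => j _; rewrite relE.
rewrite iterSr; split=> //.
  case=> [_|j]; last by rewrite iterSr ltnS; exact: S2.
  rewrite /=; case E: first_cluster => [c'|] //=; apply/negP => ip.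
  have cm : c' \in marked_chains r la.
    move: E; rewrite /first_cluster; case E2: [seq _ <- _ | _] => [|c'' s] // [E3].
    have : c' \in c'' :: s by rewrite E3 inE eqxx.
    by rewrite -E2 !mem_filter => /andP[_ /andP[_]].
  by have := in_place_moves_left0 a0 r0 adm fi cm ip; rewrite pt.
exists c; split=> //; split=> //.
- by move=> j; rewrite H2 -dE /drop_pair !relE.
- by move=> j jr; rewrite -mE H3.
- by rewrite sE H4 !addSn.
- by rewrite -szE H5.
Qed.

(** A relational form of [settle_cluster] expressed by multiplicities only: it ignores the order of
    the lists and can be run backwards. *)
Definition extract (a r m : nat) (la : seq nat) (t : nat) (la' : seq nat) :=
  [/\ admissible a r m la, admissible a r m.+1 la' & exists i,
    [/\ first_full r (rel_freq a r m la) i, moves_left r (rel_freq a r m la) i = t &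
        rel_freq a r m.+1 la' =1 drop_pair (rel_freq a r m la) i]].

Lemma admissible_perm a r m la la' : perm_eq la la' -> admissible a r m la ->
  admissible a r m la'.
Proof.
move=> p [H1 H2]; split; first by move=> v; rewrite -(perm_mem p); exact: H1.
have E j : rel_freq a r m la' j = rel_freq a r m la j.
  by case: j => //= j; rewrite /freq (permP p).
by move=> j; rewrite !E.
Qed.

Lemma rel_freq_perm a r m la la' : perm_eq la la' ->
  rel_freq a r m la =1 rel_freq a r m la'.
Proof. by move=> p [|j] //=; rewrite /freq (permP p). Qed.

Lemma perm_rel_freq a r m la la' : admissible a r m la -> admissible a r m la' ->
  rel_freq a r m la =1 rel_freq a r m la' -> perm_eq la la'.
Proof.
move=> adm adm' E; apply: freq_eq_perm => v.
case: (leqP v (2 * m)) => lt; first by rewrite (adm_lo adm lt) (adm_lo adm' lt).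
by have := E (v - 2 * m); rewrite /rel_freq; case E2: (v - 2 * m) => [|j];
  [lia | have -> : v = 2 * m + j.+1 by lia].
Qed.

Lemma extract_perm a r m la la0 t la' la'0 : perm_eq la la0 -> perm_eq la' la'0 ->
  extract a r m la t la' -> extract a r m la0 t la'0.
Proof.
move=> p p' [adm adm' [i [fi pi dE]]]; split.
- exact: admissible_perm p adm.
- exact: admissible_perm p' adm'.
- have E := rel_freq_perm a r m p; exists i; split; first exact: first_full_eq E fi.
    by rewrite -pi; apply: moves_left_eq => j _; rewrite E.
  by move=> j; rewrite -(rel_freq_perm a r m.+1 p') dE /drop_pair !E.
Qed.

Lemma extract_fun a r m la t1 l1 t2 l2 : extract a r m la t1 l1 ->
  extract a r m la t2 l2 -> t1 = t2 /\ perm_eq l1 l2.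
Proof.
move=> [_ adm1 [i1 [f1 <- d1]]] [_ adm2 [i2 [f2 <- d2]]].
have E := first_full_uniq f1 f2; subst i2; split=> //.
by apply: perm_rel_freq adm1 adm2 _ => j; rewrite d1 d2.
Qed.

Lemma extract_inj a r m la1 la2 t l1 l2 : extract a r m la1 t l1 ->
  extract a r m la2 t l2 -> perm_eq l1 l2 -> perm_eq la1 la2.
Proof.
move=> [adm1 _ [i1 [f1 p1 d1]]] [adm2 _ [i2 [f2 p2 d2]]] p.
apply: (perm_rel_freq adm1 adm2); apply: drop_pair_inj f1 f2 _ _.
- by case: adm1.
- by case: adm2.
- by rewrite p1 p2.
- by move=> j; rewrite -d1 -d2 (rel_freq_perm a r m.+1 p).
Qed.

Lemma extract_mono a r m la t la1 t1 la2 : extract a r m la t la1 ->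
  extract a r m.+1 la1 t1 la2 -> t <= t1.
Proof.
move=> [adm _ [i [fi <- d]]] [_ _ [i1 [f1 <- _]]].
have okF : pairs_le r (rel_freq a r m la) by case: adm.
have -> : moves_left r (rel_freq a r m.+1 la1) i1 = moves_left r (drop_pair (rel_freq a r m la) i) i1.
  by apply: moves_left_eq => j _; rewrite d.
by apply: moves_left_drop_pair okF fi _; apply: first_full_eq f1.
Qed.

Lemma settle_clusterP a r m la : 0 < a -> 0 < r -> admissible a r m la ->
  (exists i, first_full r (rel_freq a r m la) i) ->
  exists t c la', [/\ settle_cluster a r m la = Some (t, c, la'), size c = r,
    extract a r m la t la' &
    [/\ forall j, 0 < j <= r -> size (marked j la) = (size (marked j la')).+1,
      sumn la = t + r * (2 * m + 1) + (r - a.-1) + sumn la' &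
      size la = r + size la']].
Proof.
move=> a0 r0 adm [i fi].
have [S1 S2 [c [fc sc [H1 H2 H3 H4 H5]]]] := settle_iter a0 r0 adm fi erefl.
set t := moves_left _ _ _ in S1 S2 fc H1 H2 H3 H4 H5.
set la' := foldl _ _ _ in H1 H2 H3 H4 H5.
exists t, c, la'; split=> //; last by split=> //; exists i.
have lt : t <= sumn la by rewrite H4 -!addnA leq_addr.
by rewrite /settle_cluster (find_traject (t := t)) // lt fc.
Qed.

Lemma extract_stats a r m la t la' : 0 < a -> 0 < r -> extract a r m la t la' ->
  [/\ forall j, 0 < j <= r -> size (marked j la) = (size (marked j la')).+1,
      sumn la = t + r * (2 * m + 1) + (r - a.-1) + sumn la' &
      size la = r + size la'].
Proof.
move=> a0 r0 ex; have [adm _ [i [fi _ _]]] := ex.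
have [t0 [c [l [_ _ ex0 [H1 H2 H3]]]]] := settle_clusterP a0 r0 adm (ex_intro _ i fi).
have [-> p] := extract_fun ex ex0; rewrite (perm_sumn p) (perm_size p); split=> // j jr.
rewrite H1 //; congr _.+1.
have z : 0 \notin la' by case: ex => _ [lo _] _; apply/negP => /lo.
have [B HB] := bounded_parts la'.
rewrite (size_marked j z HB) (@size_marked _ l B) -?(perm_mem p) //; last first.
  by move=> v; rewrite -(perm_mem p); exact: HB.
by apply: eq_count => v; rewrite (eq_marks (f' := freq l)) // => u _; rewrite /freq (permP p).
Qed.

Lemma marked_perm j la la' : perm_eq la la' -> marked j la = marked j la'.
Proof.
by rewrite /marked /gordon_marking => /(perm_sortP leq_total leq_trans anti_leq) ->.
Qed.

Lemma marked_first_full a r m la : 0 < r -> admissible a r m la -> marked r la <> [::] ->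
  exists i, first_full r (rel_freq a r m la) i.
Proof.
move=> r0 adm ne; apply: first_full_ex; first by case: adm.
have z := adm0 adm; have f0 : freq la 0 = 0 by exact/count_memPn.
case E: (marked r la) ne => [//|v s] _; have : v \in marked r la by rewrite E inE eqxx.
rewrite mem_marked //; case: v {E} => // v /(top_mark_sum f0 (adm_ok adm)) E.
case: (ltngtP v (2 * m)) E => [lt|lt|->] E.
- by move: E; rewrite (adm_lo adm (ltnW lt)) (adm_lo adm lt); lia.
- exists (v - 2 * m); first by lia.
  rewrite /rel_freq; case E2: (v - 2 * m) => [|j]; first lia.
  have Ev : v = 2 * m + j.+1 by lia.
  by rewrite -E Ev -[(_ + _).+1 in RHS]addnS.
(* The full pair is (2m, 2m+1), which [first_full] does not see; but then F 1 = r and F 2 = 0, so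
   the pair (1, 2) is full too. *)
- exists 1 => //; have := proj2 adm 1; have := E.
  by rewrite /rel_freq (adm_lo adm) // addn1; lia.
Qed.

Lemma first_full_marked a r m la i : 0 < a -> 0 < r -> admissible a r m la ->
  first_full r (rel_freq a r m la) i -> marked r la <> [::].
Proof.
move=> a0 r0 adm fi E.
have [t0 [c [l [_ _ _ [H1 _ _]]]]] := settle_clusterP a0 r0 adm (ex_intro _ i fi).
by have := H1 r; rewrite E r0 leqnn => /(_ isT).
Qed.

Lemma extract_surj a r m la' t : 0 < r -> admissible a r m.+1 la' ->
  (forall i, first_full r (rel_freq a r m.+1 la') i -> t <= moves_left r (rel_freq a r m.+1 la') i) ->
  exists la, extract a r m la t la'.
Proof.
move=> r0 adm Ht; have okG := proj2 adm; set G := rel_freq a r m.+1 la' in Ht okG.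
have [B HB] := bounded_parts la'.
have G0 j : B < j -> G j = 0.
  case: j => // j lt; apply/eqP; rewrite -leqn0 leqNgt /G /= freq_gt0.
  by apply/negP => /HB; lia.
have [|F [i [okF fi pi dE]]] := drop_pair_surj r0 okG _ Ht; first by exists B.+1.
have F0 : F 0 = r - a.-1 by have := dE 0; rewrite /drop_pair; case: fi => ->.
have Fhi j : i.+2 + B < j -> F j = 0.
  move=> lt; have := dE j.-2; rewrite /drop_pair ifF; last by lia.
  by have -> : j.-2.+2 = j; [lia | move=> ->; apply: G0; lia].
(* The entries of [F] are placed above 2m; entry 0, being virtual, yields no part. *)
pose la := expand (fun v => if v <= 2 * m then 0 else F (v - 2 * m)) (2 * m + (i.+2 + B).+1).
have fE v : freq la v = if v <= 2 * m then 0 else F (v - 2 * m).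
  rewrite /freq count_expand; case: (leqP v (2 * m)) => le; first by case: ifP.
  by case: ltnP => // le2; rewrite Fhi //; lia.
have relE : rel_freq a r m la =1 F.
  case=> [|j] //; rewrite /rel_freq fE ifF; last by lia.
  by congr F; lia.
exists la; split=> //.
- split; last by move=> j; rewrite !relE.
  by move=> v; rewrite -freq_gt0 fE; case: (leqP v).
- exists i; split; first by apply: (first_full_eq _ fi) => j; rewrite relE.
    by rewrite -pi; apply: moves_left_eq => j _; exact: relE.
  by move=> j; rewrite -[LHS]dE /drop_pair !relE.
Qed.

(** * The map phi *)

(** Stage [r] as a relation. [ts] lists the numbers of moves in order of extraction, hence
    increasingly, whereas [phi_stage] accumulates them in reverse. *)
Fixpoint extracts (a r m : nat) (la ts la' : seq nat) : Prop :=
  if ts is t :: ts' then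
    exists la1, extract a r m la t la1 /\ extracts a r m.+1 la1 ts' la'
  else [/\ admissible a r m la, marked r la = [::] & perm_eq la la'].

Section Stage.
Variables (a r : nat).
Hypotheses (a0 : 0 < a) (r0 : 0 < r).

Lemma extracts_perm m la la0 ts la' la'0 : perm_eq la la0 -> perm_eq la' la'0 ->
  extracts a r m la ts la' -> extracts a r m la0 ts la'0.
Proof.
elim: ts m la la0 => [|t ts IH] m la la0 p p' /=.
  move=> [adm mE pp]; split; first exact: admissible_perm p adm.
    by rewrite -(marked_perm r p).
  by rewrite perm_sym in p; exact: perm_trans p (perm_trans pp p').
move=> [la1 [ex exs]]; exists la1; split; first exact: extract_perm p _ ex.
exact: IH exs.
Qed.

Lemma extracts_adm m la ts la' : extracts a r m la ts la' ->
  [/\ admissible a r m la, admissible a r (m + size ts) la' & marked r la' = [::]].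
Proof.
elim: ts m la => [|t ts IH] m la /=.
  move=> [adm mE p]; rewrite addn0 -(marked_perm r p); split=> //.
  exact: admissible_perm p adm.
by move=> [la1 [[adm _ _] /IH[]]]; rewrite addnS.
Qed.

Lemma extracts_ex m la : admissible a r m la -> exists ts la', extracts a r m la ts la'.
Proof.
move E: (size (marked r la)) => n; elim: n m la E => [|n IH] m la E adm.
  by exists [::], la; split=> //; exact: size0nil.
have ne : marked r la <> [::] by move=> E0; rewrite E0 in E.
have [t [c [la1 [_ _ ex [H1 _ _]]]]] := settle_clusterP a0 r0 adm (marked_first_full r0 adm ne).
have [||ts [la' exs]] := IH m.+1 la1; last by exists (t :: ts), la', la1.
- by have := H1 r; rewrite E r0 leqnn => /(_ isT) [].
- by case: ex.
Qed.

(** The expression r m^2 + (r - (a-1)) m is a potential whose increase from m to m+1 is r(2m+1) + (r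
    - (a-1)), the sum of a cluster in place. *)
Lemma extracts_stats m la ts la' : extracts a r m la ts la' ->
  [/\ forall j, 0 < j <= r -> size (marked j la) = size ts + size (marked j la'),
      sumn la + (r * m ^ 2 + (r - a.-1) * m) =
        sumn ts + sumn la' + (r * (m + size ts) ^ 2 + (r - a.-1) * (m + size ts)) &
      size la = r * size ts + size la'].
Proof.
elim: ts m la => [|t ts IH] m la /=.
  move=> [adm mE p]; rewrite (perm_sumn p) (perm_size p); split; [|by lia|by rewrite muln0].
  by move=> j _; rewrite (marked_perm j p).
move=> [la1 [ex /IH[I1 I2 I3]]]; have [E1 E2 E3] := extract_stats a0 r0 ex; split.
- by move=> j jr; rewrite E1 // I1.
- rewrite E2; move: I2; rewrite addSnnS.
  by move: (sumn la1) (sumn ts) (size ts) (r - a.-1) => *; nia.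
- by rewrite E3 I3; lia.
Qed.

Lemma extracts_sorted m la ts la' : extracts a r m la ts la' -> sorted leq ts.
Proof.
elim: ts m la => [|t ts IH] m la //= [la1 [ex exs]].
have := IH _ _ exs; case: ts exs {IH} => //= t' ts [la2 [ex2 _]] ->.
by rewrite (extract_mono ex ex2).
Qed.

Lemma extracts_inj m la1 la2 ts l1 l2 : extracts a r m la1 ts l1 ->
  extracts a r m la2 ts l2 -> perm_eq l1 l2 -> perm_eq la1 la2.
Proof.
elim: ts m la1 la2 => [|t ts IH] m la1 la2 /=.
  move=> [_ _ p1] [_ _ p2] p; apply: perm_trans p1 (perm_trans p _).
  by rewrite perm_sym.
move=> [l1' [e1 es1]] [l2' [e2 es2]] p.
exact: extract_inj e1 e2 (IH _ _ _ es1 es2 p).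
Qed.

(** The clusters are put back from the last one to the first. The bound asked by [extract_surj]
    comes from the sortedness of [ts]; for the last cluster it is vacuous, as no full pair remains
    after it. *)
Lemma extracts_surj m ts la' : admissible a r (m + size ts) la' -> marked r la' = [::] ->
  sorted leq ts -> exists la, extracts a r m la ts la'.
Proof.
elim: ts m => [|t ts IH] m adm mE srt.
  by exists la'; split=> //; rewrite addn0 in adm.
have [||la1 exs] := IH m.+1 _ mE; first by rewrite addSnnS.
  by case: (ts) srt => //= t' ts' /andP[].
have [adm1 _ _] := extracts_adm exs.
have [i fi|la ex] := @extract_surj a r m la1 t r0 adm1; last by exists la, la1.
case: ts exs srt {IH adm} => [[_ mE1 _]|t' ts [la2 [ex2 _]] /= /andP[le _]].
  by case: (first_full_marked a0 r0 adm1 fi).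
have [_ _ [i' [fi' p' _]]] := ex2.
by rewrite (first_full_uniq fi fi') p'.
Qed.

Lemma phi_stageP fuel la ts la' mu pi : size ts <= fuel ->
  extracts a r (size mu) la ts la' ->
  exists la'' mu1, [/\ phi_stage fuel a r la mu pi = Some (la'', mu ++ mu1, rev ts ++ pi),
    perm_eq la'' la', all (fun c => size c == r) mu1 & size mu1 = size ts].
Proof.
elim: fuel la ts mu pi => [|fuel IH] la [|t ts] mu pi //=.
- by move=> _ [adm -> p]; exists la, [::]; rewrite cats0.
- by move=> _ [adm -> p]; exists la, [::]; rewrite cats0.
rewrite ltnS => le [la1 [ex exs]]; have [adm _ [i [fi _ _]]] := ex.
have [t0 [c [la0 [sE sc ex0 _]]]] := settle_clusterP a0 r0 adm (ex_intro _ i fi).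
have [tE p] := extract_fun ex ex0; subst t0.
have exs0 := extracts_perm p (perm_refl _) exs.
rewrite -(size_rcons mu c) in exs0.
have [la'' [mu1 [E p2 al sz]]] := IH la0 ts (rcons mu c) (t :: pi) le exs0.
exists la'', (c :: mu1); split=> //=.
- case E2: (marked r la) => [|x s]; first by case: (first_full_marked a0 r0 adm fi).
  by rewrite sE E cat_rcons rev_cons cat_rcons.
- by rewrite sc eqxx.
- by rewrite sz.
Qed.

End Stage.

(** * Passing between consecutive stages, and the weight shared by both maps *)

Lemma admissible_pred a r m la : admissible a r.+1 m la -> marked r.+1 la = [::] ->
  admissible a r m la.
Proof.
move=> adm mE; have z := adm0 adm; have f0 : freq la 0 = 0 by exact/count_memPn.
have lt v : freq la v + freq la v.+1 <= r.
  rewrite -ltnS ltn_neqAle (adm_ok adm) andbT; apply/negP => /eqP E.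
  have := marks_full f0 (adm_ok adm) E (e := r.+1); rewrite leqnn => /(_ isT).
  by rewrite -!mem_marked // mE.
split; first by case: adm.
case=> [|j]; last by rewrite /rel_freq [in freq la (2 * m + j.+2)]addnS; exact: lt.
(* When a-1 > r the virtual entry is 0 at both stages, so the bound at index 0 has to come from the
   actual pair (2m, 2m+1). *)
have := proj2 adm 0; have := lt (2 * m); rewrite /rel_freq (adm_lo adm) // addn1; lia.
Qed.

Lemma admissible_succ a r m la : admissible a r m la ->
  admissible a r.+1 m la /\ marked r.+1 la = [::].
Proof.
move=> adm; have z := adm0 adm; have f0 : freq la 0 = 0 by exact/count_memPn.
split.
  split; first by case: adm.
  by case=> [|j]; [have := proj2 adm 0 | have := proj2 adm j.+1]; rewrite /rel_freq; lia.
apply/eqP; rewrite -size_eq0 -leqn0 leqNgt; apply/negP.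
case E: (marked _ _) => [//|v s] _; have : v \in marked r.+1 la by rewrite E inE eqxx.
by rewrite mem_marked // => /(marks_le f0 (adm_ok adm)); rewrite ltnn.
Qed.

(** When each pi^(l) has n_l parts, this is n_(i+1) + ... + n_(k-1) = N_(i+1). *)
Definition part_total (i : nat) (pis : seq (seq nat)) := sumn (map size (drop i pis)).

(* The sum of the parts (resp. the major index) in terms of the partitions
   pi^(i); [m] is the number of clusters (resp. of peaks) already present. *)
Definition weight (a m : nat) (pis : seq (seq nat)) :=
  \sum_(i < size pis) ((m + part_total i pis) ^ 2 +
    (a <= i.+1) * (m + part_total i pis) + sumn (nth [::] pis i)).

Lemma part_total_rcons i pis p : i <= size pis ->
  part_total i (rcons pis p) = part_total i pis + size p.
Proof. by move=> le; rewrite /part_total drop_rcons // map_rcons sumn_rcons. Qed.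

Lemma part_total_oversize i pis : size pis <= i -> part_total i pis = 0.
Proof. by move=> le; rewrite /part_total drop_oversize. Qed.

Lemma weight_rcons a m pis p :
  weight a m (rcons pis p) = weight a (m + size p) pis +
    ((m + size p) ^ 2 + (a <= (size pis).+1) * (m + size p) + sumn p).
Proof.
rewrite /weight size_rcons big_ord_recr /=; congr (_ + _).
  apply: eq_bigr => i _; rewrite part_total_rcons ?nth_rcons ?ltn_ord ?(ltnW (ltn_ord i)) //.
  by rewrite [part_total i pis + _]addnC addnA.
by rewrite nth_rcons ltnn eqxx part_total_rcons // part_total_oversize.
Qed.

Lemma sorted_rev_geq ts : sorted leq ts -> sort geq (rev ts) = rev ts.
Proof.
move=> h; apply: sorted_sort; first by move=> x y z le1 le2; exact: leq_trans le2 le1.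
by rewrite rev_sorted.
Qed.

Lemma phi_stage_ex a r m la mu : 0 < a -> admissible a r.+1 m la -> size mu = m ->
  exists ts la' la'' mu1, [/\ extracts a r.+1 m la ts la', perm_eq la'' la',
    phi_stage (size la) a r.+1 la mu [::] = Some (la'', mu ++ mu1, rev ts),
    all (fun c => size c == r.+1) mu1 & size mu1 = size ts] /\
    sort geq (rev ts) = rev ts.
Proof.
move=> a0 adm sm; have [ts [la' exs]] := extracts_ex a0 (ltn0Sn r) adm.
have [_ _ sz] := extracts_stats a0 (ltn0Sn r) exs.
have le : size ts <= size la by rewrite sz mulSn -addnA leq_addr.
rewrite -sm in exs *.
have [la'' [mu1 [E p al s1]]] := phi_stageP a0 (ltn0Sn r) [::] le exs.
exists ts, la', la'', mu1; rewrite E cats0; split=> //.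
exact/sorted_rev_geq/(extracts_sorted exs).
Qed.

Lemma phi_fromP a r m la mu : 0 < a -> admissible a r m la -> size mu = m ->
  exists mu1 pis, [/\ phi_from a r la mu = Some (mu ++ mu1, pis),
    size pis = r /\ all (sorted geq) pis,
    forall i, nb_clusters i mu1 = if 0 < i <= r then size (nth [::] pis i.-1) else 0,
    forall j, 0 < j <= r -> size (marked j la) = part_total j.-1 pis &
    sumn la + (r * m ^ 2 + (r - a.-1) * m) = weight a m pis].
Proof.
move=> a0; elim: r m la mu => [|r IH] m la mu adm sm.
  have la0 : la = [::].
    case: la adm => // x l adm; have := adm_ok adm x.
    have : 0 < freq (x :: l) x by rewrite freq_gt0 inE eqxx.
    by lia.
  exists [::], [::]; rewrite la0 /= cats0; split=> //.
  - by case.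
  - by rewrite /weight big_ord0; lia.
have [ts [la' [la'' [mu1 [[exs p E al s1] srt]]]]] := phi_stage_ex a0 adm sm.
have [S1 S2 _] := extracts_stats a0 (ltn0Sn r) exs.
have [_ adm' mE] := extracts_adm exs.
have adm2 : admissible a r (m + size ts) la''.
  by rewrite perm_sym in p; apply: admissible_perm p _; exact: admissible_pred.
have sm2 : size (mu ++ mu1) = m + size ts by rewrite size_cat sm s1.
have [mu2 [pis [E2 [sz al2] nb mk wt]]] := IH _ _ _ adm2 sm2.
have sz2 : size pis <= r by rewrite sz.
exists (mu1 ++ mu2), (rcons pis (rev ts)); split.
- by rewrite /= E E2 /= srt catA.
- rewrite size_rcons sz all_rcons al2 andbT; split=> //.
  by rewrite -srt; apply: sort_sorted => x y; exact: leq_total.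
- move=> i; rewrite /nb_clusters count_cat -/(nb_clusters i mu2) nb.
  have -> : count (fun c => size c == i) mu1 = if i == r.+1 then size ts else 0.
    case: eqP => [->|ne].
      by rewrite -s1; apply/eqP; rewrite -all_count.
    apply/eqP; rewrite -leqn0 leqNgt -has_count; apply/hasP => -[c cm /eqP E3].
    by have /eqP E4 := allP al c cm; rewrite E3 in E4.
  case: (ltngtP i r.+1) => [lt|lt|->].
  + rewrite ltnS in lt; rewrite lt !andbT add0n nth_rcons sz.
    by case: (posnP i) => // i0; rewrite ifT //; lia.
  + by rewrite !ifF //; lia.
  + by rewrite ltnn /= nth_rcons sz ltnn eqxx addn0 size_rev.
- move=> j /andP[j0 jr]; rewrite S1 ?j0 // part_total_rcons; last by lia.
  rewrite size_rev addnC; congr (_ + _); move: jr; rewrite leq_eqVlt => /orP[/eqP->|lt].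
    by rewrite mE part_total_oversize // sz.
  by rewrite -mk ?j0 // (marked_perm j p).
- rewrite weight_rcons sz size_rev -wt sumn_rev.
  rewrite (perm_sumn p) S2.
  (* The virtual entry grows with the stage exactly when a <= r+1; this is the origin of the linear
     terms N_i with i >= a. *)
  have -> : r.+1 - a.-1 = (r - a.-1) + (a <= r.+1) by case: leqP; lia.
  by move: (size ts) (r - a.-1) (nat_of_bool _) => *; nia.
Qed.

Lemma phi_from_inj a r m la1 la2 mu1 mu2 res1 res2 pis : 0 < a ->
  admissible a r m la1 -> admissible a r m la2 -> size mu1 = m -> size mu2 = m ->
  phi_from a r la1 mu1 = Some (res1, pis) -> phi_from a r la2 mu2 = Some (res2, pis) ->
  perm_eq la1 la2.
Proof.
move=> a0; elim: r m la1 la2 mu1 mu2 res1 res2 pis => [|r IH] m la1 la2 mu1 mu2 res1 res2 pis.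
  by case: la1 la2 => [|? ?] [|? ?] //=.
move=> adm1 adm2 s1 s2.
have [ts1 [l1 [l1' [nu1 [[exs1 p1 E1 al1 sz1] srt1]]]]] := phi_stage_ex a0 adm1 s1.
have [ts2 [l2 [l2' [nu2 [[exs2 p2 E2 al2 sz2] srt2]]]]] := phi_stage_ex a0 adm2 s2.
rewrite /= E1 E2 srt1 srt2.
case F1: phi_from => [[x1 q1]|] //= [_ <-]; case F2: phi_from => [[x2 q2]|] //= [_].
move/eqP; rewrite eqseq_rcons => /andP[/eqP q21 /eqP ets].
have {}ets : ts2 = ts1 by rewrite -[ts2]revK ets revK.
subst ts2 q2.
have [_ adm1' mE1] := extracts_adm exs1; have [_ adm2' mE2] := extracts_adm exs2.
have pp : perm_eq l1' l2'.
  apply: (IH (m + size ts1) _ _ _ _ _ _ _ _ _ _ _ F1 F2).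
  - by rewrite perm_sym in p1; apply: admissible_perm p1 _; exact: admissible_pred.
  - by rewrite perm_sym in p2; apply: admissible_perm p2 _; exact: admissible_pred.
  - by rewrite size_cat s1 sz1.
  - by rewrite size_cat s2 sz2.
apply: (extracts_inj exs1 exs2); rewrite perm_sym in p1.
exact: perm_trans p1 (perm_trans pp p2).
Qed.

(** The quantification over [la0] and [mu] serves the recursion: a stage leaves a list known only up
    to order, and [mu] matters only through its size. *)
Lemma phi_from_surj a r m pis : 0 < a -> size pis = r -> all (sorted geq) pis ->
  exists la, admissible a r m la /\ forall la0 mu, perm_eq la la0 -> size mu = m ->
    exists mu', phi_from a r la0 mu = Some (mu', pis).
Proof.
move=> a0; elim: r m pis => [|r IH] m pis.
  move=> /size0nil -> _; exists [::]; split; first by split=> // -[].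
  by move=> la0 mu; rewrite perm_sym => /perm_nilP -> _; exists mu.
case/lastP: pis => // pis p; rewrite size_rcons all_rcons => -[sz] /andP[srt al].
have [la' [adm' H]] := IH (m + size p) pis sz al.
have [adm1 mE] := admissible_succ adm'.
have srt' : sorted leq (rev p) by rewrite rev_sorted.
have [|la exs] := extracts_surj a0 (ltn0Sn r) _ mE srt' (m := m); first by rewrite size_rev.
have [adm _ _] := extracts_adm exs.
exists la; split=> // la0 mu pla smu.
have adm0 := admissible_perm pla adm.
have [_ _ szla] := extracts_stats a0 (ltn0Sn r) exs.
have exs0 := extracts_perm pla (perm_refl _) exs.
have le : size (rev p) <= size la0.
  by rewrite -(perm_size pla) szla mulSn -addnA leq_addr.
rewrite -smu in exs0.
have [la'' [mu1 [E pp _ s1]]] := phi_stageP a0 (ltn0Sn r) [::] le exs0.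
rewrite perm_sym in pp.
have [|mu' E2] := H la'' (mu ++ mu1) pp; first by rewrite size_cat smu s1 size_rev.
by exists mu'; rewrite /= E E2 /= cats0 sorted_rev_geq // revK.
Qed.

(** * The difference condition as a bound on neighbouring multiplicities *)

Lemma geq_trans : transitive geq.
Proof. by move=> x y z le1 le2; exact: leq_trans le2 le1. Qed.

Lemma sorted_filter_split (P : pred nat) s : sorted geq s ->
  (forall x y, P x -> x <= y -> P y) ->
  s = [seq x <- s | P x] ++ [seq x <- s | ~~ P x].
Proof.
move=> + up; elim: s => //= x s IH px.
case: (boolP (P x)) => Px /=; first by rewrite -IH // (path_sorted px).
have nP y : y \in s -> ~~ P y.
  move=> ys; apply: contra Px => Py; apply: up Py _.
  by have := order_path_min geq_trans px; move/allP/(_ _ ys).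
rewrite (_ : [seq y <- s | P y] = [::]) /=.
  by congr cons; rewrite -[LHS]filter_predT; apply: eq_in_filter => y /nP ->.
by apply/eqP; rewrite -(negbK (_ == _)) -has_filter; apply/hasP => -[y /nP /negbTE ->].
Qed.

Lemma freq_pair la v :
  freq la v + freq la v.+1 = count (fun x => (x == v) || (x == v.+1)) la.
Proof.
rewrite /freq -count_predUI [X in _ + X](_ : _ = 0) ?addn0 //.
apply/eqP; rewrite -leqn0 leqNgt -has_count; apply/hasP => -[x _ /= /andP[/eqP->]].
by rewrite (ltn_eqF (ltnSn v)).
Qed.

(** In a decreasing list the parts v and v+1 form a block [la3]. If it had k elements, its first and
    k-th would differ by at most 1. *)
Lemma gordon_sums k la : 0 < k -> sorted geq la ->
  (forall j, j + k.-1 < size la -> 2 <= nth 0 la j - nth 0 la (j + k.-1)) ->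
  pairs_le k.-1 (freq la).
Proof.
move=> k0 srt H v; rewrite leqNgt freq_pair; apply/negP => lt.
pose P x := v.+1 < x.
have E1 := @sorted_filter_split P la srt (fun x y h1 h2 => leq_trans h1 h2).
set la1 := [seq x <- la | P x] in E1; set la2 := [seq x <- la | ~~ P x] in E1.
have srt2 : sorted geq la2 by apply: sorted_filter => //; exact: geq_trans.
have E2 := @sorted_filter_split (leq v) la2 srt2 (fun x y h1 h2 => leq_trans h1 h2).
set la3 := [seq x <- la2 | v <= x] in E2; set la4 := [seq x <- la2 | ~~ (v <= x)] in E2.
have sz3 : k.-1 < size la3.
  rewrite /la3 /la2 -filter_predI size_filter (leq_trans lt) // sub_count // => x /=.
  by rewrite /P; case/orP => /eqP->; lia.
have in3 j : j < size la3 -> v <= nth 0 la3 j <= v.+1.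
  move=> lj; have := mem_nth 0 lj; rewrite /la3 /la2 !mem_filter /P => /and3P[-> + _].
  by rewrite -leqNgt.
have nth3 j : j < size la3 -> nth 0 la (size la1 + j) = nth 0 la3 j.
  by move=> lj; rewrite E1 E2 nth_cat ltnNge leq_addr /= addKn nth_cat lj.
have p3 : 0 < size la3 by exact: leq_ltn_trans sz3.
have h0 : nth 0 la (size la1) = nth 0 la3 0 by rewrite -[X in nth 0 la X]addn0 nth3.
have := H (size la1); rewrite (nth3 _ sz3) h0.
have := in3 _ sz3; have := in3 0 p3.
have : size la = size la1 + (size la3 + size la4) by rewrite {1}E1 {1}E2 !size_cat.
lia.
Qed.

(** If the parts at positions j and j+k-1 differ by at most 1, all k parts in between lie in {v,
    v+1}, where v is the last of them. *)
Lemma sums_gordon k la : 0 < k -> sorted geq la -> pairs_le k.-1 (freq la) ->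
  forall j, j + k.-1 < size la -> 2 <= nth 0 la j - nth 0 la (j + k.-1).
Proof.
move=> k0 srt H j lt; rewrite leqNgt; apply/negP => lt2.
have := H (nth 0 la (j + k.-1)); set v := nth 0 la (j + k.-1) in lt2 *.
rewrite freq_pair; apply/negP; rewrite -ltnNge prednK //.
rewrite -(cat_take_drop j la) count_cat -(cat_take_drop k (drop j la)) count_cat.
have sz : size (take k (drop j la)) = k by rewrite size_take_min size_drop; lia.
suff : count (fun x => (x == v) || (x == v.+1)) (take k (drop j la)) = k by lia.
rewrite -[RHS]sz; apply/eqP; rewrite -all_count; apply/(all_nthP 0) => i.
rewrite sz => ik; rewrite nth_take // nth_drop.
have mono p q : p <= q -> q < size la -> nth 0 la q <= nth 0 la p.
  move=> pq qs; have := sorted_leq_nth geq_trans leqnn 0 srt; apply=> //.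
  exact: leq_ltn_trans pq qs.
have h1 : v <= nth 0 la (j + i) by apply: mono; lia.
have h2 : nth 0 la (j + i) <= nth 0 la j by apply: mono; lia.
lia.
Qed.

(** For m = 0 and r = k-1 the bound at index 0 reads (k-1) - (a-1) + F 1 <= k-1, that is F 1 <= a-1,
    because a <= k. *)
Lemma gordon_admissible k a n la : 0 < a -> a <= k ->
  gordon_partition k a n la <->
  [/\ sorted geq la, admissible a k.-1 0 la & sumn la = n].
Proof.
move=> a0 ak; have k0 : 0 < k by lia.
have relE : rel_freq a k.-1 0 la =1 fun j => if j is 0 then k.-1 - a.-1 else freq la j by case.
split.
- case=> /and3P[srt z /eqP sn] H c1; split=> //; split.
    by move=> v vla; rewrite muln0 lt0n; exact: (memPn z).
  have okf := gordon_sums k0 srt H.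
  by move=> j; rewrite !relE; case: j => [|j]; [rewrite /freq; lia | exact: okf].
- case=> srt adm sn; split; last by have := proj2 adm 0; rewrite !relE /freq; lia.
    by rewrite /is_partition srt (adm0 adm) sn eqxx.
  by apply: sums_gordon => //; exact: adm_ok adm.
Qed.

(** * Deleting the peaks of a path *)

Definition hstep (c : nat) (x : step) : nat :=
  match x with NE => c.+1 | SE => c.-1 | EE => c end.

Definition step_allowed (c : nat) (x : step) : bool :=
  match x with NE => true | SE => 0 < c | EE => c == 0 end.

Fixpoint flat (c : nat) (w : seq step) : bool :=
  if w is x :: w' then step_allowed c x && flat (hstep c x) w' else true.

Definition final (c : nat) (w : seq step) : nat := foldl hstep c w.

Definition valid (c : nat) (w : seq step) : bool := flat c w && (final c w == 0).

Fixpoint below (K c : nat) (w : seq step) : bool :=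
  (c <= K) && (if w is x :: w' then below K (hstep c x) w' else true).

Definition starts_SE (w : seq step) : bool := if w is SE :: _ then true else false.

Definition no_peak (x : step) (w : seq step) : bool := ~~ (is_NE x && starts_SE w).

(** A single pass: peaks that appear when the deletion makes two steps adjacent are kept, to be
    removed by the next iteration. *)
Fixpoint del_peaks (w : seq step) : seq step :=
  match w with
  | NE :: (SE :: w') => del_peaks w'
  | x :: w' => x :: del_peaks w'
  | [::] => [::]
  end.

Fixpoint npeaks (w : seq step) : nat :=
  match w with
  | NE :: (SE :: w') => (npeaks w').+1
  | x :: w' => npeaks w'
  | [::] => 0
  end.

(** Follows the recursion of [del_peaks] and its companions, which consume a peak as two steps at
    once and any other step singly. *)
Lemma word_ind (P : seq step -> Prop) : P [::] ->
  (forall w, P w -> P (NE :: SE :: w)) ->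
  (forall x w, no_peak x w -> P w -> P (x :: w)) -> forall w, P w.
Proof.
move=> P0 P2 P1 w; move E: (size w) => n.
elim/ltn_ind: n w E => n IH [|x w] //= E.
case: (boolP (no_peak x w)) => H; first by apply: P1 => //; apply: IH (size w) _ _ _; lia.
case: x w H E => // -[|[] w] //= _ E.
by apply: P2; apply: IH (size w) _ _ _; lia.
Qed.

Lemma del_peaks_cons x w : no_peak x w -> del_peaks (x :: w) = x :: del_peaks w.
Proof. by case: x w => // -[|[] w]. Qed.

Lemma npeaks_cons x w : no_peak x w -> npeaks (x :: w) = npeaks w.
Proof. by case: x w => // -[|[] w]. Qed.

Lemma flat_cat c u w : flat c (u ++ w) = flat c u && flat (final c u) w.
Proof. by elim: u c => //= x u IH c; rewrite IH andbA. Qed.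

Lemma final_cat c u w : final c (u ++ w) = final (final c u) w.
Proof. exact: foldl_cat. Qed.

Lemma flat_del_peaks c w : flat c (del_peaks w) = flat c w.
Proof. by elim/word_ind: w c => // x w np IH c; rewrite del_peaks_cons //= IH. Qed.

Lemma final_del_peaks c w : final c (del_peaks w) = final c w.
Proof. by elim/word_ind: w c => // x w np IH c; rewrite del_peaks_cons //= IH. Qed.

Lemma valid_del_peaks c w : valid c (del_peaks w) = valid c w.
Proof. by rewrite /valid flat_del_peaks final_del_peaks. Qed.

Lemma below_le K c w : below K c w -> c <= K.
Proof. by case: w => [|x w] /andP[]. Qed.

(** A North-East step to height K+1 that is not part of a peak is followed by another one, since
    East is forbidden there and the path must come back to 0. So it leads the original path to
    K+2. *)
Lemma below_del_peaks K c w : valid c w -> c <= K -> below K.+1 c w = below K c (del_peaks w).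
Proof.
elim/word_ind: w c => [|w IH|x w np IH] c.
- by move=> _ le; rewrite /= le leqW.
- rewrite /valid /= => v le; rewrite ltnS le leqW //=.
  exact: IH.
rewrite del_peaks_cons // /= /valid /= => /andP[/andP[ox fx] fin] le.
rewrite le (leqW le) /=; case: (leqP (hstep c x) K) => H.
  by apply: IH => //; rewrite /valid fx fin.
case: x np IH ox fx fin H => //=; [|lia|lia].
move=> np IH _ fx fin H; have -> : c = K by lia.
rewrite (_ : below K K.+1 (del_peaks w) = false); last by apply/negP => /below_le; rewrite ltnn.
case: w np IH fx fin => [|[] w] //= _ _ _ _.
by apply/negP => /andP[_ /below_le]; rewrite ltnn.
Qed.

(* Some vertex of [w] has height less than [lo], and the height does not exceed
   [hi] before. *)
Fixpoint scan (lo hi c : nat) (w : seq step) : bool :=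
  (c <= hi) && ((c < lo) || (if w is x :: w' then scan lo hi (hstep c x) w' else false)).

Lemma scan0 hi c w : scan 0 hi c w = false.
Proof. by elim: w c => [|x w IH] c /=; rewrite ?IH andbF. Qed.

Lemma scan_hi lo hi c w : hi < c -> scan lo hi c w = false.
Proof. by case: w => [|x w] H /=; rewrite leqNgt H. Qed.

(** The same argument as for heights: leaving the band by a step outside all peaks means rising once
    more in the original path, unless that path ends there, and then [lo] is not reached either. *)
Lemma scan_del_peaks lo hi c w : flat c w -> c <= hi -> lo <= hi.+1 ->
  scan lo hi.+1 c w = scan lo hi c (del_peaks w).
Proof.
elim/word_ind: w c => [|w IH|x w np IH] c.
- by move=> _ le lh /=; rewrite le leqW.
- move=> /= fl le lh; rewrite leqW // ltnS le /=.
  case: (ltnP c lo) => lo1 /=.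
    by case: (del_peaks w) => [|y u] /=; rewrite lo1 le.
  rewrite (ltnNge c.+1) (leqW lo1) /=; exact: IH.
rewrite del_peaks_cons // => /= /andP[ox fx] le lh; rewrite le leqW //=; congr (_ || _).
case: (leqP (hstep c x) hi) => H; first exact: IH.
rewrite [RHS]scan_hi //; case: x np IH ox fx H => //=; [|lia|lia].
move=> np _ _ fx H; have -> : c = hi by lia.
case: w np fx => [|[] w] //= _; rewrite leqnn [hi.+1 < lo]ltnNge lh //=.
by rewrite scan_hi.
Qed.

Definition swap (x : step) : step := match x with NE => SE | SE => NE | EE => EE end.

(* [U] is the part of the path before the peak, read backwards from the foot
   (at height [c]) of the peak, with North-East and South-East exchanged. *)
Definition rises (h c : nat) (U w : seq step) : bool :=
  scan (c.+2 - h) c.+1 c w && scan (c.+2 - h) c c U.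

Fixpoint count_rises (h c : nat) (U w : seq step) : nat :=
  if w is x :: w' then
    (is_NE x && starts_SE w' && rises h c U (behead w')) +
    count_rises h (hstep c x) (swap x :: U) w'
  else 0.

(** The left bound c forces the path, read backwards, to descend at once from the foot. The right
    bound c+1 tolerates further peaks of the same height, and these are removed by the deletion.
    What is left is the same question at a foot one lower. *)
Lemma rises_del_peaks h c U w : 0 < h -> flat c U -> flat c w ->
  rises h.+1 c U w = [&& starts_SE U, starts_SE (del_peaks w) &
                         rises h c.-1 (del_peaks (behead U)) (behead (del_peaks w))].
Proof.
move=> h0 fU fw; rewrite /rises; have -> : c.+2 - h.+1 = c.+1 - h by lia.
set lo := c.+1 - h; have lole : lo <= c by rewrite /lo; lia.
have clo : (c < lo) = false by lia.
rewrite scan_del_peaks //; last by lia.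
have -> : scan lo c c U = starts_SE U && scan lo c.-1 c.-1 (del_peaks (behead U)).
  case: U fU => [|x U] /=; rewrite leqnn clo //= => /andP[ox fU].
  case: x ox fU => //= ox fU.
  - by rewrite scan_hi.
  - by rewrite -{1}(prednK ox) scan_del_peaks // prednK.
  - by rewrite /lo (eqP ox) (_ : 1 - h = 0) ?scan0 //; lia.
have -> : scan lo c c (del_peaks w) = starts_SE (del_peaks w) && scan lo c c.-1 (behead (del_peaks w)).
  move: fw; rewrite -flat_del_peaks; case: (del_peaks w) => [|x t] /=; rewrite leqnn clo //= => /andP[ox ft].
  case: x ox ft => //= ox ft.
  - by rewrite scan_hi.
  - by rewrite /lo (eqP ox) (_ : 1 - h = 0) ?scan0 //; lia.
case: U fU => [|[] U] //=; rewrite ?andbF // => /andP[c0 _].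
by rewrite prednK // -/lo -!andbA.
Qed.

Lemma hstep_swap c x : step_allowed c x -> hstep (hstep c x) (swap x) = c.
Proof. by case: x => //= c0; rewrite prednK. Qed.

Lemma step_allowed_swap c x : step_allowed c x -> step_allowed (hstep c x) (swap x).
Proof. by case: x. Qed.

(** The extra term accounts for a peak that the deletion creates astride the cut between [U] and
    [w]; the last hypothesis says that the cut does not split a peak of the original path. Among
    adjacent peaks at one vertex only the leftmost can contribute. *)
Lemma count_rises_del_peaks h c U w : 0 < h -> flat c U -> flat c w ->
  ~~ (starts_SE U && starts_SE w) ->
  count_rises h.+1 c U w = count_rises h c (del_peaks U) (del_peaks w) +
    [&& starts_SE U, starts_SE (del_peaks w) &
        rises h c.-1 (del_peaks (behead U)) (behead (del_peaks w))].
Proof.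
move=> h0; elim/word_ind: w c U => [|w IH|x w np IH] c U fU fw nb.
- by rewrite /= andbF.
- rewrite /= IH //=.
  by rewrite addn0 addnC rises_del_peaks // drop0.
case/andP: (fw) => ox fx.
rewrite [LHS]/= (negbTE (_ : ~~ (is_NE x && starts_SE w))) // add0n.
rewrite IH //; last 2 first.
- by rewrite /= step_allowed_swap // hstep_swap.
- by case: (x) np => //.
have -> : del_peaks (swap x :: U) = swap x :: del_peaks U.
  by apply: del_peaks_cons; rewrite /no_peak; case: (x) nb => //=; rewrite andbT.
have -> : [&& starts_SE U, starts_SE (del_peaks (x :: w)) &
        rises h c.-1 (del_peaks (behead U)) (behead (del_peaks (x :: w)))] = false.
  by rewrite del_peaks_cons //; case: (x) nb => //=; rewrite ?andbF // andbT => /negbTE ->.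
rewrite del_peaks_cons // addn0 /= addnC; congr (nat_of_bool _ + _).
by case: (x).
Qed.

Lemma rises1 c U w : rises 1 c U w.
Proof. by rewrite /rises subn1 /=; case: w => [|? ?]; case: U => [|? ?] /=; rewrite ltnSn leqnn leqW. Qed.

Lemma count_rises1 c U w : count_rises 1 c U w = npeaks w.
Proof.
elim/word_ind: w c U => //= [w IH|x w np IH] c U; first by rewrite rises1 IH.
by rewrite rises1 andbT (negbTE np) IH -[RHS]/(npeaks (x :: w)) npeaks_cons.
Qed.

Lemma count_risesE h c w : flat c w -> count_rises h.+1 c [::] w = npeaks (iter h del_peaks w).
Proof.
elim: h w => [|h IH] w fw; first exact: count_rises1.
by rewrite count_rises_del_peaks // addn0 IH ?flat_del_peaks // iterSr.
Qed.

(** * Relative heights *)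

Lemma final_count c w : flat c w ->
  c + count is_NE w = final c w + count is_SE w.
Proof.
elim: w c => //= x w IH c /andP[ox /IH]; rewrite -/(final _ w).
by case: x ox => /=; lia.
Qed.

Lemma flat_take c w x : flat c w -> flat c (take x w).
Proof. by rewrite -{1}(cat_take_drop x w) flat_cat => /andP[]. Qed.

Lemma heightE s w x : flat s w -> height (LPath s w) x = final s (take x w).
Proof.
by move=> /(flat_take x)/final_count; rewrite /height /=; move: (take x w) => u; lia.
Qed.

Lemma final_takeS s w z : z < size w ->
  final s (take z.+1 w) = hstep (final s (take z w)) (nth EE w z).
Proof. by move=> lt; rewrite (take_nth EE) // -cats1 final_cat. Qed.

Lemma flat_nth s w z : flat s w -> z < size w -> step_allowed (final s (take z w)) (nth EE w z).
Proof.
by move=> fw lt; have := flat_take z.+1 fw; rewrite (take_nth EE) // -cats1 flat_cat => /and3P[].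
Qed.

Lemma is_lattice_pathP s w : is_lattice_path (LPath s w) <->
  valid s w /\ (w = [::] \/ last EE w = SE).
Proof.
have flatP : flat s w -> forall x, x < size w ->
    match nth EE w x with NE => True | SE => 0 < height (LPath s w) x
    | EE => height (LPath s w) x = 0 end.
  move=> fw x lt; have := flat_nth fw lt; rewrite heightE //.
  by case: (nth EE w x) => //= /eqP.
split.
- case=> /= H hf lw; suff fw : flat s w.
    by split=> //; rewrite /valid fw -hf heightE // take_size eqxx.
  suff fx x : x <= size w -> flat s (take x w) by rewrite -(take_size w) fx.
  elim: x => [|x IH] lt; first by rewrite take0.
  rewrite (take_nth EE) // -cats1 flat_cat IH /= ?andbT ?(ltnW lt) //.
  have := H x lt; have := final_count (IH (ltnW lt)).
  rewrite /height /=; move: (final _ _) => y E.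
  have -> : s + count is_NE (take x w) - count is_SE (take x w) = y by lia.
  by case: (nth EE w x) => //= ->.
- case=> /andP[fw /eqP hf] lw; split=> //; first exact: flatP.
  by rewrite /= heightE // take_size.
Qed.

Lemma belowP K s w : below K s w <-> forall x, x <= size w -> final s (take x w) <= K.
Proof.
elim: w s => [|y w IH] s /=.
  by rewrite andbT; split=> [le [|x]|/(_ 0 isT)].
split=> [/andP[le /IH H] [|x] //|H]; first exact: H.
by rewrite (H 0 isT); apply/IH => x lx; exact: (H x.+1).
Qed.

Fixpoint peak_list (p : nat) (w : seq step) : seq nat :=
  match w with
  | NE :: (SE :: w') => p.+1 :: peak_list p.+2 w'
  | x :: w' => peak_list p.+1 w'
  | [::] => [::]
  end.

Lemma peak_list_cons p x w : no_peak x w -> peak_list p (x :: w) = peak_list p.+1 w.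
Proof. by case: x w => // -[|[] w]. Qed.

Lemma peaksE s w : peaks (LPath s w) = peak_list 0 w.
Proof.
rewrite /peaks /= /is_peak /=.
suff H u w2 : [seq x <- iota (size u).+1 (size w2) | is_peak (LPath s (u ++ w2)) x] =
    peak_list (size u) w2 by exact: (H [::] w).
elim/word_ind: w2 u => // [w2 IH|x w2 np IH] u.
- rewrite /= {1}/is_peak /= drop_size_cat // {1}/is_peak /=.
  rewrite -cat_rcons drop_size_cat ?size_rcons //.
  by have := IH (rcons (rcons u NE) SE); rewrite !size_rcons !cat_rcons => ->.
- rewrite peak_list_cons // /= {1}/is_peak /= drop_size_cat //.
  have -> : (if x :: w2 is NE :: SE :: _ then true else false) = false.
    by case: x np {IH} => //; case: w2 => // -[].
  by have := IH (rcons u x); rewrite size_rcons cat_rcons.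
Qed.

Lemma peak_list_nth w p : p.+1 < size w -> nth EE w p = NE -> nth EE w p.+1 = SE ->
  p.+1 \in peak_list 0 w.
Proof.
move=> lt e1 e2; rewrite -(peaksE 0) mem_filter mem_iota /is_peak /=.
rewrite (drop_nth EE) ?(ltnW lt) // (drop_nth EE) // e1 e2 /=; lia.
Qed.

Section PeakBetween.
Variables (s : nat) (w : seq step).
Hypothesis fw : flat s w.
Local Notation H z := (final s (take z w)).

Lemma climb_before x1 z : x1 < z -> z <= size w -> H x1 < H z ->
  exists z0, [/\ x1 <= z0, z0 < z, nth EE w z0 = NE & H z <= H z0.+1].
Proof.
elim: z => // z IH lt sz Hlt; have := flat_nth fw sz.
case E: (nth EE w z) => /= sx.
- by exists z.
- have Ez : H z.+1 = (H z).-1 by rewrite final_takeS // E.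
  have ne : x1 <> z by move=> E1; rewrite E1 Ez in Hlt; lia.
  have [|||z0 [h1 h2 h3 h4]] := IH; [lia|exact: ltnW|lia|].
  by exists z0; split=> //; lia.
- have Ez : H z.+1 = H z by rewrite final_takeS // E.
  by move: Hlt; rewrite Ez (eqP sx).
Qed.

Lemma peak_after z0 x2 M : z0 < x2 -> x2 <= size w -> nth EE w z0 = NE ->
  M <= H z0.+1 -> H x2 < M ->
  exists p, [/\ z0 < p, p < x2, M <= H p & p \in peak_list 0 w].
Proof.
move E: (x2 - z0) => n; elim: n z0 E => [|n IH] z0 E lt sz ne hM hx; first lia.
have lt2 : z0.+1 < x2.
  by rewrite ltn_neqAle lt andbT; apply/negP => /eqP E2; rewrite E2 in hM; lia.
have ls : z0.+1 < size w by exact: leq_trans lt2 sz.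
have := flat_nth fw ls; have E1 : H z0.+1 = (H z0).+1 by rewrite final_takeS ?ne // ltnW.
case E2: (nth EE w z0.+1) => /= sx.
- have E3 : H z0.+2 = (H z0.+1).+1 by rewrite final_takeS // E2.
  have [||p [h1 h2 h3 h4]] := IH z0.+1 _ lt2 sz E2 _ hx; [lia|lia|].
  by exists p; split=> //; exact: ltnW.
- by exists z0.+1; split=> //; exact: peak_list_nth.
- by rewrite E1 in sx.
Qed.

(** Relative height constrains only the peaks between two vertices; this turns the constraint into
    one on all vertices there. *)
Lemma peak_between x1 z x2 : x1 < z < x2 -> x2 <= size w -> H x1 < H z -> H x2 < H z ->
  exists p, [/\ x1 < p, p < x2, H z <= H p & p \in peak_list 0 w].
Proof.
move=> /andP[l1 l2] sz h1 h2.
have [|z0 [a1 a2 a3 a4]] := climb_before l1 _ h1; first exact: leq_trans (ltnW l2) sz.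
have [|p [b1 b2 b3 b4]] := peak_after _ sz a3 a4 h2; first exact: ltn_trans l2.
by exists p; split=> //; exact: leq_ltn_trans b1.
Qed.

End PeakBetween.

Lemma scan_ex lo hi c t : scan lo hi c t -> lo <= c.+1 ->
  exists q, [/\ q <= size t, (final c (take q t)).+1 = lo &
                forall z, z <= q -> final c (take z t) <= hi].
Proof.
elim: t c => [|x t IH] c /= /andP[le H] lo1.
  by exists 0; split=> //; move: H; rewrite orbF /=; lia.
case: (ltnP c lo) H => [lt _|ge /= sc].
  by exists 0; split=> //=; [lia | case].
have [|q [h1 h2 h3]] := IH _ sc; first by case: (x) => /=; lia.
by exists q.+1; split=> // -[|z] //; exact: h3.
Qed.

Lemma scan_intro lo hi c t q : q <= size t -> final c (take q t) < lo ->
  (forall z, z <= q -> final c (take z t) <= hi) -> scan lo hi c t.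
Proof.
elim: t c q => [|x t IH] c [|q] //= lq lt H; rewrite (H 0 isT) /=.
- by rewrite lt.
- by rewrite lt.
- by rewrite (IH _ q) ?orbT // => z; exact: (H z.+1).
Qed.

Lemma final_rev s u q : flat s u -> q <= size u ->
  final (final s u) (take q (map swap (rev u))) = final s (take (size u - q) u).
Proof.
elim/last_ind: u q => [|u x IH] q //.
rewrite -cats1 flat_cat final_cat /= andbT => /andP[fu ox].
rewrite cats1 rev_rcons size_rcons; case: q => [_|q] /=.
  by rewrite subn0 -(size_rcons u x) take_size -cats1 final_cat.
rewrite ltnS => le; rewrite subSS hstep_swap // -/(final _ _) IH //.
by rewrite -cats1 takel_cat // leq_subr.
Qed.

Lemma bigmax_ge (i : nat) (P : pred nat) s : 0 < i ->
  (i <= \max_(h <- s | P h) h) = has (fun h => P h && (i <= h)) s.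
Proof.
move=> i0; elim: s => [|h s IH]; first by rewrite big_nil leqNgt i0.
by rewrite big_cons /= -IH; case: (P h) => //=; rewrite leq_max.
Qed.

(** A witness for any h >= i descends at least to the level of i. Conversely, the first vertices
    found by the two scans lie exactly at that level, so they are witnesses for h = i. *)
Lemma rel_heightE s u t i (w := u ++ [:: NE, SE & t]) : valid s w -> 0 < i ->
  (i <= rel_height (LPath s w) (size u).+1) =
  rises i (final s u) (map swap (rev u)) t.
Proof.
move=> /andP[fw _] i0; set c := final s u; set L := LPath s w; set x := (size u).+1.
have fu : flat s u by move: fw; rewrite flat_cat => /andP[].
have hE z : height L z = final s (take z w) by rewrite heightE.
have hu z : z <= size u -> height L z = final s (take z u) by move=> le; rewrite hE takel_cat.
have hx : height L x = c.+1.
  by rewrite hE /x /w -cat_rcons -(size_rcons u NE) take_size_cat // -cats1 final_cat.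
have ht z : height L (z + x.+1) = final c (take z t).
  have -> : height L (z + x.+1) = final s (take (size (u ++ [:: NE; SE]) + z) ((u ++ [:: NE; SE]) ++ t)).
    by rewrite hE -catA /w size_cat /= /x; congr (final s (take _ _)); lia.
  by rewrite takeD take_size_cat // drop_size_cat // final_cat final_cat.
have sw : size w = x.+1 + size t by rewrite /w size_cat /= /x; lia.
rewrite /rel_height bigmax_ge // hx; apply/hasP/andP.
- case=> h; rewrite mem_iota /= add0n ltnS => hc /andP[+ ih]; rewrite /rises_by hx => /hasP[x1].
  rewrite mem_iota /= add0n => l1 /hasP[x2]; rewrite mem_iota => l2 /and3P[/eqP e1 /eqP e2 /allP al].
  have l2' : x < x2 <= size w by lia.
  have {}al z : z \in peaks L -> x1 < z < x2 ->
      (height L z < c.+1) || (height L z == c.+1) && (x <= z).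
    by move=> zp; exact/implyP/(al z zp).
  rewrite peaksE in al; split.
  + apply: (@scan_intro _ _ _ _ (x2 - x.+1)); first lia.
      by rewrite -ht subnK; lia.
    move=> z lz; rewrite -ht leqNgt; apply/negP => gt.
    have [||||p] := @peak_between s w fw x (z + x.+1) x2.
    * apply/andP; split; first lia.
      rewrite ltn_neqAle; apply/andP; split; last lia.
      by apply/negP => /eqP E; rewrite E e2 in gt; lia.
    * by case/andP: l2'.
    * by rewrite -!hE hx.
    * by rewrite -!hE e2; lia.
    case=> p1 p2 p3 p4; have := al p p4; rewrite -!hE in p3; lia.
  + apply: (@scan_intro _ _ _ _ (size u - x1)); rewrite ?size_map ?size_rev; first lia.
      by rewrite final_rev ?subKn ?leq_subr // -?hu; lia.
    move=> z lz; rewrite final_rev //; last lia.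
    rewrite -hu ?leq_subr // leqNgt; apply/negP => gt.
    have hc2 : height L (size u) = c by rewrite hu // take_size.
    have [||||p] := @peak_between s w fw x1 (size u - z) (size u).
    * apply/andP; split.
        rewrite ltn_neqAle; apply/andP; split; last lia.
        by apply/negP => /eqP E; rewrite -E e1 in gt; lia.
      rewrite ltn_neqAle leq_subr andbT; apply/negP => /eqP E.
      by rewrite E hc2 ltnn in gt.
    * by rewrite sw /x; lia.
    * by rewrite -!hE e1; lia.
    * by rewrite -!hE hc2.
    case=> p1 p2 p3 p4; have := al p p4; rewrite -!hE in p3; lia.
- case=> sR sL.
  (* For larger i the threshold [c.+2 - i] truncates to 0, and no vertex is below it. *)
  have ic : i <= c.+1.
    rewrite leqNgt; apply/negP => lt; move: sR.
    by rewrite (_ : c.+2 - i = 0) ?scan0 //; lia.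
  have [|q [q1 q2 q3]] := scan_ex sR; first lia.
  have [|q' [q1' q2' q3']] := scan_ex sL; first lia.
  rewrite size_map size_rev in q1'.
  rewrite final_rev // -hu ?leq_subr // in q2'; rewrite -ht in q2.
  exists i; first by rewrite mem_iota; lia.
  rewrite leqnn andbT /rises_by hx; apply/hasP; exists (size u - q').
    by rewrite mem_iota /x; lia.
  apply/hasP; exists (q + x.+1); first by rewrite mem_iota sw; lia.
  apply/and3P; split; [apply/eqP; lia|apply/eqP; lia|].
  apply/allP => z _; apply/implyP => /andP[z1 z2].
  case: (ltngtP z x) => [lt|gt|->].
  + apply/orP; left; rewrite ltnS.
    have zu : z <= size u by rewrite /x in lt; lia.
    have h : size u - z <= q' by lia.
    by have := q3' _ h; rewrite final_rev ?leq_subr // subKn // -hu.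
  + rewrite andbT orbC -leq_eqVlt.
    have := q3 (z - x.+1); rewrite -ht subnK //; apply; lia.
  + by rewrite hx eqxx orbT.
Qed.

Lemma rel_height_gt0 s u t (w := u ++ [:: NE, SE & t]) : valid s w ->
  0 < rel_height (LPath s w) (size u).+1.
Proof. by move=> v; rewrite rel_heightE // rises1. Qed.

Lemma count_rel_height s w i : valid s w -> 0 < i ->
  count (fun x => i <= rel_height (LPath s w) x) (peaks (LPath s w)) =
  count_rises i s [::] w.
Proof.
move=> v i0; rewrite peaksE.
suff H u w2 : w = u ++ w2 ->
    count (fun x => i <= rel_height (LPath s w) x) (peak_list (size u) w2) =
    count_rises i (final s u) (map swap (rev u)) w2 by exact: (H [::] w).
elim/word_ind: w2 u => // [w2 IH|x w2 np IH] u E.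
- have := IH (rcons (rcons u NE) SE).
  rewrite !cat_rcons !size_rcons !rev_rcons /= -!cats1 !final_cat /= => -> //.
  by rewrite -rel_heightE // -?E.
- rewrite peak_list_cons // [RHS]/= andbA (negbTE np) add0n.
  have := IH (rcons u x); rewrite cat_rcons size_rcons rev_rcons /= => -> //.
  by rewrite -cats1 final_cat.
Qed.

Lemma count_rel_heightE s w h : valid s w ->
  count (fun x => h.+1 <= rel_height (LPath s w) x) (peaks (LPath s w)) =
  npeaks (iter h del_peaks w).
Proof. by move=> v; rewrite count_rel_height // count_risesE //; case/andP: v. Qed.

(** * Inserting and moving peaks *)

Definition hats (n : nat) : seq step := flatten (nseq n [:: NE; SE]).

Lemma hatsS n : hats n.+1 = NE :: SE :: hats n. Proof. by []. Qed.

Lemma hatsD m n : hats (m + n) = hats m ++ hats n.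
Proof. by elim: m => //= m IH; rewrite addSn !hatsS IH. Qed.

Lemma hatsSr n : hats n.+1 = hats n ++ [:: NE; SE].
Proof. by rewrite -addn1 hatsD. Qed.

Lemma size_hats n : size (hats n) = n.*2.
Proof. by elim: n => //= n IH; rewrite IH. Qed.

(* [c q] peaks of relative height one are inserted at abscissa [q] of [v], on
   top of the volcanic uplift of [v]; [pn] tells whether [v] is preceded by a
   North-East step. *)
Fixpoint weave (c : nat -> nat) (pn : bool) (v : seq step) : seq step :=
  hats (c 0 + (pn && starts_SE v)) ++
  (if v is x :: v' then x :: weave (fun q => c q.+1) (is_NE x) v' else [::]).

Definition weave_tail (c : nat -> nat) (v : seq step) : seq step :=
  if v is x :: v' then x :: weave (fun q => c q.+1) (is_NE x) v' else [::].

Lemma weaveE c pn v : weave c pn v = hats (c 0 + (pn && starts_SE v)) ++ weave_tail c v.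
Proof. by case: v. Qed.

Lemma eq_weave c c' pn v : (forall q, q <= size v -> c q = c' q) ->
  weave c pn v = weave c' pn v.
Proof.
elim: v c c' pn => [|x v IH] c c' pn E /=; rewrite E // (IH _ (fun q => c' q.+1)) //.
by move=> q le; apply: E.
Qed.

Lemma del_peaks_hats n w : del_peaks (hats n ++ w) = del_peaks w.
Proof. by elim: n. Qed.

Lemma npeaks_hats n w : npeaks (hats n ++ w) = n + npeaks w.
Proof. by elim: n => //= n ->. Qed.

Lemma starts_SE_hats n w : starts_SE (hats n ++ w) -> n = 0.
Proof. by case: n. Qed.

(** Wherever a North-East step of [v] meets a South-East step, [weave] inserts at least one peak
    between them. *)
Lemma no_peak_weave c x v : no_peak x (weave c (is_NE x) v).
Proof.
case: x => //; rewrite weaveE /no_peak /=; apply/negP => H.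
have E := starts_SE_hats H; move: H; rewrite E /=.
by case: v E => [|[] v] //=; rewrite ?addn1.
Qed.

Lemma del_peaks_weave c pn v : del_peaks (weave c pn v) = v.
Proof.
elim: v c pn => [|x v IH] c pn; rewrite weaveE del_peaks_hats //.
by rewrite [weave_tail _ _]/= del_peaks_cons ?no_peak_weave // IH.
Qed.

Lemma npeaks_step x v : npeaks (x :: v) = (is_NE x && starts_SE v) + npeaks v.
Proof. by case: x v => // -[|[] v]. Qed.

Lemma npeaks_weave c pn v : npeaks (weave c pn v) =
  \sum_(q < (size v).+1) c q + (pn && starts_SE v) + npeaks v.
Proof.
elim: v c pn => [|x v IH] c pn; rewrite weaveE npeaks_hats.
  by rewrite big_ord_recl big_ord0 /= !addn0.
rewrite [weave_tail _ _]/= npeaks_cons ?no_peak_weave // IH [in RHS]big_ord_recl npeaks_step.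
rewrite -[\sum_(i < size (x :: v)) _]/(\sum_(q < (size v).+1) c q.+1) /=; lia.
Qed.

Lemma uplift_weave v : uplift_steps v = weave (fun=> 0) false v.
Proof.
elim/word_ind: v => [|v IH|x v np IH] //=; first by rewrite IH.
case: x np => //= np; rewrite ?IH //.
by case: v np IH => [|[] v] //= _ ->.
Qed.

(** Each peak is counted with the number of steps outside peaks before it, that is, with its
    abscissa in [del_peaks w], shifted by [p]. *)
Fixpoint slots (p : nat) (w : seq step) : nat :=
  match w with
  | NE :: (SE :: w') => p + slots p w'
  | x :: w' => slots p.+1 w'
  | [::] => 0
  end.

Lemma slots_cons p x w : no_peak x w -> slots p (x :: w) = slots p.+1 w.
Proof. by case: x w => // -[|[] w]. Qed.

Lemma slots_hats p n w : slots p (hats n ++ w) = n * p + slots p w.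
Proof. by elim: n => //= n ->; rewrite mulSn addnA. Qed.

Lemma sumn_peak_listS p w : sumn (peak_list p.+1 w) = sumn (peak_list p w) + npeaks w.
Proof.
elim/word_ind: w p => // [w IH|x w np IH] p; first by rewrite /= IH; lia.
by rewrite !peak_list_cons // npeaks_cons.
Qed.

(** The peak of rank i from the left, starting at 0, stands 2i+1 to the right of its slot, and the
    first odd numbers sum to a square. *)
Lemma sumn_peak_list p w : sumn (peak_list p w) = slots p w + npeaks w ^ 2.
Proof.
elim/word_ind: w p => // [w IH|x w np IH] p.
  by rewrite /= !sumn_peak_listS IH; nia.
by rewrite peak_list_cons // npeaks_cons // slots_cons.
Qed.

Lemma sumn_peak_list_consE p x v : sumn (peak_list p (x :: v)) =
  (is_NE x && starts_SE v) * p.+1 + sumn (peak_list p.+1 v).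
Proof. by case: x v => // -[|[] v] //=; rewrite mul1n. Qed.

(** The compulsory peaks sit at the abscissas of the peaks of [v], so they contribute its major
    index; this gives the recursion for the major index. *)
Lemma slots_weave p c pn v : slots p (weave c pn v) =
  \sum_(q < (size v).+1) (p + q) * c q + (pn && starts_SE v) * p + sumn (peak_list p v).
Proof.
elim: v p c pn => [|x v IH] p c pn; rewrite weaveE slots_hats.
  by rewrite big_ord_recl big_ord0 /=; lia.
rewrite [weave_tail _ _]/= slots_cons ?no_peak_weave // IH [in RHS]big_ord_recl sumn_peak_list_consE.
rewrite -[\sum_(i < size (x :: v)) _]/(\sum_(q < (size v).+1) (p + q.+1) * c q.+1).
rewrite (eq_bigr (fun q : 'I_(size v).+1 => (p + q.+1) * c q.+1)); first by rewrite /= addn0; lia.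
by move=> q _; rewrite addSnnS.
Qed.

(** What [t] moves make of a peak followed by [B]. If the swap brings the peak next to another one,
    it stays there and the motion passes to that other peak, so the recursion continues behind
    both. *)
Fixpoint hop (t : nat) (B : seq step) : seq step :=
  if t is t'.+1 then
    match B with
    | [::] => EE :: hop t' [::]
    | y :: NE :: (SE :: B') => [:: y, NE, SE & hop t' B']
    | y :: B' => y :: hop t' B'
    end
  else [:: NE, SE & B].

Lemma move_right_cat s A B y :
  move_right ((size A).+1, LPath s (A ++ [:: NE, SE, y & B])) =
  (if drop 0 B is [:: NE, SE & _] then (size A).+4 else (size A).+2,
   LPath s (A ++ [:: y, NE, SE & B])).
Proof.
have dropA C x z : drop (size A).+2 (A ++ [:: x, z & C]) = C.
  by rewrite -2!cat_rcons drop_size_cat // !size_rcons.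
rewrite /move_right /= take_size_cat // dropA /is_peak /=.
have -> : drop (size A).+3 (A ++ [:: y, NE, SE & B]) = B.
  by rewrite -3!cat_rcons drop_size_cat // !size_rcons.
by rewrite drop0; case: B => [|[] [|[] B]].
Qed.

Lemma move_right_end s A :
  move_right ((size A).+1, LPath s (A ++ [:: NE; SE])) =
  ((size A).+2, LPath s (A ++ [:: EE; NE; SE])).
Proof.
have E : drop (size A).+2 (A ++ [:: NE; SE]) = [::].
  by rewrite drop_oversize // size_cat addn2.
by rewrite /move_right /= take_size_cat // E /is_peak /= drop_oversize // size_cat addn3.
Qed.

Lemma iter_move_right s A B t :
  (iter t move_right ((size A).+1, LPath s (A ++ [:: NE, SE & B]))).2 = LPath s (A ++ hop t B).
Proof.
elim: t A B => [//|t IH] A B; rewrite iterSr.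
case: B => [|y B].
  rewrite move_right_end /= -(cat_rcons EE A) -(cat_rcons EE A (hop t [::])).
  by rewrite -IH size_rcons.
rewrite move_right_cat drop0.
have gen : (iter t move_right ((size A).+2, LPath s (A ++ [:: y, NE, SE & B]))).2 =
    LPath s (A ++ y :: hop t B).
  by rewrite -(cat_rcons y A) -(cat_rcons y A (hop t B)) -IH size_rcons.
case: B gen => [|[] [|[] B]] //= _.
have := IH (rcons (rcons (rcons A y) NE) SE) B.
by rewrite !size_rcons !cat_rcons.
Qed.

(** The bound m <= 1 reflects the order of the moves: earlier peaks went at least as far, so a
    vertex that is crossed carries at most the compulsory peak of the uplift. *)
Lemma hop_hats t m x T : (forall B, T <> [:: NE, SE & B]) -> (0 < t -> m <= 1) ->
  hop t.+1 (x :: hats m ++ T) = x :: hats m ++ hop t T.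
Proof.
move=> nT mt; case: t mt => [_|t /(_ isT)].
  have -> : hats m ++ hop 0 T = NE :: SE :: hats m ++ T.
    by rewrite -[hop 0 T]/([:: NE; SE] ++ T) catA -hatsSr.
  by case: (hats m ++ T) => [|[] [|[] ?]].
case: m => [_|[_|//]] //; rewrite [hats 0 ++ _]/=.
by case: T nT => [|[] [|[] w]] // H; case: (H w).
Qed.

Lemma weave_tail_no_hat c v B : weave_tail c v <> [:: NE, SE & B].
Proof.
case: v => //= x v [E1 E2]; have := no_peak_weave (fun q => c q.+1) x v.
by rewrite E2 E1.
Qed.

Lemma starts_SE_cat v e : starts_SE (v ++ nseq e EE) = starts_SE v.
Proof. by case: v => //; case: e. Qed.

Lemma eq_weave_tail c c' v : (forall q, 0 < q <= size v -> c q = c' q) ->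
  weave_tail c v = weave_tail c' v.
Proof.
by case: v => //= x v E; congr cons; apply: eq_weave => q le; apply: E.
Qed.

(* A peak inserted at abscissa 0 and moved [t] times ends up inserted at
   abscissa [t]: it trades places with the uplifted peaks it meets. *)
Lemma hop_weave_tail t c v : (forall q, 0 < q < t -> c q = 0) ->
  (forall q, size v < q -> c q = 0) ->
  hop t (weave_tail c v) = hats (t == 0) ++
  weave_tail (fun q => c q + (q == t)) (v ++ nseq (t - size v) EE).
Proof.
elim: t c v => [|t IH] c v c1 c2.
  rewrite sub0n cats0 /=; congr [:: _, _ & _]; apply: eq_weave_tail => q /andP[q0 _].
  by rewrite (gtn_eqF q0) addn0.
have c1' q : 0 < q < t -> c q.+1 = 0 by move=> ?; apply: c1; lia.
case: v c2 => [|x v] c2.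
  rewrite [hop _ _]/= -[hop t [::]]/(hop t (weave_tail (fun q => c q.+1) [::])).
  rewrite IH //; last by move=> q _; apply: c2.
  rewrite !subn0 /= weaveE c2 //.
  by have -> : starts_SE (nseq t EE) = false; [case: (t) | rewrite add0n addn0 eq_sym].
have c2' q : size v < q -> c q.+1 = 0 by move=> ?; exact: c2.
rewrite [weave_tail c _]/= weaveE hop_hats; last 2 first.
- exact: weave_tail_no_hat.
- by move=> t0; rewrite c1 ?t0 //; case: (_ && _).
rewrite IH // /= weaveE starts_SE_cat subSS.
rewrite -[1 == t.+1]/(0 == t) [0 == t]eq_sym catA -hatsD; congr (_ :: hats _ ++ _); lia.
Qed.

Lemma hop_weave t c v : (forall q, 0 < q < t -> c q = 0) ->
  (forall q, size v < q -> c q = 0) ->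
  hats (c 0) ++ hop t (weave_tail c v) =
  weave (fun q => c q + (q == t)) false (v ++ nseq (t - size v) EE).
Proof.
by move=> c1 c2; rewrite hop_weave_tail // weaveE catA -hatsD addn0 eq_sym.
Qed.

(** Lists the slots of the peaks that [weave] counts by [c]. At a vertex where the path without
    peaks has a peak, one peak is compulsory and is skipped; [pn] is then reset so that the others
    are recorded. *)
Fixpoint parse (p : nat) (pn : bool) (w : seq step) : seq nat :=
  match w with
  | NE :: (SE :: w') =>
      if pn && starts_SE (del_peaks w') then parse p false w' else p :: parse p false w'
  | x :: w' => parse p.+1 (is_NE x) w'
  | [::] => [::]
  end.

Lemma parse_cons p pn x w : no_peak x w -> parse p pn (x :: w) = parse p.+1 (is_NE x) w.
Proof. by case: x w => // -[|[] w]. Qed.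

Lemma parse_bounds p pn w q : q \in parse p pn w -> p <= q <= p + size (del_peaks w).
Proof.
elim/word_ind: w p pn => // [w IH|x w np IH] p pn.
  rewrite /=; case: ifP => _; first exact: IH.
  by rewrite inE => /orP[/eqP->|/IH //]; rewrite leqnn leq_addr.
by rewrite parse_cons // del_peaks_cons // => /IH /=; lia.
Qed.

Lemma weave_parse p pn w : ~~ (pn && starts_SE w) ->
  weave (fun q => count_mem (p + q) (parse p pn w)) pn (del_peaks w) = w.
Proof.
elim/word_ind: w p pn => [|w IH|x w np IH] p pn nb.
- by rewrite /= andbF.
- set l := parse p false w in IH *; have E : hats (count_mem p l) ++
      weave_tail (fun q => count_mem (p + q) l) (del_peaks w) = w.
    by rewrite -[RHS](IH p false) // weaveE !addn0.
  rewrite weaveE [del_peaks _]/= [parse p pn _]/= -/l addn0; case: ifP => _.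
    by rewrite addn1 hatsS /= E.
  rewrite addn0 /= eqxx add1n hatsS /= -[in RHS]E; congr [:: _, _ & _ ++ _].
  apply: eq_weave_tail => q /andP[q0 _].
  by rewrite -{1}(addn0 p) eqn_add2l (ltn_eqF q0).
rewrite del_peaks_cons // weaveE parse_cons //=.
have -> : count_mem (p + 0) (parse p.+1 (is_NE x) w) = 0.
  by apply/count_memPn/negP => /parse_bounds; rewrite addn0 ltnn.
have -> : pn && starts_SE (x :: del_peaks w) = false by case: (pn) nb => //=; case: (x).
congr cons; rewrite -[RHS](IH p.+1 (is_NE x)) //.
by apply: eq_weave => q _; rewrite addSnnS.
Qed.

Lemma weave_inj c c' pn v q : weave c pn v = weave c' pn v -> q <= size v -> c q = c' q.
Proof.
have H m n c1 c2 u : hats m ++ weave_tail c1 u = hats n ++ weave_tail c2 u ->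
    m = n /\ weave_tail c1 u = weave_tail c2 u.
  elim: m n => [|m IH] [|n] // E.
  - by case: (@weave_tail_no_hat c1 u (hats n ++ weave_tail c2 u)).
  - by case: (@weave_tail_no_hat c2 u (hats m ++ weave_tail c1 u)).
  - by case: E => /IH[-> ->].
elim: v c c' pn q => [|x v IH] c c' pn q; rewrite !weaveE => /H[/eqP].
  by rewrite eqn_add2r => /eqP E _; case: q.
rewrite eqn_add2r => /eqP E [] E2; case: q => // q; exact: (IH _ _ _ q E2).
Qed.

(** * Leading South-East steps, trailing East steps, and sums of multiplicities *)

Lemma del_peaks_SE x w : del_peaks (nseq x SE ++ w) = nseq x SE ++ del_peaks w.
Proof. by elim: x => //= x ->. Qed.

Lemma del_peaks_EE w y : del_peaks (w ++ nseq y EE) = del_peaks w ++ nseq y EE.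
Proof.
elim/word_ind: w => [|w IH|x w np IH] /=; first by elim: y => //= y ->.
  exact: IH.
rewrite -/(del_peaks (x :: w ++ nseq y EE)) -/(del_peaks (x :: w)) !del_peaks_cons ?IH //.
by rewrite /no_peak starts_SE_cat.
Qed.

Lemma npeaks_SE x w : npeaks (nseq x SE ++ w) = npeaks w.
Proof. by elim: x. Qed.

Lemma npeaks_EE w y : npeaks (w ++ nseq y EE) = npeaks w.
Proof.
elim/word_ind: w => [|w IH|x w np IH] /=; first by elim: y.
  by rewrite IH.
rewrite -/(npeaks (x :: w ++ nseq y EE)) -/(npeaks (x :: w)) !npeaks_cons ?IH //.
by rewrite /no_peak starts_SE_cat.
Qed.

Lemma sumn_peak_list_EE p w y : sumn (peak_list p (w ++ nseq y EE)) = sumn (peak_list p w).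
Proof.
elim/word_ind: w p => [|w IH|x w np IH] p /=; first by elim: y p => //=.
  by rewrite IH.
rewrite -/(peak_list p (x :: w ++ nseq y EE)) -/(peak_list p (x :: w)).
by rewrite !peak_list_cons ?IH // /no_peak starts_SE_cat.
Qed.

Lemma valid_EE s w y : valid s (w ++ nseq y EE) = valid s w.
Proof.
rewrite /valid flat_cat final_cat; have E c : final c (nseq y EE) = c by elim: y.
rewrite E; case: eqP => [->|_]; rewrite ?andbF // !andbT.
have -> : flat 0 (nseq y EE) by elim: y {E}.
by rewrite andbT.
Qed.

Lemma below_EE K s w y : below K s (w ++ nseq y EE) = below K s w.
Proof.
elim: w s => [|x w IH] s /=; last by rewrite IH.
by rewrite andbT; elim: y => [|y IH] /=; rewrite ?IH ?andbT ?andbb.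
Qed.

Lemma sum_count B l : (forall q, q \in l -> q <= B) ->
  \sum_(q < B.+1) count_mem (q : nat) l = size l.
Proof.
elim: l => [|x l IH] H; first by rewrite big1.
rewrite /= big_split /= IH; last by move=> q ql; apply: H; rewrite inE ql orbT.
have lx : x < B.+1 by apply: H; rewrite inE eqxx.
rewrite (bigD1 (Ordinal lx)) //= eqxx big1 ?addn0 // => i ne.
by apply/eqP; rewrite eqb0; apply: contra ne => /eqP E; apply/eqP/val_inj.
Qed.

Lemma sum_mul_count p B l : (forall q, q \in l -> q <= B) ->
  \sum_(q < B.+1) (p + q) * count_mem (q : nat) l = p * size l + sumn l.
Proof.
elim: l => [|x l IH] H; first by rewrite muln0 big1 // => i _; rewrite muln0.
rewrite /=; under eq_bigr do rewrite mulnDr.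
rewrite big_split /= IH; last by move=> q ql; apply: H; rewrite inE ql orbT.
have lx : x < B.+1 by apply: H; rewrite inE eqxx.
rewrite (bigD1 (Ordinal lx)) //= eqxx big1 ?addn0; first by lia.
move=> i ne; apply/eqP; rewrite muln_eq0 eqb0 orbC.
by rewrite (_ : x != i) //; apply: contra ne => /eqP E; apply/eqP/val_inj.
Qed.

(** As [U] is reversed and exchanged, a North-East step at its head is a South-East step just before
    the peak: read backwards, the path rises at once above c. *)
Lemma rises2_NE c U w : (if U is x :: _ then is_NE x else true) -> rises 2 c U w = false.
Proof.
rewrite /rises subn2 /=; case: U => [|[] U] //= _; rewrite ltnn leqnn /= ?andbF //.
by rewrite (@scan_hi c c c.+1) ?andbF.
Qed.

Lemma peak_list_hats p m R :
  peak_list p (hats m ++ R) = [seq p + i.*2.+1 | i <- iota 0 m] ++ peak_list (p + m.*2) R.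
Proof.
elim: m p => [|m IH] p; first by rewrite addn0.
rewrite /= IH -[iota 1 m]/(iota (1 + 0) m) iotaDl -map_comp addn1; congr (_ :: _ ++ peak_list _ _); last by lia.
by apply: eq_map => i /=; lia.
Qed.

Lemma peak_list_SE p x w : peak_list p (nseq x SE ++ w) = peak_list (p + x) w.
Proof. by elim: x p => [|x IH] p /=; rewrite ?addn0 // IH addSnnS. Qed.

(** Each of the m+1 leading peaks starts the path or follows a South-East step, so its relative
    height is one. They are the leftmost such peaks, and counting from the right, index n-m-1 hits
    the last of them. *)
Lemma unit_peaks_first s x m R n (A := nseq x SE) (w := A ++ hats m.+1 ++ R) :
  valid s w -> npeaks w = n + npeaks (del_peaks w) ->
  size (unit_peaks (LPath s w)) = n /\
  nth 0 (unit_peaks (LPath s w)) (n - m.+1) = (size (A ++ hats m)).+1.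
Proof.
move=> v np; rewrite /unit_peaks size_rev size_filter.
have sz : count (fun z => rel_height (LPath s w) z == 1) (peaks (LPath s w)) = n.
  have c1 := count_rel_heightE 0 v; have c2 := count_rel_heightE 1 v; rewrite /= in c1 c2.
  suff : forall l, count (fun z => 0 < rel_height (LPath s w) z) l =
    count (fun z => rel_height (LPath s w) z == 1) l +
    count (fun z => 1 < rel_height (LPath s w) z) l by move=> /(_ (peaks (LPath s w))); lia.
  by elim=> //= z l ->; case: (rel_height _ z) => [|[|h]] /=; lia.
split=> //; rewrite peaksE in sz *.
set P := (fun z => _ == 1) in sz *.
set l1 := [seq x + i.*2.+1 | i <- iota 0 m.+1].
have Ep : peak_list 0 w = l1 ++ peak_list (x + m.+1.*2) R.
  by rewrite /w peak_list_SE add0n peak_list_hats.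
have Pl1 : all P l1.
  apply/allP => z /mapP[i]; rewrite mem_iota => /andP[_ im] ->.
  set u := A ++ hats i; have su : (size u).+1 = x + i.*2.+1.
    by rewrite size_cat size_nseq size_hats addnS.
  have Ew : w = u ++ [:: NE, SE & hats (m - i) ++ R].
    rewrite /w /u -catA; congr (_ ++ _); have -> : m.+1 = i + (m - i).+1 by lia.
    by rewrite hatsD -catA.
  rewrite /P -su Ew eqn_leq rel_height_gt0 -?Ew // andbT leqNgt Ew rel_heightE -?Ew //.
  apply/negbT/rises2_NE; rewrite /u; case: (i) => [|i']; last first.
    by rewrite hatsSr rev_cat rev_cat.
  by rewrite cats0 /A; case: (x) => // x'; rewrite -addn1 nseqD rev_cat.
have sl1 : size l1 = m.+1 by rewrite size_map size_iota.
have cl1 : count P l1 = m.+1 by rewrite -sl1; apply/eqP; rewrite -all_count.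
have le : m.+1 <= n by rewrite -sz Ep count_cat cl1 leq_addr.
rewrite nth_rev size_filter sz; last by lia.
have -> : n - (n - m.+1).+1 = m by lia.
rewrite Ep filter_cat (all_filterP Pl1) nth_cat sl1 ltnSn (nth_map 0) ?size_iota // nth_iota //.
by rewrite size_cat size_nseq size_hats addnS.
Qed.

Lemma head_geq_max p q : sorted geq p -> q \in p -> q <= head 0 p.
Proof.
case: p => //= t p srt; rewrite inE => /orP[/eqP-> //|qp].
by have /allP/(_ q qp) := order_path_min geq_trans srt.
Qed.

(* The path after one round of psi, before the uplift: East steps are appended
   to [v] so that every abscissa in [p] is reached. *)
Definition stage (x : nat) (p : seq nat) (v : seq step) : seq step :=
  nseq x SE ++ weave (fun q => count_mem q p) false (v ++ nseq (head 0 p - size v) EE).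

Lemma slots_SE y x w : slots y (nseq x SE ++ w) = slots (y + x) w.
Proof.
elim: x y => [|x IH] y; first by rewrite addn0.
by rewrite [nseq _ _ ++ _]/= slots_cons // IH addSnnS.
Qed.

Section Stage.
Variables (x : nat) (p : seq nat) (v : seq step).
Hypothesis srt : sorted geq p.
Let V := v ++ nseq (head 0 p - size v) EE.

Lemma stage_le q : q \in p -> q <= size V.
Proof. by move=> /(head_geq_max srt); rewrite /V size_cat size_nseq; lia. Qed.

Lemma del_peaks_stage : del_peaks (stage x p v) = nseq x SE ++ V.
Proof. by rewrite /stage del_peaks_SE del_peaks_weave. Qed.

Lemma npeaks_stage : npeaks (stage x p v) = npeaks v + size p.
Proof.
by rewrite /stage npeaks_SE npeaks_weave sum_count ?npeaks_EE ?addn0 1?addnC //; exact: stage_le.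
Qed.

Lemma sumn_stage : sumn (peak_list 0 (stage x p v)) =
  (npeaks v + size p) ^ 2 + x * (npeaks v + size p) + sumn p + sumn (peak_list 0 v).
Proof.
rewrite sumn_peak_list npeaks_stage.
have -> : slots 0 (stage x p v) = slots x (weave (fun q => count_mem q p) false V).
  by rewrite /stage slots_SE.
have sx y w : sumn (peak_list y w) = sumn (peak_list 0 w) + y * npeaks w.
  by elim: y => [|y IH]; rewrite ?addn0 // sumn_peak_listS IH; lia.
rewrite slots_weave sum_mul_count; last exact: stage_le.
rewrite sx sumn_peak_list_EE npeaks_EE andFb mul0n mulnDr.
by move: (x * _) (x * _) (_ ^ 2) (sumn p) => *; lia.
Qed.

End Stage.

(** [word l] is the path once the peaks of [l] have been moved, the others still waiting in front.
    As [p] decreases, every earlier peak has travelled at least as far ([tl]), which is what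
    [hop_weave] needs. *)
Lemma move_unit_peak_stage s x p v j (n := size p)
  (word := fun l => nseq x SE ++ hats (n - size l) ++
     weave (fun q => count_mem q l) false (v ++ nseq (head 0 l - size v) EE)) :
  sorted geq p -> valid s (nseq x SE ++ v) -> j < n ->
  move_unit_peak j (nth 0 p j) (LPath s (word (take j p))) = Some (LPath s (word (take j.+1 p))).
Proof.
move=> srt vv jn; set t := nth 0 p j; set l := take j p.
have El : take j.+1 p = rcons l t by rewrite (take_nth 0).
have sl : size l = j by rewrite size_takel // ltnW.
have srtl : sorted geq l by exact: take_sorted.
have tl q : q \in l -> t <= q.
  case/(nthP 0) => i; rewrite sl => ij <-; rewrite nth_take //.
  have := sorted_leq_nth geq_trans leqnn 0 srt.
  by apply=> //; [exact: ltn_trans jn | exact: ltnW].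
have [m Em] : exists m, n - j = m.+1 by exists (n - j).-1; lia.
set h := head 0 l; set V := v ++ nseq (h - size v) EE.
pose c q := count_mem q l.
have lV q : q \in l -> q <= size V by exact: stage_le.
have Ew : word l = nseq x SE ++ hats m.+1 ++ weave c false V by rewrite /word sl Em.
have dw : del_peaks (word l) = nseq x SE ++ V by rewrite Ew del_peaks_SE del_peaks_hats del_peaks_weave.
have vw : valid s (word l) by rewrite -valid_del_peaks dw /V catA valid_EE.
have npw : npeaks (word l) = n + npeaks (del_peaks (word l)).
  rewrite dw Ew !npeaks_SE npeaks_hats npeaks_weave sum_count // sl; lia.
have [su nu] : size (unit_peaks (LPath s (word l))) = n /\
    nth 0 (unit_peaks (LPath s (word l))) (n - m.+1) = (size (nseq x SE ++ hats m)).+1.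
  by move: vw npw; rewrite Ew; exact: unit_peaks_first.
have Ej : n - m.+1 = j by lia.
rewrite Ej in nu; rewrite El /move_unit_peak su jn nu -/t; congr Some.
have EV : V ++ nseq (t - size V) EE = v ++ nseq (head 0 (rcons l t) - size v) EE.
  rewrite /V size_cat size_nseq /h; case: (l) tl => [|q l'] tl /=; first by rewrite cats0 sub0n addn0.
  have := tl q; rewrite inE eqxx => /(_ isT) tq.
  by rewrite (_ : t - _ = 0) ?cats0 //; lia.
have Ec q : count_mem q (rcons l t) = c q + (q == t).
  by rewrite -cats1 count_cat /= addn0 eq_sym.
have Ew2 : word (rcons l t) = nseq x SE ++ hats m ++ hats (c 0) ++ hop t (weave_tail c V).
  rewrite hop_weave; last 2 first.
  - by move=> q /andP[_ qt]; apply/count_memPn/negP => /tl; lia.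
  - by move=> q qV; apply/count_memPn/negP => /lV; lia.
  rewrite /word size_rcons sl EV; congr (_ ++ hats _ ++ _); first by lia.
  exact: eq_weave.
rewrite Ew2.
(* With no move to make, the waiting peak is only reinterpreted as one inserted at abscissa 0. *)
case: (posnP t) => [t0|t0].
  rewrite t0 /= Ew; congr (LPath _ (_ ++ _)).
  have -> : [:: NE, SE & weave_tail c V] = hats 1 ++ weave_tail c V by [].
  rewrite weaveE andFb addn0 catA -hatsD [hats (c 0) ++ hats 1 ++ _]catA -hatsD catA -hatsD.
  by congr (hats _ ++ _); lia.
have c0 : c 0 = 0 by apply/count_memPn/negP => /tl; lia.
rewrite Ew weaveE c0 hatsSr catA [hats 0 ++ hop _ _]/= [hats (0 + _)]/= catA.
by rewrite [in RHS]catA -iter_move_right -!catA.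
Qed.

Lemma move_peaks_stage s x p v : sorted geq p -> valid s (nseq x SE ++ v) ->
  move_peaks (size p) p (LPath s (nseq x SE ++ hats (size p) ++ uplift_steps v)) =
  Some (LPath s (stage x p v)).
Proof.
move=> srt vv; rewrite /move_peaks.
set word := fun l => nseq x SE ++ hats (size p - size l) ++
     weave (fun q => count_mem q l) false (v ++ nseq (head 0 l - size v) EE).
have -> : nseq x SE ++ hats (size p) ++ uplift_steps v = word (take 0 p).
  by rewrite take0 /word subn0 sub0n cats0 uplift_weave.
have -> : stage x p v = word p by rewrite /word subnn.
suff H j : j <= size p -> foldl
    (fun oL j => obind (move_unit_peak j (nth 0 p j)) oL)
    (Some (LPath s (word (take 0 p)))) (iota 0 j) = Some (LPath s (word (take j p))).
  by rewrite H // take_size.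
elim: j => [//|j IH] jn; rewrite -addn1 iotaD foldl_cat IH ?(ltnW jn) //= addn1.
exact: move_unit_peak_stage.
Qed.

Definition ends_SE (w : seq step) : bool := if w is x :: w' then is_SE (last x w') else true.

Lemma ends_SEP w : reflect (w = [::] \/ last EE w = SE) (ends_SE w).
Proof.
case: w => [|x w] /=; first by left; left.
by apply: (iffP idP) => [|[]//]; [case: (last x w); right | move=> ->].
Qed.

Lemma ends_SE_cons x w : w <> [::] -> ends_SE (x :: w) = ends_SE w.
Proof. by case: w. Qed.

Lemma ends_SE_hats n w : ends_SE w -> ends_SE (hats n ++ w).
Proof. by elim: n => [//|n IH] /IH; rewrite hatsS /=; case: (hats n ++ w). Qed.

Lemma ends_SE_hats_cons n x w : ends_SE (hats n ++ x :: w) = ends_SE (x :: w).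
Proof. by elim: n => [//|n IH]; rewrite hatsS -IH /=; case: n {IH}. Qed.

Lemma ends_SE_weave c pn v : ends_SE (weave c pn v) = ends_SE v || (0 < c (size v)).
Proof.
elim: v c pn => [|x v IH] c pn; rewrite weaveE.
  by rewrite ends_SE_hats.
rewrite [weave_tail _ _]/= ends_SE_hats_cons.
case: v IH => [|y v] IH.
  rewrite weaveE andbF addn0 cats0 /=; case: (c 1) => [|m]; first by rewrite orbF.
  by rewrite hatsSr /= last_cat orbT.
rewrite ends_SE_cons; first by rewrite IH.
by move=> E; have := del_peaks_weave (fun q => c q.+1) (is_NE x) (y :: v); rewrite E.
Qed.

Lemma cat_EE_rcons v e : v ++ nseq e.+1 EE = rcons (v ++ nseq e EE) EE.
Proof. by rewrite -cats1 -catA -[[:: EE]]/(nseq 1 EE) -nseqD addn1. Qed.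

Lemma ends_SE_EE v e : ends_SE (v ++ nseq e.+1 EE) = false.
Proof.
rewrite cat_EE_rcons.
by case: (v ++ _) => //= y u; rewrite last_rcons.
Qed.

Lemma strip_EE s w : valid s w -> exists v e, w = v ++ nseq e EE /\ ends_SE v.
Proof.
elim/last_ind: w => [|w y IH] v; first by exists [::], 0.
case: y v => v.
- by move: v; rewrite /valid -cats1 final_cat /= andbF.
- exists (rcons w SE), 0; rewrite cats0; split=> //.
  by case: (w) => //= z u; rewrite last_rcons.
- rewrite -cats1 -[[:: EE]]/(nseq 1 EE) valid_EE in v.
  have [u [e [-> es]]] := IH v; by exists u, e.+1; rewrite cat_EE_rcons.
Qed.

Lemma strip_uniq v v' e e' : v ++ nseq e EE = v' ++ nseq e' EE ->
  ends_SE v -> ends_SE v' -> v = v'.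
Proof.
elim: e e' => [|e IH] [|e'].
- by rewrite !cats0.
- by rewrite cats0 => -> /=; rewrite ends_SE_EE.
- by rewrite cats0 => <- _; rewrite ends_SE_EE.
- by rewrite !cat_EE_rcons => /rcons_inj[]; exact: IH.
Qed.

Lemma nseq_SE_inj x (u w : seq step) : nseq x SE ++ u = nseq x SE ++ w -> u = w.
Proof. by elim: x => //= x IH [/IH]. Qed.

(** Deleting the peaks returns [v] followed by East steps, which [ends_SE] allows to strip
    unambiguously; then the numbers of inserted peaks return the multiplicities of [p]. *)
Lemma stage_inj x p p' v v' : sorted geq p -> sorted geq p' -> ends_SE v -> ends_SE v' ->
  stage x p v = stage x p' v' -> p = p' /\ v = v'.
Proof.
move=> srt srt' ev ev' E.
have EV : v ++ nseq (head 0 p - size v) EE = v' ++ nseq (head 0 p' - size v') EE.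
  by apply: (@nseq_SE_inj x); rewrite -!del_peaks_stage E.
split; last exact: strip_uniq EV ev ev'.
have le := stage_le v srt; have le' := stage_le v' srt'.
move/nseq_SE_inj: E; rewrite EV in le *; set V := (v' ++ _) in le le' * => E.
apply: (sorted_eq geq_trans _ srt srt'); first by move=> y z /andP[h1 h2]; apply/eqP; rewrite eqn_leq; exact/andP.
apply: freq_eq_perm => q; case: (leqP q (size V)) => qV.
  exact: (weave_inj E qV).
have n1 : q \notin p by apply/negP => /le; rewrite leqNgt qV.
have n2 : q \notin p' by apply/negP => /le'; rewrite leqNgt qV.
by rewrite /freq (count_memPn n1) (count_memPn n2).
Qed.

Definition path_ok (K s : nat) (w : seq step) : bool := [&& valid s w, below K s w & ends_SE w].

Section StageLevel.
Variables (k a i : nat).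
Hypotheses (a0 : 0 < a) (ak : a <= k) (i0 : 0 < i) (ik : i < k).
Let x : nat := nat_of_bool (a <= i).
(** The start height after round i: the added South-East step raises it by one when i >= a, and it
    stays k - a when i < a. The height bound after that round is k - i. *)
Let s := k - maxn a i.
Let s' := k - maxn a i.+1.

Lemma level_start : s = s' + x /\ s' <= k - i.+1.
Proof. by rewrite /s /s' /x; case: leqP; lia. Qed.

Lemma valid_level w : valid s (nseq x SE ++ w) = valid s' w.
Proof.
have [-> _] := level_start; case: (x) (leq_b1 (a <= i) : x <= 1) => [|[|y]] //= _.
- by rewrite addn0.
- by rewrite addn1.
Qed.

Lemma below_level w : below (k - i) s (nseq x SE ++ w) = below (k - i) s' w.
Proof.
have [-> le] := level_start; case: (x) (leq_b1 (a <= i) : x <= 1) => [|[|y]] //= _.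
- by rewrite addn0.
- by rewrite addn1 /= (_ : s' < k - i) //; lia.
Qed.

Lemma stage_ok p v : sorted geq p -> path_ok (k - i.+1) s' v -> path_ok (k - i) s (stage x p v).
Proof.
move=> srt /and3P[vv bv ev]; have [_ le] := level_start.
set W := weave (fun q => count_mem q p) false (v ++ nseq (head 0 p - size v) EE).
have vW : valid s' W by rewrite -valid_del_peaks del_peaks_weave valid_EE.
apply/and3P; split.
- by rewrite valid_level.
- rewrite below_level -/W (_ : k - i = (k - i.+1).+1); last by lia.
  by rewrite below_del_peaks // del_peaks_weave below_EE.
- have eW : ends_SE W.
    rewrite ends_SE_weave; case E: (head 0 p - size v) => [|e]; first by rewrite cats0 ev.
    (* East steps are appended only as far as the largest entry of [p], so a peak is inserted at the
       very end. *)
    apply/orP; right; rewrite size_cat size_nseq -has_count has_pred1 -E subnKC; last by lia.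
    by case: (p) E => [|t p'] /=; [lia | rewrite inE eqxx].
  rewrite /stage -/W; case: (x) => [|y] //=.
  by elim: y => [|y IH] //=; case: (W) eW.
Qed.

Lemma stage_surj w : path_ok (k - i) s w ->
  exists p v, [/\ sorted geq p, path_ok (k - i.+1) s' v & stage x p v = w].
Proof.
have [_ le] := level_start.
move=> ow; have [w1 Ew] : exists w1, w = nseq x SE ++ w1.
  (* For a <= i the path starts at its maximal height k - i > 0: it cannot rise, cannot go East and
     cannot be empty, so it starts with a South-East step. *)
  rewrite /x; case: leqP => ai; last by exists w.
  move: ow; rewrite /path_ok /s (maxn_idPr ai) => /and3P[+ + _].
  have ki : 0 < k - i by lia.
  case: w => [|[] w] /=.
  - by rewrite /valid /=; lia.
  - by move=> _ /andP[_ /below_le]; rewrite ltnn.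
  - by exists w.
  - by rewrite /valid /= => /andP[/andP[/eqP E]]; rewrite E in ki.
move: ow; rewrite Ew => /and3P[]; rewrite valid_level below_level => vw bw ew.
have {}ew : ends_SE w1.
  move: ew; elim: (x) => //= y IH; case: y IH => [|y] IH; last by move=> h; apply: IH.
  by case: (w1).
have [v [e [Ev ev]]] : exists v e, del_peaks w1 = v ++ nseq e EE /\ ends_SE v.
  by apply: (@strip_EE s'); rewrite valid_del_peaks.
set l := parse 0 false w1; set p := sort geq l.
have geq_total : total geq by move=> y z; exact: leq_total.
have srt : sorted geq p by exact: sort_sorted.
have pc q : count_mem q p = count_mem q l by apply/permP; rewrite perm_sort.
have Ew1 : weave (fun q => count_mem q p) false (del_peaks w1) = w1.
  by rewrite -[RHS](@weave_parse 0 false) //; apply: eq_weave => q _; rewrite pc.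
have pl q : q \in p -> q <= size v + e.
  by rewrite mem_sort => /parse_bounds; rewrite add0n Ev size_cat size_nseq.
(* If e > 0 then, because [w] ends with a South-East step, a peak occupies the last slot. So the
   number of East steps can be read from the largest entry of [p]. *)
have he : head 0 p - size v = e.
  have h1 : head 0 p <= size v + e by case: (p) pl => //= t u; apply; rewrite inE eqxx.
  case: (posnP e) => [e0|]; first by lia.
  case: e Ev pl h1 => // e Ev pl h1 _.
  have : size v + e.+1 \in p.
    move: ew; rewrite -Ew1 ends_SE_weave Ev ends_SE_EE orFb size_cat size_nseq.
    by rewrite -has_count has_pred1.
  by move/(head_geq_max srt); lia.
exists p, v; split=> //; last by rewrite /stage he -Ev Ew1.
apply/and3P; split=> //.
- by rewrite -(valid_EE _ _ e) -Ev valid_del_peaks.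
- rewrite -(below_EE _ _ _ e) -Ev -below_del_peaks //.
  by rewrite (_ : (k - i.+1).+1 = k - i) //; lia.
Qed.

End StageLevel.

(** * The map psi *)

Fixpoint path_from (a : nat) (pis : seq (seq nat)) (i : nat) (v : seq step) : seq step :=
  if i is i'.+1 then path_from a pis i' (stage (a <= i) (nth [::] pis i') v) else v.

Lemma path_from_rcons a pis p i v : i <= size pis ->
  path_from a (rcons pis p) i v = path_from a pis i v.
Proof. by elim: i v => //= i IH v lt; rewrite IH ?(ltnW lt) // nth_rcons lt. Qed.

Lemma path_from_weight a pis v : all (sorted geq) pis ->
  sumn (peak_list 0 (path_from a pis (size pis) v)) =
  weight a (npeaks v) pis + sumn (peak_list 0 v).
Proof.
elim/last_ind: pis v => [|pis p IH] v; first by rewrite /weight big_ord0.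
rewrite all_rcons => /andP[srt al]; rewrite size_rcons /= path_from_rcons //.
rewrite nth_rcons ltnn eqxx IH // weight_rcons npeaks_stage // sumn_stage //.
by move: (weight _ _ _) (_ ^ 2) (_ * _) => *; lia.
Qed.

(** Deleting the peaks of all rounds leaves only South-East steps in front and East steps behind,
    which carry no peak. *)
Lemma path_from_del_peaks a pis v : exists x y,
  iter (size pis) del_peaks (path_from a pis (size pis) v) = nseq x SE ++ v ++ nseq y EE.
Proof.
elim/last_ind: pis v => [|pis p IH] v; first by exists 0, 0; rewrite cats0.
rewrite size_rcons /= path_from_rcons // nth_rcons ltnn eqxx.
have [x [y ->]] := IH (stage (a <= (size pis).+1) p v).
rewrite del_peaks_SE del_peaks_EE del_peaks_stage.
exists (x + (a <= (size pis).+1)), (head 0 p - size v + y).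
by rewrite !nseqD -!catA.
Qed.

Lemma path_from_npeaks a pis v j : all (sorted geq) pis -> j <= size pis ->
  npeaks (iter j del_peaks (path_from a pis (size pis) v)) = npeaks v + part_total j pis.
Proof.
elim/last_ind: pis v => [|pis p IH] v.
  by rewrite leqn0 => _ /eqP->; rewrite addn0.
move=> al; rewrite leq_eqVlt => /orP[/eqP->|].
  have [x [y ->]] := path_from_del_peaks a (rcons pis p) v.
  by rewrite npeaks_SE npeaks_EE part_total_oversize // addn0.
move: al; rewrite all_rcons => /andP[srt al]; rewrite size_rcons ltnS => le.
rewrite part_total_rcons //= path_from_rcons // nth_rcons ltnn eqxx IH //.
by rewrite npeaks_stage // -addnA [size p + _]addnC.
Qed.

Section Paths.
Variables (k a : nat).
Hypotheses (a0 : 0 < a) (ak : a <= k).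
Local Notation level i := (path_ok (k - i) (k - maxn a i)).

Lemma sorted_nth_pis pis i : all (sorted geq) pis -> sorted geq (nth [::] pis i).
Proof.
move=> al; case: (ltnP i (size pis)) => h; last by rewrite nth_default.
exact: (allP al) (mem_nth _ h).
Qed.

(** Here [v] is the path before the uplift that closes the previous round. The last round has no
    uplift, whence the tests on i; at the start [v] is empty and the uplift does nothing. *)
Lemma psi_from_path mu pis i v s0 : i < k -> all (sorted geq) pis ->
  (forall j, 0 < j <= i -> nb_clusters j mu = size (nth [::] pis j.-1)) ->
  level i.+1 v ->
  psi_from k a mu pis i (LPath s0 (if 0 < i then uplift_steps v else v)) =
  Some (LPath (if 0 < i then k - maxn a 1 else s0) (path_from a pis i v)).
Proof.
elim: i v s0 => [//|i IH] v s0 ik al nb lv; rewrite [psi_from _ _ _ _ _ _]/=.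
set p := nth [::] pis i; have srt : sorted geq p by exact: sorted_nth_pis.
rewrite nb ?leqnn //= -/p.
set x := nat_of_bool (a <= i.+1); set L2 := (if a <= i.+1 then _ else _).
have -> : L2 = LPath (k - maxn a i.+1) (nseq x SE ++ hats (size p) ++ uplift_steps v).
  rewrite /L2 /x /insert_peaks; by case: leqP.
have i1 : 0 < i.+1 by [].
rewrite move_peaks_stage //; last by rewrite valid_level //; case/and3P: lv.
have ls := stage_ok a0 ak i1 ik srt lv.
rewrite -/x in ls.
have nb' j : 0 < j <= i -> nb_clusters j mu = size (nth [::] pis j.-1).
  by move=> /andP[j0 ji]; apply: nb; rewrite j0 ltnW.
have := IH (stage x p v) (k - maxn a i.+1) (ltnW ik) al nb' ls.
rewrite /volcanic_uplift [1 < i.+1]ltnS; case: (posnP i) => [E|//].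
by move=> ->; rewrite /= {1}E.
Qed.

Lemma path_from_ok pis i v : i < k -> all (sorted geq) pis -> level i.+1 v ->
  level 1 (path_from a pis i v).
Proof.
elim: i v => //= i IH v ik al lv; apply: IH => //; first exact: ltnW.
by apply: stage_ok => //; exact: sorted_nth_pis.
Qed.

Lemma path_from_inj pis pis' i v v' : i < k -> all (sorted geq) pis -> all (sorted geq) pis' ->
  level i.+1 v -> level i.+1 v' -> path_from a pis i v = path_from a pis' i v' ->
  v = v' /\ forall j, j < i -> nth [::] pis j = nth [::] pis' j.
Proof.
elim: i v v' => //= i IH v v' ik al al' lv lv' E.
have srt := sorted_nth_pis i al; have srt' := sorted_nth_pis i al'.
have i1 : 0 < i.+1 by [].
have [E1 E2] := IH _ _ (ltnW ik) al al' (stage_ok a0 ak i1 ik srt lv)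
  (stage_ok a0 ak i1 ik srt' lv') E.
have ev : ends_SE v by case/and3P: lv.
have ev' : ends_SE v' by case/and3P: lv'.
have [E3 E4] := stage_inj srt srt' ev ev' E1; split=> // j.
by rewrite ltnS leq_eqVlt => /orP[/eqP->|/E2].
Qed.

Lemma path_from_surj i w : i < k -> level 1 w ->
  exists pis v, [/\ size pis = i, all (sorted geq) pis, level i.+1 v & path_from a pis i v = w].
Proof.
elim: i => [|i IH] ik lw; first by exists [::], w.
have [pis [v [sz al lv E]]] := IH (ltnW ik) lw.
have i1 : 0 < i.+1 by [].
have [p [v' [srt lv' Es]]] := stage_surj a0 ak i1 ik lv.
exists (rcons pis p), v'; split=> //.
- by rewrite size_rcons sz.
- by rewrite all_rcons srt.
- by rewrite /= path_from_rcons ?sz // nth_rcons sz ltnn eqxx Es.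
Qed.

(** Height bound 0 leaves only East steps, and a nonempty path must end with South-East. *)
Lemma level_top v : level k v -> v = [::].
Proof.
rewrite subnn (maxn_idPr ak) subnn => /and3P[vv bv ev].
case: v vv bv ev => // -[] v.
- by move=> _ /andP[_ /below_le].
- by rewrite /valid.
rewrite /valid => /= vv bv ev; exfalso.
have H u : below 0 0 u -> valid 0 u -> all (fun y => ~~ is_SE y) u.
  by elim: u => //= -[] u IH; rewrite /valid //= => /below_le.
have := H (EE :: v) bv vv; move=> /= av.
elim/last_ind: v ev av {vv bv H} => // v y _; rewrite last_rcons all_rcons => yS /andP[].
by rewrite yS.
Qed.

Lemma level_nil : level k [::].
Proof. by rewrite subnn (maxn_idPr ak) subnn. Qed.

Lemma special_path_level s w : special_path k a (LPath s w) <-> s = k - a /\ level 1 w.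
Proof.
have k0 : 0 < k by lia.
rewrite (maxn_idPl a0); split.
- case=> /is_lattice_pathP[v e] /= es H; split=> //; rewrite -es.
  apply/and3P; split=> //; last exact/ends_SEP.
  apply/belowP => x xs; have := H x xs; rewrite heightE; last by case/andP: v.
  by lia.
- case=> -> /and3P[v b e]; split=> //.
  + by apply/is_lattice_pathP; split=> //; exact/ends_SEP.
  + move=> x xs; rewrite heightE; last by case/andP: v.
    by move/belowP: b => /(_ x xs); lia.
Qed.

End Paths.

Section Main.
Variables (k a : nat).
Hypotheses (a0 : 0 < a) (ak : a <= k).

Lemma phi_psiP la : admissible a k.-1 0 la -> exists mu pis,
  [/\ phi k a la = Some (mu, pis), size pis = k.-1, all (sorted geq) pis,
      phi_psi k a la = Some (LPath (k - a) (path_from a pis k.-1 [::])) &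
      (forall j, 0 < j <= k.-1 -> size (marked j la) = part_total j.-1 pis) /\
      sumn la = weight a 0 pis].
Proof.
move=> adm; have k0 : 0 < k by lia.
have [mu [pis [E [sz al] nb mk wt]]] := phi_fromP a0 adm (erefl (size [::])).
exists mu, pis; rewrite /phi_psi /phi E /= ; split=> //; last by rewrite exp0n // !muln0 !addn0 in wt.
have lt : k.-1 < k by lia.
have lv : path_ok (k - k.-1.+1) (k - maxn a k.-1.+1) [::] by rewrite prednK //; exact: level_nil.
have nb' j : 0 < j <= k.-1 -> nb_clusters j mu = size (nth [::] pis j.-1).
  by move=> jr; rewrite nb jr.
have := psi_from_path a0 ak 0 lt al nb' lv; rewrite if_same /psi => ->.
(* If k = 1 there is no round at all; then a = 1 and the initial height 0 is k - a. *)
by case: posnP => H; rewrite ?(maxn_idPl a0) //; congr (Some (LPath _ _)); lia.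
Qed.

Lemma path_from_special pis : size pis = k.-1 -> all (sorted geq) pis ->
  special_path k a (LPath (k - a) (path_from a pis k.-1 [::])) /\
  major_index (LPath (k - a) (path_from a pis k.-1 [::])) = weight a 0 pis /\
  forall i, 0 < i <= k.-1 ->
    count (fun x => i <= rel_height (LPath (k - a) (path_from a pis k.-1 [::])) x)
      (peaks (LPath (k - a) (path_from a pis k.-1 [::]))) = part_total i.-1 pis.
Proof.
move=> sz al; have k0 : 0 < k by lia.
have lt : k.-1 < k by lia.
have lv : path_ok (k - k.-1.+1) (k - maxn a k.-1.+1) [::] by rewrite prednK //; exact: level_nil.
have lv1 := path_from_ok a0 ak lt al lv.
split; first exact/special_path_level.
have v : valid (k - a) (path_from a pis k.-1 [::]) by case/and3P: lv1; rewrite (maxn_idPl a0).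
split; first by rewrite /major_index peaksE -sz path_from_weight // addn0.
case=> // i /andP[_ ik]; rewrite count_rel_heightE // -sz path_from_npeaks //.
by rewrite sz ltnW.
Qed.

End Main.

Theorem mainTheorem5 (k a n : nat) (N : nat -> nat)
    (ha : 1 <= a) (hak : a <= k)
    (hN : forall i : nat, 1 <= i -> i < k.-1 -> N i.+1 <= N i) :
  set_bij (B_set k a N n) [set Some L | L in E_set k a N n]%classic (phi_psi k a).
Proof.
have k0 : 0 < k by lia.
split.
- move=> la [/(gordon_admissible _ _ ha hak)[srt adm sn] HN].
  have [mu [pis [_ sz al -> [mk wt]]]] := phi_psiP ha hak adm.
  have [sp [mj ct]] := path_from_special ha hak sz al.
  exists (LPath (k - a) (path_from a pis k.-1 [::])) => //; split=> //.
    by rewrite mj -wt.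
  by move=> i ik; rewrite ct // -mk // HN.
- move=> la1 la2; rewrite !inE.
  move=> [/(gordon_admissible _ _ ha hak)[srt1 adm1 _] _].
  move=> [/(gordon_admissible _ _ ha hak)[srt2 adm2 _] _].
  have [mu1 [pis1 [E1 sz1 al1 -> _]]] := phi_psiP ha hak adm1.
  have [mu2 [pis2 [E2 sz2 al2 -> _]]] := phi_psiP ha hak adm2.
  case=> E; have lt : k.-1 < k by lia.
  have lv : path_ok (k - k.-1.+1) (k - maxn a k.-1.+1) [::].
    by rewrite prednK //; exact: level_nil.
  have [_ E3] := path_from_inj ha hak lt al1 al2 lv lv E.
  have E4 : pis1 = pis2.
    by apply: (@eq_from_nth _ [::]); rewrite sz1 ?sz2.
  rewrite E4 in E1.
  apply: (sorted_eq geq_trans _ srt1 srt2).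
    by move=> y z /andP[h1 h2]; apply/eqP; rewrite eqn_leq; exact/andP.
  exact: (phi_from_inj ha adm1 adm2 _ _ E1 E2).
- move=> _ [[s w] [sp mj ct] <-].
  have [-> lw] := (special_path_level ha hak s w).1 sp.
  have lt : k.-1 < k by lia.
  have [pis [v [sz al lv Ew]]] := path_from_surj ha hak lt lw.
  have v0 : v = [::] by apply: (level_top hak); rewrite prednK in lv.
  subst v; have [la' [adm' H]] := phi_from_surj 0 ha sz al.
  pose la := sort geq la'.
  have pl : perm_eq la' la by rewrite perm_sym perm_sort.
  have adm := admissible_perm pl adm'.
  have srt : sorted geq la by apply: sort_sorted => x y; exact: leq_total.
  have [mu' E] := H la [::] pl erefl.
  have [mu [pis' [E2 sz2 al2 E3 [mk wt]]]] := phi_psiP ha hak adm.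
  have Ep : pis' = pis by move: E2; rewrite /phi E => -[].
  subst pis'; have [_ [mj2 ct2]] := path_from_special ha hak sz al.
  have Es : s = k - a by case/(special_path_level ha hak): sp.
  subst s; rewrite -Ew in mj ct *.
  exists la => //; split.
    by apply/gordon_admissible => //; split=> //; rewrite wt -mj2.
  by move=> i ik; rewrite mk // -ct2 // ct.
Qed.
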